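(* Let $\mathbf{E}\subset\mathbb{C}^{\mathbb{Z}^+}$ be a Banach space of sequences such that: (i) the set $F(\mathbb{Z}^+)$ of finitely supported sequences on $\mathbb{Z}^+$ is contained in and dense in $\mathbf{E}$; (ii) for every $n\in\mathbb{Z}^+$ the map $p_n:x\mapsto x(n)$ is continuous from $\mathbf{E}$ into $\mathbb{C}$; (iii) for every $x=(x(n))_{n\in\mathbb{Z}^+}\in\mathbf{E}$ and every $z\in\mathbb{T}$, $\gamma_z(x)=(z^nx(n))_{n\in\mathbb{Z}^+}\in\mathbf{E}$, and $\sup_{z\in\mathbb{T}}\|\gamma_z\|<+\infty$. Suppose that at least one of the operators $\mathbf{S}$ and $\mathbf{S}_{-1}$ is bounded. Let $T$ be a Toeplitz operator on $\mathbf{E}$. Then: 1) For every $r>0$ with $r\in\Bigl[\frac{1}{\rho(\mathbf{S}_{-1})},\rho(\mathbf{S})\Bigr]$ if $\rho(\mathbf{S})<+\infty$, or with $r\in\Bigl[\frac{1}{\rho(\mathbf{S}_{-1})},+\infty\Bigr[$ if $\rho(\mathbf{S})=+\infty$, we have $\widetilde{T}\in L^\infty(C_r)$ and $|\widetilde{T}(z)|\leq\|T\|$ for almost every $z\in C_r$. 2) If $\mathbf{S}$ and $\mathbf{S}_{-1}$ are bounded and $\frac{1}{\rho(\mathbf{S}_{-1})}<\rho(\mathbf{S})$, then $\widetilde{T}\in\mathcal{H}^\infty(\overset{\circ}{\mathbf{\Omega}})$, where $\mathbf{\Omega}:=\Bigl\{z\in\mathbb{C}:\frac{1}{\rho(\mathbf{S}_{-1})}\leq|z|\leq\rho(\mathbf{S})\Bigr\}$.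 3) If $\mathbf{S}$ is not bounded, but $\mathbf{S}_{-1}$ is bounded, then $\widetilde{T}\in\mathcal{H}^\infty(\overset{\circ}{U})$, where $U:=\Bigl\{z\in\mathbb{C}:\frac{1}{\rho(\mathbf{S}_{-1})}\leq|z|\Bigr\}$. 4) If $\mathbf{S}$ is bounded, but $\mathbf{S}_{-1}$ is not bounded, then $\widetilde{T}\in\mathcal{H}^\infty(\overset{\circ}{V})$, where $V:=\Bigl\{z\in\mathbb{C}:|z|\leq\rho(\mathbf{S})\Bigr\}$.
   Context: $\mathbb{Z}^+=\{0,1,2,\dots\}$, $\mathbb{T}=\{z\in\mathbb{C}:|z|=1\}$, $C_r=\{z\in\mathbb{C}:|z|=r\}$ for $r>0$. $F(\mathbb{Z}^+)$ is the set of sequences on $\mathbb{Z}^+$ with finitely many non-zero coefficients. $e_k$ is the sequence with $e_k(k)=1$ and $e_k(n)=0$ for $n\ne k$. $\overset{\circ}{A}$ denotes the interior of $A$. On $\mathbb{C}^{\mathbb{Z}^+}$ define $\mathbf{S}$ by $(\mathbf{S}u)(0)=0$ and $(\mathbf{S}u)(n)=u(n-1)$ for $n\geq1$, and $\mathbf{S}_{-1}$ by $(\mathbf{S}_{-1}u)(n)=u(n+1)$ for $n\geq0$. One says that $\mathbf{S}$ (resp. $\mathbf{S}_{-1}$) is bounded when $\mathbf{S}(\mathbf{E})\subset\mathbf{E}$ (resp. $\mathbf{S}_{-1}(\mathbf{E})\subset\mathbf{E}$); by the closed graph theorem its restriction to $\mathbf{E}$ is then bounded. If $\mathbf{S}$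 (resp. $\mathbf{S}_{-1}$) is bounded, $\operatorname{spec}(\mathbf{S})$ (resp. $\operatorname{spec}(\mathbf{S}_{-1})$) is the spectrum of its restriction to $\mathbf{E}$; otherwise it is the spectrum of the smallest closed extension, as an operator in $\mathbf{E}$, of its restriction to $F(\mathbb{Z}^+)$. For a densely defined closed operator $A$, $\rho(A)=\sup\{|\lambda|:\lambda\in\operatorname{spec}(A)\}$; $\rho(\mathbf{S})$ and $\rho(\mathbf{S}_{-1})$ are defined using the spectra just described. $\frac{1}{\rho(\mathbf{S}_{-1})}$ denotes $0$ if $\rho(\mathbf{S}_{-1})=+\infty$ and $+\infty$ if $\rho(\mathbf{S}_{-1})=0$. A Toeplitz operator on $\mathbf{E}$ is a bounded operator $T$ on $\mathbf{E}$ such that $(\mathbf{S}_{-1}T\mathbf{S})u=Tu$ for all $u\in F(\mathbb{Z}^+)$. For such $T$ and $n\geq0$ put $\widehat{T}(n)=(Te_0)(n)$ and $\widehat{T}(-n)=(Te_n)(0)$, and let $\widetilde{T}(z)=\sum_{n\in\mathbb{Z}}\widehat{T}(n)z^n$ (a formal Laurent series). The assertion ''$\widetilde{T}\in L^\infty(C_r)$ and $|\widetilde{T}|\leq\|T\|$ a.e. on $C_r$'' means that there is $\nu_r\in L^\infty(\mathbb{T})$ whose Fourier coefficients are $\widehat{\nu_r}(n)=\widehat{T}(n)r^n$, $n\in\mathbb{Z}$ (so that $\widetilde{T}(rz)$ is identified with $\nu_r(z)$), and $|\nu_r|\leq\|T\|$ a.e. on $\mathbb{T}$. For an open set $O$,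 $\mathcal{H}^\infty(O)$ is the space of bounded holomorphic functions on $O$; $\widetilde{T}\in\mathcal{H}^\infty(O)$ means that the series converges on $O$ to a function in $\mathcal{H}^\infty(O)$. *)

(* Defs.v *)
From HB Require Import structures.
From mathcomp Require Import all_boot all_order all_algebra.
From mathcomp Require Import complex.
From mathcomp Require Import all_classical all_reals all_analysis.

Set Implicit Arguments.
Unset Strict Implicit.
Unset Printing Implicit Defensive.

Import Order.TTheory GRing.Theory Num.Theory.
Import numFieldNormedType.Exports.

Local Open Scope classical_set_scope.
Local Open Scope complex_scope.
Local Open Scope ring_scope.

Section Sequences.
Context {R : realType}.
Local Notation C := R[i].

Definition finsupp (u : nat -> C) : Prop :=
  exists N : nat, forall n : nat, (N <= n)%N -> u n = 0.

Definition e_ (k : nat) : nat -> C := fun n => (n == k)%:R.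

Definition shift_fwd (u : nat -> C) : nat -> C :=
  fun n => if n is m.+1 then u m else 0.

Definition shift_bwd (u : nat -> C) : nat -> C := fun n => u n.+1.

Definition rotate (z : C) (u : nat -> C) : nat -> C := fun n => z ^+ n * u n.

End Sequences.

(* The norm of a normed space over R[i] takes its values in R[i]; this is the
   same norm seen in R. *)
Definition rnorm {R : realType} {V : normedZmodType R[i]} (x : V) : R :=
  complex.Re `|x|.

(* A Banach space of sequences is given by an abstract Banach space E and an
   injective linear map j : E -> (nat -> R[i]), standing for the inclusion of E
   into the space of all sequences.  Linearity is required coordinatewise. *)
Section SequenceSpace.
Context {R : realType} {E : completeNormedModType R[i]}.
Local Notation C := R[i].
Variable j : E -> nat -> C.

(* The element of E whose underlying sequence is u; it is meaningful only if u
   is in the image of j. *)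
Definition seq_lift (u : nat -> C) : E := xget 0 [set x | j x = u].

Definition stable (A : (nat -> C) -> (nat -> C)) : Prop :=
  forall x : E, exists y : E, j y = A (j x).

Definition restriction (A : (nat -> C) -> (nat -> C)) : E -> E :=
  fun x => seq_lift (A (j x)).

End SequenceSpace.

Section Operators.
Context {R : realType} {E : completeNormedModType R[i]}.
Local Notation C := R[i].

Definition opnorm (f : E -> E) : \bar R :=
  ereal_sup [set (rnorm (f x))%:E | x in [set x : E | rnorm x <= 1]].

(* A possibly unbounded operator in E is represented by its graph. *)
Definition closed_operator (G : set (E * E)) : Prop :=
  [/\ G (0, 0),
      forall (a : C) (p q : E * E), G p -> G q -> G (a *: p + q),
      forall x y y' : E, G (x, y) -> G (x, y') -> y = y'
    & closed G].

(* B is the everywhere defined bounded inverse of A - lambda, where A is the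
   operator with graph G. *)
Definition resolvent_set (G : set (E * E)) : set C :=
  [set lambda | exists B : {linear E -> E},
    [/\ continuous B,
        forall x y : E, G (x, y) -> B (y - lambda *: x) = x
      & forall v : E, G (B v, v + lambda *: B v)]].

Definition spec (G : set (E * E)) : set C := ~` resolvent_set G.

Definition rho (G : set (E * E)) : \bar R :=
  ereal_sup [set (rnorm (lambda : C))%:E | lambda in spec G].

(* [smallest] is the intersection of the graphs of all the closed operators
   extending the restriction of A to the finitely supported sequences. *)
Definition op_graph (j : E -> nat -> C) (A : (nat -> C) -> (nat -> C)) :
    set (E * E) :=
  if `[< stable j A >] then [set p | j p.2 = A (j p.1)]
  else smallest closed_operator
         [set p | finsupp (j p.1) /\ j p.2 = A (j p.1)].

Definition toeplitz (j : E -> nat -> C) (T : {linear E -> E}) : Prop :=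
  continuous T /\
  forall u : nat -> C, finsupp u ->
    shift_bwd (j (T (seq_lift j (shift_fwd u)))) = j (T (seq_lift j u)).

Definition toeplitz_coef (j : E -> nat -> C) (T : E -> E) (n : int) : C :=
  match n with
  | Posz m => j (T (seq_lift j (e_ 0))) m
  | Negz m => j (T (seq_lift j (e_ m.+1))) 0%N
  end.

End Operators.

Section Circle.
Context {R : realType}.
Local Notation C := R[i].
Local Notation mu := (@lebesgue_measure R).

Definition cis (t : R) : C := cos t +i* sin t.

(* Functions on the unit circle are handled through t |-> f (cis t) on
   [0, 2 pi]; the values of f off the circle are irrelevant. *)
Definition ae_circle (P : C -> Prop) : Prop :=
  {ae mu, forall t : R, t \in `[0, 2 * pi] -> P (cis t)}.

Definition Linfty_circle (f : C -> C) : Prop :=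
  [/\ measurable_fun (`[0, 2 * pi] : set R) (fun t => complex.Re (f (cis t))),
      measurable_fun (`[0, 2 * pi] : set R) (fun t => complex.Im (f (cis t)))
    & exists M : R, ae_circle (fun z => rnorm (f z) <= M)].

Definition cintegral (D : set R) (g : R -> C) : C :=
  (\int[mu]_(t in D) complex.Re (g t)) +i* (\int[mu]_(t in D) complex.Im (g t)).

Definition fourier_coef (f : C -> C) (n : int) : C :=
  ((2 * pi)^-1)%:C *
  cintegral `[0, 2 * pi] (fun t => f (cis t) * cis t ^ (- n)).

(* The formal Laurent series with coefficients a belongs to L^oo of the circle
   of radius r, with modulus at most M almost everywhere: nu z stands for the
   value of the series at r z. *)
Definition laurent_Linfty_le (a : int -> C) (r : R) (M : \bar R) : Prop :=
  exists nu : C -> C,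
    [/\ Linfty_circle nu,
        forall n : int, fourier_coef nu n = a n * (r%:C) ^ n
      & ae_circle (fun z => ((rnorm (nu z))%:E <= M)%E)].

End Circle.

Section Holomorphic.
Context {R : realType}.
Local Notation C := R[i].

(* Since 0^-1 = 0, the case z = 0 needs a separate clause: the series has a
   meaning there only if its coefficients of negative index vanish. *)
Definition laurent_cvg_to (a : int -> C) (z w : C) : Prop :=
  (z = 0 -> forall n : nat, a (Negz n) = 0) /\
  exists p q : C,
    [/\ series (fun n : nat => a (Posz n) * z ^ (Posz n) : C^o) @ \oo
          --> (p : C^o),
        series (fun n : nat => a (Negz n) * z ^ (Negz n) : C^o) @ \oo
          --> (q : C^o)
      & w = p + q].

(* Over the field R[i], [derivable f z 1] is complex differentiability. *)
Definition Hinfty (O : set C) (f : C -> C) : Prop :=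
  (forall z : C, O z -> derivable (f : C^o -> C^o) z 1) /\
  exists M : R, forall z : C, O z -> rnorm (f z) <= M.

Definition laurent_Hinfty (a : int -> C) (O : set C) : Prop :=
  exists f : C -> C,
    Hinfty O f /\ forall z : C, O z -> laurent_cvg_to a z (f z).

End Holomorphic.

(* Main.v *)
Require Import Defs.
From HB Require Import structures.
From mathcomp Require Import all_boot all_order all_algebra.
From mathcomp Require Import complex.
From mathcomp Require Import all_classical all_reals all_analysis.
From mathcomp Require Import measurable_realfun.
From mathcomp Require Import ring lra zify.

Set Implicit Arguments.
Unset Strict Implicit.
Unset Printing Implicit Defensive.

Import Order.TTheory GRing.Theory Num.Theory.
Import numFieldNormedType.Exports.

Local Open Scope classical_set_scope.
Local Open Scope complex_scope.
Local Open Scope ring_scope.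

(** Finitely supported sequences are polynomials: S is multiplication by X,
    S_{-1} is [drop_poly 1], the matrix of T has the entries a(i - k), and [K]
    bounds the rotations.

    Weights.  Averaging the conjugates of an operator by the rotations against
    the Fejer kernel, which is nonnegative, multiplies the diagonals of its
    matrix by Fejer weights and costs only a factor K^2 ([fejer_op]).  For T
    this produces banded Toeplitz matrices whose symbols are the Fejer means of
    the series of T.

    One circle.  Let r be the growth rate of the powers of S and |la| = r.  Then
    S - la is not bounded below in the algebra of the polynomials in S
    ([approx_eigenvector]), a polynomial in S acts on an approximate eigenvector
    as its value at la, and away from the origin a banded Toeplitz matrix is a
    polynomial in S up to a negative power of S.  Hence the Fejer means are
    bounded by K^2 ||T|| on the circle of radius r ([circle_forward]); S_{-1} gives the inner circle
    ([circle_backward]), and a maximum principle for Laurent polynomials the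
    annulus between them ([max_annulus]).  The spectrum is used only through
    the Neumann series: r <= rho(S) implies r^l <= ||S^l||
    ([spectral_lower_bound]).

    The sharp constant.  The powers T^m are not Toeplitz, but their entries
    differ from c_m(i - k), where c_m are the coefficients of the m-th power of
    the series, by a defect that is small far from the origin
    ([defect_vanish], [defect_geometric]).  The argument above tolerates it, and
    bounds the Fejer means of the m-th power by K^2 ||T||^m.  By Parseval, the
    mean square of the m-th power is at most a constant independent of m times
    ||T||^(2m) ([power_l2]).  As m grows the constant disappears: the almost
    everywhere limit of a subsequence of the Fejer means has modulus at most
    ||T|| ([ae_le_of_moments], [laurent_boundary]).  When the critical
    circles of the two shifts coincide, approximate eigenvectors are found far
    from the origin instead ([circle_degenerate]).

    Unbounded shifts.  The second difference of the Fejer weights isolates the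
    two diagonals at distance n of the matrix, so that
    a(n) S^n + a(-n) S_{-1}^n is bounded.  If S_{-1} is bounded and a(n) is not
    zero, S^n is bounded, and so is S = S_{-1}^(n-1) S^n.  Thus if one shift is
    not bounded, the coefficients on its side vanish ([coef_pos_vanish],
    [coef_neg_vanish]), and the maximum principle needs one circle only.

    Inside the domain the two halves of the series converge geometrically, and
    their sum keeps the bound of the Fejer means
    ([laurent_Hinfty_of_fejer]). *)

(** * The norm as a real number *)

Section RealNorm.
Variable R : realType.
Local Notation C := R[i].

Lemma normE (V : normedZmodType C) (x : V) : `|x| = (rnorm x)%:C.
Proof.
rewrite /rnorm; have := normr_ge0 x.
by case: `|x| => a b; rewrite lecE /= => /andP[/eqP -> _].
Qed.

Lemma rnorm_ge0 (V : normedZmodType C) (x : V) : 0 <= rnorm x.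
Proof. by have := normr_ge0 x; rewrite normE lecE /= eqxx. Qed.

Lemma rnormD (V : normedZmodType C) (x y : V) :
  rnorm (x + y) <= rnorm x + rnorm y.
Proof. by have := ler_normD x y; rewrite !normE -rmorphD lecR. Qed.

Lemma rnormN (V : normedZmodType C) (x : V) : rnorm (- x) = rnorm x.
Proof. by rewrite /rnorm normrN. Qed.

Lemma rnorm_distC (V : normedZmodType C) (x y : V) :
  rnorm (x - y) = rnorm (y - x).
Proof. by rewrite -rnormN opprB. Qed.

Lemma rnormB (V : normedZmodType C) (x y : V) :
  rnorm (x - y) <= rnorm x + rnorm y.
Proof. by rewrite -[rnorm y]rnormN rnormD. Qed.

Lemma rnorm0 (V : normedZmodType C) : rnorm (0 : V) = 0.
Proof. by rewrite /rnorm normr0. Qed.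

Lemma rnorm0_eq0 (V : normedZmodType C) (x : V) : rnorm x = 0 -> x = 0.
Proof. by move=> h; apply/eqP; rewrite -normr_eq0 normE h. Qed.

Lemma rnorm_eq0 (V : normedZmodType C) (x : V) : (rnorm x == 0) = (x == 0).
Proof. by apply/eqP/eqP => [/rnorm0_eq0//|->]; exact: rnorm0. Qed.

Lemma rnorm_gt0 (V : normedZmodType C) (x : V) : (0 < rnorm x) = (x != 0).
Proof. by rewrite lt0r rnorm_ge0 andbT rnorm_eq0. Qed.

Lemma rnorm_sum (V : normedZmodType C) I (r : seq I) (P : pred I) (F : I -> V) :
  rnorm (\sum_(i <- r | P i) F i) <= \sum_(i <- r | P i) rnorm (F i).
Proof.
elim/big_rec2: _ => [|i y1 y2 _ h]; first by rewrite rnorm0.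
by rewrite (le_trans (rnormD _ _))// lerD2l.
Qed.

Lemma rnormM (x y : C) : rnorm (x * y) = rnorm x * rnorm y.
Proof. by have := normrM x y; rewrite !normE -rmorphM => /complexI. Qed.

Lemma rnorm1 : rnorm (1 : C) = 1.
Proof. by rewrite /rnorm normr1. Qed.

Lemma rnormX (x : C) n : rnorm (x ^+ n) = rnorm x ^+ n.
Proof. by elim: n => [|n ih]; rewrite ?expr0 ?rnorm1// !exprS rnormM ih. Qed.

Lemma rnormV (x : C) : rnorm (x^-1) = (rnorm x)^-1.
Proof.
have [->|x0] := eqVneq x 0; first by rewrite invr0 rnorm0 invr0.
have h : rnorm x != 0 by rewrite rnorm_eq0.
by apply: (mulfI h); rewrite -rnormM mulfV// rnorm1 mulfV.
Qed.

Lemma rnorm_real (x : R) : rnorm (x%:C) = `|x|.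
Proof. by rewrite /rnorm normc_def /= expr0n /= addr0 sqrtr_sqr. Qed.

Lemma rnorm_nat n : rnorm (n%:R : C) = n%:R.
Proof. by rewrite -(rmorph_nat (real_complex R)) rnorm_real normr_nat. Qed.

Lemma rnormZ (V : normedModType C) (a : C) (x : V) :
  rnorm (a *: x) = rnorm a * rnorm x.
Proof. by have := normrZ a x; rewrite !normE -rmorphM => /complexI. Qed.

Lemma rnorm_sqr (z : C) : rnorm z ^+ 2 = complex.Re z ^+ 2 + complex.Im z ^+ 2.
Proof. by rewrite /rnorm normc_def /= sqr_sqrtr// addr_ge0// sqr_ge0. Qed.

Lemma rnorm_sqrE (z : C) : (rnorm z ^+ 2)%:C = z * z^*%C.
Proof. by rewrite -sqr_normc normE rmorphXn. Qed.

Lemma ler_rnormB (V : normedZmodType C) (x y : V) :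
  rnorm x - rnorm y <= rnorm (x - y).
Proof. by rewrite lerBlDr -{1}(subrK y x) rnormD. Qed.

Lemma rnormD3 (V : normedZmodType C) (y x z : V) :
  rnorm (x - z) <= rnorm (x - y) + rnorm (y - z).
Proof. by rewrite -{1}(subrK y x) -addrA rnormD. Qed.

End RealNorm.

(** * Growth of powers *)

Section PowerComparison.
Variable R : realType.

Lemma bernoulli (x : R) n : 0 <= x -> 1 + n%:R * x <= (1 + x) ^+ n.
Proof.
move=> x0; elim: n => [|n ih]; first by rewrite mul0r addr0 expr0.
rewrite exprS (le_trans _ (ler_wpM2l _ ih)) ?addr_ge0//.
rewrite -natr1; have : 0 <= n%:R * x * x by rewrite !mulr_ge0.
by lra.
Qed.

Lemma pow_ge_quad (x : R) n : 0 <= x -> n%:R * n%:R * (x * x) <= (1 + x) ^+ (2 * n).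
Proof.
move=> x0; rewrite mulnC exprM expr2.
have h := bernoulli n x0.
rewrite [X in X <= _](_ : _ = (n%:R * x) * (n%:R * x)); last by ring.
have h0 : 0 <= n%:R * x by rewrite mulr_ge0.
by rewrite ler_pM// (le_trans _ h)// lerDr.
Qed.

Lemma exists_natr_gt (x : R) : exists n : nat, x < n.+1%:R.
Proof. by exists (Num.truncn x); exact: truncnS_gt. Qed.

Lemma pow_unbounded (x M : R) : 1 < x -> exists n, M < x ^+ n.
Proof.
move=> x1; have [n hn] := exists_natr_gt (M / (x - 1)); exists n.+1.
move: hn; rewrite ltr_pdivrMr ?subr_gt0// => /lt_le_trans; apply.
have := @bernoulli (x - 1) n.+1; rewrite subr_ge0 (ltW x1) => /(_ isT).
by rewrite [1 + (_ - _)]addrC subrK; apply: le_trans; rewrite lerDr.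
Qed.

Lemma pow_vanish (t e : R) : 0 <= t -> t < 1 -> 0 < e -> exists n, t ^+ n < e.
Proof.
move=> t0 t1 e0; have [->|tn0] := eqVneq t 0; first by exists 1%N; rewrite expr1.
have tp : 0 < t by rewrite lt0r tn0.
have [|n hn] := @pow_unbounded t^-1 e^-1; first by rewrite invf_gt1.
exists n; rewrite -ltf_pV2 ?posrE ?exprn_gt0//.
by rewrite -exprVn.
Qed.

(** A factor that is polynomial in [k] disappears on taking k-th roots. *)
Lemma root_comparison (x y al be : R) : 0 <= y ->
  (forall k, x ^+ k <= (al * k%:R + be) * y ^+ k) -> x <= y.
Proof.
move=> y0 h; rewrite leNgt; apply/negP => yx.
have [ye|yn] := eqVneq y 0.
  by have := h 1%N; rewrite ye !expr1 mulr0 leNgt -{1}ye yx.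
have yp : 0 < y by rewrite lt0r yn.
pose u := x / y - 1.
have up : 0 < u by rewrite /u subr_gt0 ltr_pdivlMr// mul1r.
have [n hn] := exists_natr_gt ((2 * `|al| + `|be|) / (u * u)).
have hk := h (2 * n.+1)%N.
have : (x / y) ^+ (2 * n.+1) <= al * (2 * n.+1)%:R + be.
  by rewrite expr_div_n ler_pdivrMr ?exprn_gt0.
have := @pow_ge_quad u n.+1 (ltW up).
rewrite /u [1 + (_ - _)]addrC subrK -/u => h1 /(le_trans h1).
apply/negP; rewrite -ltNge.
move: hn; rewrite ltr_pdivrMr ?mulr_gt0// => hn.
have n1 : (1 : R) <= n.+1%:R by rewrite ler1n.
have ha : al <= `|al| := ler_norm _.
have hb : be <= `|be| := ler_norm _.
have ha0 : 0 <= `|al| := normr_ge0 _.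
have hb0 : 0 <= `|be| := normr_ge0 _.
rewrite natrM; set m := n.+1%:R in hn n1 *.
have m0 : 0 < m by lra.
apply: (@le_lt_trans _ _ ((2 * `|al| + `|be|) * m)); last first.
  by rewrite (_ : m * m * _ = m * (u * u) * m) ?ltr_pM2r//; ring.
have h2 : 0 <= (`|al| - al) * m by rewrite mulr_ge0// ?subr_ge0// ltW.
have h3 : 0 <= `|be| * (m - 1) by rewrite mulr_ge0// subr_ge0.
by nra.
Qed.

End PowerComparison.

(** * Roots of unity *)

Section RootsOfUnity.
Variable R : realType.
Local Notation C := R[i].

(** Square roots are taken repeatedly, starting from -1. *)
Lemma prim_root_pow2 h : exists w : C, (2 ^ h).-primitive_root w.
Proof.
case: h => [|h].
  exists 1; apply/andP; split => //; apply/forallP => i.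
  by rewrite unity_rootE expr1n eqxx; case: i => [[|]].
have [w hw] : exists w : C, w ^+ (2 ^ h) = -1.
  elim: h => [|h [w hw]]; first by exists (-1).
  by exists (sqrtC w); rewrite expnS exprM sqrtCK.
exists w.
have h1 : w ^+ (2 ^ h.+1) = 1 by rewrite expnSr exprM hw sqrrN expr1n.
have [|m mdvd hm] := prim_order_exists _ h1; first by rewrite expn_gt0.
have /(dvdn_pfactor _ _ (isT : prime 2))[k kh mE] := hm.
move: kh; rewrite leq_eqVlt => /orP[/eqP kE|]; first by rewrite -kE -mE.
rewrite ltnS => kh; exfalso.
have : w ^+ (2 ^ h) = 1.
  by apply/eqP; rewrite -(prim_order_dvd mdvd) mE dvdn_exp2l.
rewrite hw => /eqP; rewrite eq_sym -subr_eq0 opprK.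
by rewrite (_ : 1 + 1 = 2%:R) ?pnatr_eq0.
Qed.

Lemma rnorm_root1 (w : C) n : (0 < n)%N -> w ^+ n = 1 -> rnorm w = 1.
Proof.
move=> n0 h; apply/eqP; rewrite -(pexpr_eq1 n0) ?rnorm_ge0//.
by rewrite -rnormX h rnorm1.
Qed.

(** Discrete orthogonality of characters; as the order [2 ^ h] is as large as
    desired, averages over these roots replace integrals over the circle. *)
Lemma unit_roots h : exists w : C, rnorm w = 1 /\
  forall i j, (i < 2 ^ h)%N -> (j < 2 ^ h)%N ->
    \sum_(k < 2 ^ h) (w ^+ k) ^+ i * (w ^+ k) ^- j = (2 ^ h * (i == j))%:R.
Proof.
have [w hw] := prim_root_pow2 h; exists w.
have w1 := prim_expr_order hw.
have w_norm : rnorm w = 1 by apply: rnorm_root1 w1; rewrite expn_gt0.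
have w0 : w != 0 by rewrite -rnorm_gt0 w_norm ltr01.
split => // i j hi hj.
pose x := w ^+ i * w ^- j.
have xE k : (w ^+ k) ^+ i * (w ^+ k) ^- j = x ^+ k.
  by rewrite /x exprMn -!exprVn -!exprM mulnC [(k * j)%N]mulnC.
under eq_bigr do rewrite xE.
have [ij|ij] := eqVneq i j.
  rewrite muln1 /x ij mulfV ?expf_eq0 ?(negbTE w0) ?andbF//.
  under eq_bigr do rewrite expr1n.
  by rewrite sumr_const card_ord.
have x1 : x != 1.
  apply: contra ij => /eqP xx; apply/eqP.
  have : w ^+ i == w ^+ j.
    by rewrite -[w ^+ j]mul1r -xx /x mulfVK// expf_eq0 (negbTE w0) andbF.
  by rewrite (eq_prim_root_expr hw) !modn_small// => /eqP.
rewrite muln0.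
have := subrX1 x (2 ^ h).
have -> : x ^+ (2 ^ h) = 1.
  by rewrite /x exprMn -exprVn -!exprM ![(_ * 2 ^ h)%N]mulnC !exprM exprVn w1 expr1n invr1 expr1n mulr1.
rewrite subrr => /esym/eqP; rewrite mulf_eq0 subr_eq0 (negbTE x1) /=.
by move=> /eqP.
Qed.

End RootsOfUnity.

(** * The identity of Parseval and a maximum principle *)

Section Parseval.
Variable R : realType.
Local Notation C := R[i].

(** The squared norm in L^2 of the circle of radius [r], computed from the
    coefficients. *)
Definition l2 (r : R) (p : {poly C}) : R :=
  \sum_(i < size p) rnorm p`_i ^+ 2 * r ^+ (2 * i).

Lemma l2_widen r n (p : {poly C}) : (size p <= n)%N ->
  l2 r p = \sum_(i < n) rnorm p`_i ^+ 2 * r ^+ (2 * i).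
Proof.
move=> h; rewrite /l2 (big_ord_widen n (fun i => rnorm p`_i ^+ 2 * r ^+ (2 * i)) h).
rewrite big_mkcond; apply: eq_bigr => i _; case: ltnP => // hi.
by rewrite nth_default// rnorm0 expr0n mul0r.
Qed.

Lemma l2_ge0 r p : 0 <= l2 r p.
Proof. by apply: sumr_ge0 => i _; rewrite mulr_ge0// ?sqr_ge0// exprM exprn_ge0// sqr_ge0. Qed.

Lemma l2_coef r (p : {poly C}) i : rnorm p`_i ^+ 2 * r ^+ (2 * i) <= l2 r p.
Proof.
have h j : 0 <= rnorm p`_j ^+ 2 * r ^+ (2 * j).
  by rewrite mulr_ge0// ?sqr_ge0// exprM exprn_ge0// sqr_ge0.
case: (ltnP i (size p)) => hi; last first.
  by rewrite nth_default// rnorm0 expr0n mul0r l2_ge0.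
rewrite /l2 (bigD1 (Ordinal hi))//= lerDl; apply: sumr_ge0 => j _; exact: h.
Qed.

Lemma l2MXn r n (p : {poly C}) : l2 r ('X^n * p) = r ^+ (2 * n) * l2 r p.
Proof.
have h1 : (size ('X^n * p)%R <= n + size p)%N.
  by rewrite (leq_trans (size_polyMleq _ _))// size_polyXn addSn.
rewrite (l2_widen r h1) /l2 big_split_ord /= big1 ?add0r => [|i _]; last first.
  by rewrite coefXnM ltn_ord rnorm0 expr0n mul0r.
rewrite mulr_sumr; apply: eq_bigr => i _.
by rewrite coefXnM ltnNge leq_addr /= addKn mulnDr exprD; ring.
Qed.

Lemma l2D r (p q : {poly C}) : l2 r (p + q) <= 2 * (l2 r p + l2 r q).
Proof.
pose n := maxn (size p) (size q).
rewrite !(@l2_widen r n) ?leq_maxl ?leq_maxr ?(leq_trans (size_polyD _ _))//.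
rewrite -big_split mulr_sumr; apply: ler_sum => i _ /=.
rewrite coefD -mulrDl mulrA ler_wpM2r//.
  by rewrite exprM exprn_ge0// sqr_ge0.
rewrite (@le_trans _ _ ((rnorm p`_i + rnorm q`_i) ^+ 2))//.
  by rewrite ler_sqr ?nnegrE ?addr_ge0 ?rnorm_ge0// rnormD.
have := sqr_ge0 (rnorm p`_i - rnorm q`_i); rewrite sqrrB sqrrD; lra.
Qed.

Lemma parseval h (w : C) (p : {poly C}) (r : R) : rnorm w = 1 ->
  (forall i j, (i < 2 ^ h)%N -> (j < 2 ^ h)%N ->
    \sum_(k < 2 ^ h) (w ^+ k) ^+ i * (w ^+ k) ^- j = (2 ^ h * (i == j))%:R) ->
  (size p <= 2 ^ h)%N ->
  \sum_(k < 2 ^ h) rnorm p.[r%:C * w ^+ k] ^+ 2 = (2 ^ h)%:R * l2 r p.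
Proof.
move=> w1 orth sp; apply: complexI.
have w0 : w != 0 by rewrite -rnorm_gt0 w1 ltr01.
have wconj k : ((w ^+ k)^*)%C = w ^- k.
  have e : w * w^*%C = 1 by rewrite -rnorm_sqrE w1 expr1n.
  rewrite rmorphXn -exprVn; congr (_ ^+ _).
  by apply: (mulfI w0); rewrite e mulfV.
have conjE k j :
    ((p`_j * (r%:C * w ^+ k) ^+ j)^*)%C = (p`_j)^*%C * (r%:C ^+ j * (w ^+ k) ^- j).
  rewrite rmorphM exprMn rmorphM /= -[(w ^+ k) ^+ j]exprM wconj exprM.
  by rewrite -[r%:C ^+ j]rmorphXn conjc_real.
rewrite rmorph_sum rmorphM rmorph_nat /=.
under eq_bigr => k _.
  rewrite rnorm_sqrE (horner_coef_wide _ sp) rmorph_sum /= big_distrlr /=.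
  under eq_bigr => i _.
    under eq_bigr => j _.
      rewrite conjE exprMn mulrACA [X in _ * X]mulrACA mulrA.
      over.
    over.
  over.
rewrite exchange_big /=.
under eq_bigr => i _.
  rewrite exchange_big /=.
  under eq_bigr => j _ do rewrite -mulr_sumr orth//.
  rewrite (bigD1 i)//= eqxx muln1 [X in _ + X]big1 ?addr0; last first.
    by move=> j ji; rewrite (_ : (_ == _) = false) ?muln0 ?mulr0//; rewrite eq_sym; apply/negbTE.
  over.
rewrite (l2_widen r sp) rmorph_sum mulr_sumr /=.
apply: eq_bigr => i _.
have -> : (rnorm p`_i ^+ 2 * r ^+ (2 * i))%:C =
    p`_i * (p`_i)^*%C * (r%:C ^+ i * r%:C ^+ i).
  by rewrite rmorphM /= rnorm_sqrE rmorphXn /= mul2n -addnn exprD.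
by rewrite mulrC.
Qed.

Lemma exists_pow2_ge n : exists h, (n <= 2 ^ h)%N.
Proof. by exists n; rewrite ltnW// ltn_expl. Qed.

Lemma l2M (r c : R) (p q : {poly C}) : 0 <= r ->
  (forall z, rnorm z = r -> rnorm p.[z] <= c) ->
  l2 r (p * q) <= c ^+ 2 * l2 r q.
Proof.
move=> r0 pc.
have [h hh] := exists_pow2_ge (maxn (size (p * q)%R) (size q)).
have [w [w1 orth]] := unit_roots R h.
have n0 : 0 < (2 ^ h)%:R :> R by rewrite ltr0n expn_gt0.
rewrite -(ler_pM2l n0) mulrCA -!(parseval _ w1 orth); last 2 first.
  by rewrite (leq_trans _ hh)// leq_maxr.
  by rewrite (leq_trans _ hh)// leq_maxl.
rewrite mulr_sumr; apply: ler_sum => k _.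
have zr : rnorm (r%:C * w ^+ k) = r.
  by rewrite rnormM rnormX w1 expr1n mulr1 rnorm_real ger0_norm.
rewrite hornerM rnormM exprMn ler_wpM2r ?sqr_ge0//.
by rewrite ler_sqr ?nnegrE ?rnorm_ge0 ?pc// (le_trans _ (pc _ zr))// rnorm_ge0.
Qed.

Lemma l21 r : l2 r 1 = 1.
Proof. by rewrite /l2 size_poly1 big_ord1 coefC /= rnorm1 !expr1n mul1r. Qed.

Lemma l2_le_sup (r c : R) (p : {poly C}) : 0 <= r ->
  (forall z, rnorm z = r -> rnorm p.[z] <= c) -> l2 r p <= c ^+ 2.
Proof. by move=> r0 h; have := l2M 1 r0 h; rewrite mulr1 l21 mulr1. Qed.

Lemma cauchy_estimate (r c : R) (p : {poly C}) i : 0 <= r ->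
  (forall z, rnorm z = r -> rnorm p.[z] <= c) -> rnorm p`_i * r ^+ i <= c.
Proof.
move=> r0 h.
have c0 : 0 <= c.
  apply: (le_trans (rnorm_ge0 (p.[r%:C]))); apply: h.
  by rewrite rnorm_real ger0_norm.
rewrite -ler_sqr ?nnegrE ?mulr_ge0 ?rnorm_ge0 ?exprn_ge0//.
by rewrite exprMn -exprM mulnC (le_trans (l2_coef _ _ _))// l2_le_sup.
Qed.

(** A maximum principle: the powers of [p] have Cauchy estimates on the circle
    of radius [r], and the number of their coefficients is killed by taking
    roots. *)
Lemma sup_from_power_coefs (r c : R) n (p : {poly C}) : 0 <= r -> 0 <= c ->
  (size p <= n.+1)%N ->
  (forall k i, rnorm (p ^+ k)`_i * r ^+ i <= c ^+ k) ->
  forall z, rnorm z = r -> rnorm p.[z] <= c.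
Proof.
move=> r0 c0 sp h z zr.
apply: (@root_comparison _ _ _ n%:R 1) => // k.
have sk : (size (p ^+ k)%R <= n * k + 1)%N.
  have [->|p0] := eqVneq p 0.
    case: k => [|k]; rewrite ?expr0 ?size_poly1 ?addn1// exprS mul0r size_poly0//.
  by have := size_exp p k; rewrite (polySpred (expf_neq0 k p0)) /= => ->; rewrite addn1 ltnS leq_mul2r -subn1 leq_subLR add1n sp orbT.
rewrite -rnormX -horner_exp (horner_coef_wide _ sk).
apply: (le_trans (rnorm_sum _ _ _)).
apply: (@le_trans _ _ (\sum_(i < n * k + 1) c ^+ k)).
  by apply: ler_sum => i _; rewrite rnormM rnormX zr h.
by rewrite sumr_const card_ord -[X in X <= _]mulr_natl natrD natrM.
Qed.

Let pow_coef_le (rho c : R) k i (p : {poly C}) Q : 0 < rho -> 0 <= c ->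
  (forall z, rnorm z = rho -> rnorm p.[z] <= c * rho ^+ Q) ->
  rnorm (p ^+ k)`_i * rho ^+ i <= c ^+ k * rho ^+ (Q * k).
Proof.
move=> rho0 c0 h.
rewrite exprM -exprMn; apply: cauchy_estimate => [|z hz]; first exact: ltW.
by rewrite horner_exp rnormX lerXn2r ?nnegrE ?rnorm_ge0 ?h ?mulr_ge0 ?exprn_ge0 ?(ltW rho0).
Qed.

Let pow_coef_inner (r1 r c : R) k i (p : {poly C}) Q : 0 < r1 -> r1 <= r ->
  0 <= c -> (i <= Q * k)%N ->
  (forall z, rnorm z = r1 -> rnorm p.[z] <= c * r1 ^+ Q) ->
  rnorm (p ^+ k)`_i * r ^+ i <= (c * r ^+ Q) ^+ k.
Proof.
move=> r10 r1r c0 hi h1.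
have r0 : 0 < r := lt_le_trans r10 r1r.
rewrite exprMn -exprM.
have := @pow_coef_le _ _ k i _ _ r10 c0 h1.
rewrite -(subnK hi) !exprD mulrA ler_pM2r ?exprn_gt0// => h.
rewrite mulrA ler_pM2r ?exprn_gt0// (le_trans h)// ler_wpM2l ?exprn_ge0//.
by rewrite lerXn2r ?nnegrE // ltW.
Qed.

Let pow_coef_outer (r r2 c : R) k i (p : {poly C}) Q : 0 < r -> r <= r2 ->
  0 <= c -> (Q * k <= i)%N ->
  (forall z, rnorm z = r2 -> rnorm p.[z] <= c * r2 ^+ Q) ->
  rnorm (p ^+ k)`_i * r ^+ i <= (c * r ^+ Q) ^+ k.
Proof.
move=> r0 rr2 c0 hi h2.
have r20 : 0 < r2 := lt_le_trans r0 rr2.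
rewrite exprMn -exprM.
have := @pow_coef_le _ _ k i _ _ r20 c0 h2.
rewrite -(subnK hi) !exprD [X in X <= _]mulrA ler_pM2r ?exprn_gt0// => h.
rewrite mulrA ler_pM2r ?exprn_gt0// (le_trans _ h)// ler_wpM2l ?rnorm_ge0//.
by rewrite lerXn2r ?nnegrE // ltW.
Qed.

(** Laurent polynomials are written [z ^- Q * p.[z]].  The coefficients of
    [p ^+ k] of index at most [Q * k] are estimated on the inner circle, the
    others on the outer one. *)
Lemma max_annulus (r1 r r2 c : R) Q (p : {poly C}) : 0 < r1 -> r1 <= r ->
  r <= r2 -> 0 <= c ->
  (forall z, rnorm z = r1 -> rnorm p.[z] <= c * r1 ^+ Q) ->
  (forall z, rnorm z = r2 -> rnorm p.[z] <= c * r2 ^+ Q) ->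
  forall z, rnorm z = r -> rnorm p.[z] <= c * r ^+ Q.
Proof.
move=> r10 r1r rr2 c0 h1 h2.
have r0 : 0 < r := lt_le_trans r10 r1r.
apply: (@sup_from_power_coefs _ _ (size p)); rewrite ?mulr_ge0 ?exprn_ge0 ?(ltW r0)//.
move=> k i; case: (leqP i (Q * k)) => hi; first exact: pow_coef_inner h1.
by apply: pow_coef_outer h2 => //; exact: ltnW.
Qed.

Lemma max_disc (r r2 c : R) Q (p : {poly C}) : 0 < r -> r <= r2 -> 0 <= c ->
  (forall i, (i < Q)%N -> p`_i = 0) ->
  (forall z, rnorm z = r2 -> rnorm p.[z] <= c * r2 ^+ Q) ->
  forall z, rnorm z = r -> rnorm p.[z] <= c * r ^+ Q.
Proof.
move=> r0 rr2 c0 p0 h2.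
have pE : p = drop_poly Q p * 'X^Q.
  rewrite -[LHS](poly_take_drop Q) (_ : take_poly Q p = 0) ?add0r//.
  by apply/polyP => i; rewrite coef_take_poly coef0; case: ltnP => // /p0.
apply: (@sup_from_power_coefs _ _ (size p)); rewrite ?mulr_ge0 ?exprn_ge0 ?(ltW r0)//.
move=> k i; case: (leqP (Q * k) i) => hi; first exact: pow_coef_outer h2.
rewrite pE exprMn -exprM coefMXn hi rnorm0 mul0r.
by rewrite exprn_ge0 ?mulr_ge0 ?exprn_ge0 ?(ltW r0).
Qed.

Lemma max_exterior (r1 r c : R) Q (p : {poly C}) : 0 < r1 -> r1 <= r -> 0 <= c ->
  (size p <= Q.+1)%N ->
  (forall z, rnorm z = r1 -> rnorm p.[z] <= c * r1 ^+ Q) ->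
  forall z, rnorm z = r -> rnorm p.[z] <= c * r ^+ Q.
Proof.
move=> r10 r1r c0 sp h1; have r0 : 0 < r := lt_le_trans r10 r1r.
apply: (@sup_from_power_coefs _ _ (size p)); rewrite ?mulr_ge0 ?exprn_ge0 ?(ltW r0)//.
move=> k i; case: (leqP i (Q * k)) => hi; first exact: pow_coef_inner h1.
rewrite nth_default ?rnorm0 ?mul0r ?exprn_ge0 ?mulr_ge0 ?exprn_ge0 ?(ltW r0)//.
rewrite (leq_trans (size_poly_exp_leq _ _))// (leq_ltn_trans _ hi)//.
by rewrite leq_mul2r -subn1 leq_subLR add1n sp orbT.
Qed.

End Parseval.

(** * Approximate eigenvectors *)

Section ApproximateEigenvectors.
Variable R : realType.
Local Notation C := R[i].

Lemma eq_ler (x y : R) : x = y -> x <= y.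
Proof. by move->. Qed.

(** The norms in which approximate eigenvectors are sought: the operator norm of
    y(S) as a function of [y], and the norm of [y] shifted far from the origin.
    Invariance under rotations up to a constant yields [pnorm_coef]. *)
Record pnorm (K B : R) (n : {poly C} -> R) : Prop := PNorm {
  pnorm_ge0 : forall p, 0 <= n p;
  pnormD : forall p q, n (p + q) <= n p + n q;
  pnormZ : forall c p, n (c *: p) = rnorm c * n p;
  pnorm_coef : forall (p : {poly C}) i, n (p`_i *: 'X^i) <= K * n p;
  pnormX : forall p, n ('X * p) <= B * n p }.

Section PnormTheory.
Variables (K B : R) (n : {poly C} -> R).
Hypothesis hn : pnorm K B n.

Lemma pnorm0 : n 0 = 0.
Proof. by rewrite -(scale0r 0) (pnormZ hn) rnorm0 mul0r. Qed.

Lemma pnormN p : n (- p) = n p.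
Proof. by rewrite -scaleN1r (pnormZ hn) rnormN rnorm1 mul1r. Qed.

Lemma pnormB p q : n (p - q) <= n p + n q.
Proof. by rewrite -[n q]pnormN (pnormD hn). Qed.

Lemma pnorm_sum I (r : seq I) (P : pred I) (F : I -> {poly C}) :
  n (\sum_(i <- r | P i) F i) <= \sum_(i <- r | P i) n (F i).
Proof.
elim/big_rec2: _ => [|i y1 y2 _ h]; first by rewrite pnorm0.
by rewrite (le_trans (pnormD hn _ _))// lerD2l.
Qed.

Hypothesis B0 : 0 <= B.

Lemma pnormXn i p : n ('X^i * p) <= B ^+ i * n p.
Proof.
elim: i => [|i ih]; first by rewrite expr0 !mul1r.
by rewrite !exprS -!mulrA (le_trans (pnormX hn _))// ler_wpM2l.
Qed.

Lemma pnormM g p :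
  n (g * p) <= (\sum_(i < size g) rnorm g`_i * B ^+ i) * n p.
Proof.
rewrite -{1}[g]coefK poly_def mulr_suml (le_trans (pnorm_sum _ _ _))//.
rewrite mulr_suml; apply: ler_sum => i _.
by rewrite -scalerAl (pnormZ hn) -mulrA ler_wpM2l ?rnorm_ge0// pnormXn.
Qed.

(** At an approximate eigenvector a polynomial acts as its value; the error
    does not depend on the norm beyond [B]. *)
Definition eval_error (p : {poly C}) la : R :=
  let g := (p - p.[la]%:P) %/ ('X - la%:P) in \sum_(i < size g) rnorm g`_i * B ^+ i.

Lemma pnorm_eval (p y : {poly C}) la e : n (('X - la%:P) * y) <= e * n y ->
  rnorm p.[la] * n y <= n (p * y) + eval_error p la * e * n y /\
  n (p * y) <= rnorm p.[la] * n y + eval_error p la * e * n y.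
Proof.
move=> h.
have : root (p - p.[la]%:P) la.
  by rewrite /root hornerD hornerN hornerC subrr.
rewrite root_factor_theorem /eval_error => /divpK.
set g := _ %/ _ => /esym gE /=.
have e1 : p * y = p.[la] *: y + g * (('X - la%:P) * y).
  by rewrite mulrA -gE mulrBl mul_polyC addrC subrK.
have h2 : n (g * (('X - la%:P) * y)) <=
    (\sum_(i < size g) rnorm g`_i * B ^+ i) * e * n y.
  rewrite (le_trans (pnormM _ _))// -mulrA ler_wpM2l//.
  by apply: sumr_ge0 => i _; rewrite mulr_ge0 ?rnorm_ge0 ?exprn_ge0.
split; last by rewrite e1 (le_trans (pnormD hn _ _))// (pnormZ hn) lerD2l.
rewrite -(pnormZ hn) (_ : p.[la] *: y = p * y - g * (('X - la%:P) * y)).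
  by rewrite (le_trans (pnormB _ _))// lerD2l.
by rewrite e1 addrK.
Qed.

End PnormTheory.

(** As soon as the sequence fails once to be divided by 2, convexity with the
    constant 4 makes it double at each further step. *)
Lemma convex_dichotomy (m : nat -> R) J : (forall j, 0 <= m j) ->
  (forall j, (j < J.*2)%N -> 4 * m j.+1 <= m j.+2 + m j) ->
  2 ^+ J * m J <= m 0%N \/
  exists2 i, (i < J)%N & 2 ^+ J * m i.+1 <= m (i.+1 + J)%N /\ m i < 2 * m i.+1.
Proof.
move=> m0 h.
case: (pselect (exists2 i, (i < J)%N & m i < 2 * m i.+1)) => [[i iJ hi]|hno].
  right; exists i => //; split => //.
  have grow k : (k <= J)%N -> m (i + k)%N <= 2 * m (i + k).+1.
    elim: k => [|k ih] kJ; first by rewrite addn0 ltW.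
    have := h (i + k)%N; rewrite addnS => /(_ _) hh.
    have : (i + k < J.*2)%N by rewrite -addnn; lia.
    move=> /hh; have := ih (ltnW kJ); have := m0 (i + k)%N; lra.
  suff: forall k, (k <= J)%N -> 2 ^+ k * m i.+1 <= m (i.+1 + k)%N by exact.
  elim=> [|k ih] kJ; first by rewrite expr0 mul1r addn0.
  have hh : 4 * m (i + k).+1 <= m (i + k).+2 + m (i + k)%N.
    by apply: h; rewrite -addnn; lia.
  have := grow k (ltnW kJ); have := ih (ltnW kJ).
  by rewrite addnS addSn exprS; lra.
left; suff: forall k, (k <= J)%N -> 2 ^+ k * m k <= m 0%N by exact.
elim=> [|k ih] kJ; first by rewrite expr0 mul1r.
have : 2 * m k.+1 <= m k.
  by rewrite leNgt; apply/negP => hk; apply: hno; exists k.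
move=> hk; apply: le_trans (ih (ltnW kJ)).
by rewrite exprSr -mulrA ler_wpM2l ?exprn_ge0.
Qed.

Let rho_exists L : exists2 rho : R, 1 < rho & rho ^+ L <= 4 / 3.
Proof.
exists (1 + (4 * L.+1%:R)^-1); first by rewrite ltrDl invr_gt0 mulr_gt0.
set x := (4 * L.+1%:R)^-1.
have x0 : 0 < x by rewrite invr_gt0 mulr_gt0.
have hx : L%:R * x <= 1 / 4.
  rewrite /x ler_pdivrMr ?mulr_gt0// mulrA mul1r mulVf// mul1r ler_nat leqnSn//.
have hL k : (k <= L)%N -> (1 - k%:R * x) * (1 + x) ^+ k <= 1.
  elim: k => [|k ih] kL; first by rewrite mul0r subr0 expr0 mulr1.
  apply: le_trans (ih (ltnW kL)); rewrite exprSr [_ ^+ k * _]mulrC mulrA.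
  rewrite ler_wpM2r ?exprn_ge0 ?addr_ge0 ?(ltW x0)//.
  have : 0 <= k%:R * x * x by rewrite !mulr_ge0// ltW.
  have : 0 <= x * x by rewrite mulr_ge0// ltW.
  by rewrite -natr1; nra.
have := hL L (leqnn _).
have : 0 <= (1 + x) ^+ L by rewrite exprn_ge0 ?addr_ge0 ?(ltW x0).
nra.
Qed.

(** [(X - la) * geom L la] is [X^L.+1 - la^L.+1]; as the middle coefficient of
    [geom L la ^+ 2] is [L.+1] times as large as its extreme ones,
    [X - la] cannot be bounded below along the powers of [X] unless these
    grow or decay geometrically. *)
Definition geom L (la : C) : {poly C} := \poly_(i < L.+1) la ^+ (L - i).

Lemma geomE L la : ('X - la%:P) * geom L la = 'X^(L.+1) - (la ^+ L.+1)%:P.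
Proof.
rewrite polyC_exp subrXX; congr (_ * _).
rewrite /geom poly_def (reindex_inj rev_ord_inj) /=; apply: eq_bigr => i _.
by rewrite subSS subKn -1?ltnS// -mul_polyC polyC_exp mulrC.
Qed.

Lemma coef_geom2 L la : (geom L la ^+ 2)`_L = L.+1%:R * la ^+ L.
Proof.
rewrite expr2 coefM (eq_bigr (fun=> la ^+ L)) => [|i _].
  by rewrite sumr_const card_ord mulr_natl.
rewrite !coef_poly ltn_ord ltnS leq_subr subKn -1?ltnS//.
by rewrite -exprD subnK -1?ltnS.
Qed.

(** If [X - la] were bounded below by [e], the numbers
    [n X^((L + 1) j) / r^((L + 1) j)] would satisfy the hypothesis of
    [convex_dichotomy], hence grow or decay geometrically, which the
    subexponential bounds [f] forbid.  The bound [W] on the length of [y] is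
    chosen before the norm, so that the norm may depend on it. *)
Lemma approx_eigenvector (f : nat -> R) (K B r e : R) (la : C) :
  (forall rho, 1 < rho -> exists c, forall l, f l <= c * rho ^+ l) ->
  0 < r -> rnorm la = r -> 0 < K -> 0 < B -> 0 < e ->
  exists W, forall n, pnorm K B n -> 0 < n 1 ->
    (forall k l, n 'X^(k + l) <= f l * r ^+ l * n 'X^k) ->
    (forall l, n 1 * r ^+ l <= f l * n 'X^l) ->
    exists y : {poly C}, [/\ (size y <= W)%N, 0 < n y & n (('X - la%:P) * y) <= e * n y].
Proof.
move=> fsub r0 lar K0 B0 e0.
(* the factor L + 1 of the middle coefficient of the square of [geom L la] has
   to outweigh the constants that come from [e], [B] and [K] *)
have [L hL] := exists_natr_gt (6 * B * K * r / (e ^+ 2)).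
have [rho rho1 rhoL] := rho_exists L.+1.
have [c hc] := fsub _ rho1.
have [J hJ] : exists J, c < (3 / 2) ^+ J by apply: pow_unbounded; lra.
exists (L.+1 * J.*2.+2 + L.*2.+2 + 2)%N => n hn n1 up low.
apply: contrapT => hno.
have bnd (y : {poly C}) : (size y <= L.+1 * J.*2.+2 + L.*2.+2 + 2)%N ->
    e * n y <= n (('X - la%:P) * y).
  move=> sy; rewrite leNgt; apply/negP => hy; apply: hno; exists y; split => //.
    rewrite lt0r (pnorm_ge0 hn) andbT; apply: contraTneq hy => ->.
    by rewrite mulr0 -leNgt (pnorm_ge0 hn).
  exact: ltW.
have nX l : 0 < n 'X^l.
  rewrite lt0r (pnorm_ge0 hn) andbT; apply: contraTneq (low l) => ->.
  by rewrite mulr0 -ltNge mulr_gt0 ?exprn_gt0.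
pose m j := n 'X^(L.+1 * j) / r ^+ (L.+1 * j).
have m0 j : 0 <= m j by rewrite divr_ge0 ?exprn_ge0 ?(ltW r0) ?(pnorm_ge0 hn).
have rec j : (j < J.*2)%N -> 4 * m j.+1 <= m j.+2 + m j.
  move=> jJ.
  pose g := geom L la; pose y := g ^+ 2 * 'X^(L.+1 * j).
  have sg : (size g <= L.+1)%N by exact: size_poly.
  have sg2 : (size (g ^+ 2)%R <= L.*2.+1)%N.
    rewrite (leq_trans (size_poly_exp_leq _ _))// ltnS -muln2 leq_mul2r /=.
    by rewrite -subn1 leq_subLR add1n.
  have sy : (size y <= L.+1 * J.*2.+2 + L.*2.+1)%N.
    rewrite (leq_trans (size_polyMleq _ _))// size_polyXn addnS /= addnC.
    by rewrite leq_add// leq_mul2l /=; apply: ltnW; apply: ltnW; rewrite ltnS ltnW.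
  have h1 : e * n y <= n (('X - la%:P) * y).
    by apply: bnd; rewrite (leq_trans sy)//; lia.
  have h2 : e * n (('X - la%:P) * y) <= n (('X - la%:P) * (('X - la%:P) * y)).
    apply: bnd; rewrite (leq_trans (size_polyMleq _ _))// size_XsubC /=.
    by move: sy; move: (size y) (L.+1 * J.*2.+2)%N => a b; lia.
  have eqy : ('X - la%:P) * (('X - la%:P) * y) = 'X^(L.+1 * j.+2)
      - (2 * la ^+ L.+1) *: 'X^(L.+1 * j.+1)
      + (la ^+ L.+1 * la ^+ L.+1) *: 'X^(L.+1 * j).
    rewrite (_ : _ * _ = (('X - la%:P) * g) ^+ 2 * 'X^(L.+1 * j)); last first.
      by rewrite /y; ring.
    have XE k : 'X^(L.+1 * k.+1) = 'X^(L.+1) * 'X^(L.+1 * k) :> {poly C}.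
      by rewrite mulnS exprD.
    by rewrite geomE !XE -!mul_polyC !polyCM polyC_natr; ring.
  have h3 : n (('X - la%:P) * (('X - la%:P) * y)) <= n 'X^(L.+1 * j.+2)
      + 2 * r ^+ L.+1 * n 'X^(L.+1 * j.+1) + r ^+ L.+1 * r ^+ L.+1 * n 'X^(L.+1 * j).
    rewrite eqy (le_trans (pnormD hn _ _))// (pnormZ hn) !rnormM rnormX lar.
    rewrite lerD2r (le_trans (pnormB hn _ _))// (pnormZ hn) rnormM rnormX lar.
    by rewrite rnorm_nat.
  have h4 : L.+1%:R * r ^+ L * n 'X^(L + L.+1 * j) <= K * n y.
    have := pnorm_coef hn y (L + L.+1 * j)%N.
    rewrite /y coefMXn ltnNge leq_addl /= addnK coef_geom2.
    by rewrite (pnormZ hn) rnormM rnormX lar rnorm_nat.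
  have h5 : n 'X^(L.+1 * j.+1) <= B * n 'X^(L + L.+1 * j).
    by rewrite mulnS addSn exprS (pnormX hn).
  have h6 : e ^+ 2 * L.+1%:R * r ^+ L * n 'X^(L.+1 * j.+1) <=
      B * K * (n 'X^(L.+1 * j.+2)
      + 2 * r ^+ L.+1 * n 'X^(L.+1 * j.+1) + r ^+ L.+1 * r ^+ L.+1 * n 'X^(L.+1 * j)).
    apply: (@le_trans _ _ (B * K * (e ^+ 2 * n y))); last first.
      apply: ler_wpM2l; first by rewrite mulr_ge0// ltW.
      rewrite (le_trans _ h3)// (le_trans _ h2)// expr2 -mulrA.
      by rewrite ler_wpM2l// ltW.
    apply: (@le_trans _ _ (e ^+ 2 * L.+1%:R * r ^+ L * (B * n 'X^(L + L.+1 * j)))).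
      apply: ler_wpM2l h5.
      by rewrite !mulr_ge0 ?exprn_ge0 ?(ltW r0) ?(ltW e0).
    rewrite (_ : _ * (B * _) = e ^+ 2 * B * (L.+1%:R * r ^+ L * n 'X^(L + L.+1 * j))); last by ring.
    rewrite (_ : B * K * _ = e ^+ 2 * B * (K * n y)); last by ring.
    apply: ler_wpM2l h4.
    by rewrite !mulr_ge0 ?exprn_ge0 ?(ltW B0) ?(ltW e0).
  pose D := r ^+ (L.+1 * j.+2).
  have D0 : 0 < D by rewrite exprn_gt0.
  have mE0 : n 'X^(L.+1 * j) * (r ^+ L.+1 * r ^+ L.+1) = m j * D.
    by rewrite /m /D !mulnS !exprD; field; rewrite !expf_neq0 ?gt_eqF.
  have mE1 : n 'X^(L.+1 * j.+1) * r ^+ L.+1 = m j.+1 * D.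
    by rewrite /m /D !mulnS !exprD; field; rewrite !expf_neq0 ?gt_eqF.
  have mE2 : n 'X^(L.+1 * j.+2) = m j.+2 * D.
    by rewrite /m /D divfK// expf_neq0 ?gt_eqF.
  have h7 : e ^+ 2 * L.+1%:R * (m j.+1 * D) <= r * (B * K) * (m j.+2 * D + 2 * (m j.+1 * D) + m j * D).
    rewrite -mE2 -mE1 -mE0.
    rewrite (_ : e ^+ 2 * _ * _ = r * (e ^+ 2 * L.+1%:R * r ^+ L * n 'X^(L.+1 * j.+1))); last by rewrite [r ^+ L.+1]exprS; ring.
    rewrite -[r * (B * K) * _]mulrA; apply: ler_wpM2l; first exact: ltW.
    by apply: le_trans h6 _; apply: eq_ler; ring.
  have h8 : 6 * (B * K * r) * m j.+1 <= r * (B * K) * (m j.+2 + 2 * m j.+1 + m j).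
    have h9 : 6 * (B * K * r) <= e ^+ 2 * L.+1%:R.
      move: hL; rewrite ltr_pdivrMr ?exprn_gt0// => /ltW h.
      rewrite [X in _ <= X]mulrC (le_trans _ h)//.
      by apply: eq_ler; ring.
    have mD : 0 <= m j.+1 * D by rewrite mulr_ge0// ltW.
    rewrite -(ler_pM2r D0) -[X in X <= _]mulrA.
    apply: le_trans (le_trans (ler_wpM2r mD h9) h7) _.
    by apply: eq_ler; ring.
  have rBK : 0 < r * (B * K) by rewrite !mulr_gt0.
  have : 6 * m j.+1 <= m j.+2 + 2 * m j.+1 + m j.
    rewrite -(ler_pM2l rBK) (le_trans _ h8)//; by apply: eq_ler; ring.
  lra.
(* growth by (4/3)^J is slower than the geometric rate 2^J *)
have fL : f (L.+1 * J)%N <= c * (4 / 3) ^+ J.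
  have := hc (L.+1 * J)%N.
  have c0 : 0 < c.
    have := hc 0%N; have := low 0%N; rewrite !expr0 !mulr1 => h1 h2.
    have : 1 <= f 0%N by rewrite -(ler_pM2r n1) mul1r.
    lra.
  move=> /le_trans; apply; rewrite exprM ler_wpM2l ?(ltW c0)//.
  by rewrite lerXn2r ?nnegrE// exprn_ge0// ltW// (lt_trans _ rho1).
have f2 : f (L.+1 * J)%N < 2 ^+ J.
  apply: (le_lt_trans fL).
  rewrite (_ : 2 = (3 / 2) * (4 / 3) :> R); last by field.
  by rewrite [X in _ < X]exprMn ltr_pM2r// exprn_gt0// divr_gt0.
have mpos j : 0 < m j by rewrite divr_gt0 ?exprn_gt0.
case: (convex_dichotomy m0 rec) => [h|[i iJ [h _]]].
  have := low (L.+1 * J)%N.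
  have -> : n 1 = m 0%N by rewrite /m muln0 !expr0 divr1.
  have -> : n 'X^(L.+1 * J) = m J * r ^+ (L.+1 * J).
    by rewrite /m divfK// expf_neq0 ?gt_eqF.
  rewrite mulrA ler_pM2r ?exprn_gt0// => h'.
  have := le_trans h h'; rewrite ler_pM2r// => /(lt_le_trans f2).
  by rewrite ltxx.
have := up (L.+1 * i.+1)%N (L.+1 * J)%N.
rewrite -mulnDr => h'.
have : m (i.+1 + J)%N <= f (L.+1 * J)%N * m i.+1.
  rewrite /m ler_pdivrMr ?exprn_gt0// (le_trans h')//.
  rewrite mulnDr exprD; apply: eq_ler; field.
  by rewrite expf_neq0 ?gt_eqF.
move=> /(le_trans h); rewrite ler_pM2r// => /(lt_le_trans f2).
by rewrite ltxx.
Qed.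

(** A bound on the operator [p], up to an error that is small at the
    approximate eigenvectors, bounds the value of [p] at the eigenvalue. *)
Lemma eigenvalue_bound (f : nat -> R) (K B r be : R) (la : C) (p : {poly C}) Q :
  (forall rho, 1 < rho -> exists c, forall l, f l <= c * rho ^+ l) ->
  0 < r -> rnorm la = r -> 0 < K -> 0 < B -> 0 <= be ->
  (forall e, 0 < e -> exists I, forall W, exists n, [/\ pnorm K B n, 0 < n 1,
    (forall k l, n 'X^(k + l) <= f l * r ^+ l * n 'X^k),
    (forall l, n 1 * r ^+ l <= f l * n 'X^l) &
    forall y : {poly C}, (size y <= W)%N ->
      n (p * 'X^I * y) <= be * n ('X^(Q + I) * y) + e * n ('X^I * y)]) ->
  rnorm p.[la] <= be * r ^+ Q.
Proof.
move=> fsub r0 lar K0 B0 be0 H; rewrite leNgt; apply/negP => hlt.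
pose g := rnorm p.[la] - be * r ^+ Q.
have g0 : 0 < g by rewrite subr_gt0.
have g30 : 0 < g / 3 by rewrite divr_gt0.
have [I HI] := H _ g30.
pose ct q := eval_error B q la.
have ct0 q : 0 <= ct q.
  by apply: sumr_ge0 => i _; rewrite mulr_ge0 ?rnorm_ge0 ?exprn_ge0 ?(ltW B0).
pose c := ct (p * 'X^I) + be * ct 'X^(Q + I) + g / 3 * ct 'X^I + 1.
have c0 : 0 < c.
  rewrite /c; have := ct0 (p * 'X^I); have := mulr_ge0 be0 (ct0 'X^(Q + I)).
  have := mulr_ge0 (ltW g30) (ct0 'X^I); lra.
have rI : 0 < r ^+ I by rewrite exprn_gt0.
pose e := g / 3 * r ^+ I / c.
have e0 : 0 < e by rewrite /e !mulr_gt0 ?invr_gt0.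
have [W hW] := approx_eigenvector fsub r0 lar K0 B0 e0.
have [n [hn n1 up low hp]] := HI W.
have [y [sy ny hy]] := hW n hn n1 up low.
have h1 := hp y sy.
have [h2 _] := pnorm_eval hn (ltW B0) (p * 'X^I) hy.
have [_ h3] := pnorm_eval hn (ltW B0) 'X^(Q + I) hy.
have [_ h4] := pnorm_eval hn (ltW B0) 'X^I hy.
rewrite -/(ct (p * 'X^I)) -/(ct 'X^(Q + I)) -/(ct 'X^I) in h2 h3 h4.
have Xla k : rnorm ('X^k).[la] = r ^+ k by rewrite hornerXn rnormX lar.
rewrite hornerM rnormM !Xla in h2 h3 h4.
have h5 : (rnorm p.[la] * r ^+ I) * n y <= (be * r ^+ (Q + I) + g / 3 * r ^+ I
    + (ct (p * 'X^I) + be * ct 'X^(Q + I) + g / 3 * ct 'X^I) * e) * n y.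
  have h3' := ler_wpM2l be0 h3; have h4' := ler_wpM2l (ltW g30) h4.
  move: h1 h2 h3' h4'; move: (ct _) (ct _) (ct _) (g / 3) => c1 c2 c3 g3.
  by lra.
move: h5; rewrite ler_pM2r// => h5.
have h6 : (ct (p * 'X^I) + be * ct 'X^(Q + I) + g / 3 * ct 'X^I) * e <= g / 3 * r ^+ I.
  rewrite (@le_trans _ _ (c * e))//.
    by rewrite ler_wpM2r ?(ltW e0)// /c lerDl.
  by rewrite /e mulrC divfK// gt_eqF.
have gE : g * r ^+ I = rnorm p.[la] * r ^+ I - be * r ^+ (Q + I).
  by rewrite /g mulrBl exprD mulrA.
have : g * r ^+ I <= g * r ^+ I * (2 / 3).
  have := le_trans h5 (lerD (lexx _) h6).
  by rewrite [g / 3 * _]mulrAC; move: gE; set G := g * r ^+ I; lra.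
by apply/negP; rewrite -ltNge gtr_pMr ?mulr_gt0//; lra.
Qed.

End ApproximateEigenvectors.

(** * Fejer weights and the Fejer kernel *)

Section FejerWeights.
Variable R : realType.
Local Notation C := R[i].

(** The weight 1 - |i - k| / Q; the truncated subtraction makes it vanish outside
    the band. *)
Definition kf Q (i k : nat) : C := (Q - ((i - k) + (k - i)))%:R / Q%:R.

Lemma kf_ge Q i k : (i + Q <= k)%N || (k + Q <= i)%N -> kf Q i k = 0.
Proof.
move=> h; rewrite /kf (_ : (Q - _ = 0)%N) ?mul0r//.
by case/orP: h => h; lia.
Qed.

Lemma rnorm_kf Q i k : rnorm (kf Q i k) <= 1.
Proof.
rewrite /kf rnormM rnormV !rnorm_nat; case: Q => [|Q]; first by rewrite mul0r ler01.
by rewrite ler_pdivrMr// mul1r ler_nat leq_subr.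
Qed.

Lemma kf_shift Q i k n : kf Q (i + n) (k + n) = kf Q i k.
Proof. by rewrite /kf !subnDr. Qed.

Lemma kf_sym Q i k : kf Q i k = kf Q k i.
Proof. by rewrite /kf addnC. Qed.

Lemma kf_cvg Q i k : (0 < Q)%N ->
  rnorm (1 - kf Q i k) <= ((i - k) + (k - i))%:R / Q%:R.
Proof.
move=> Q0; set d := ((i - k) + (k - i))%N.
have QC : (Q%:R : C) != 0 by rewrite pnatr_eq0 -lt0n.
rewrite (_ : 1 - kf Q i k = (minn Q d)%:R / Q%:R).
  rewrite rnormM rnormV !rnorm_nat ler_pM2r ?invr_gt0 ?ltr0n// ler_nat.
  exact: geq_minr.
rewrite /kf -/d; transitivity ((Q%:R - (Q - d)%:R) / Q%:R : C).
  by rewrite mulrBl mulfV.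
by rewrite -natrB ?leq_subr//; congr (_%:R / _); lia.
Qed.

Let sum_eq_nat Q a : (\sum_(l < Q) (l == a :> nat) = (a < Q))%N.
Proof.
case: ltnP => h.
  rewrite (bigD1 (Ordinal h))//= eqxx big1 ?addn0// => l hl.
  by apply/eqP; rewrite eqb0.
by apply: big1 => l _; apply/eqP; rewrite eqb0; apply/eqP => e; move: (ltn_ord l); rewrite e ltnNge h.
Qed.

Let sum_ltn Q m : (m <= Q)%N -> (\sum_(l < Q) (l < m) = m)%N.
Proof.
move=> mQ; rewrite -[RHS]card_ord -sum1_card (big_ord_widen Q (fun=> 1%N))//.
by rewrite [RHS]big_mkcond; apply: eq_bigr => l _; case: ltnP.
Qed.

Let count_diag_le Q i k : (i <= k)%N ->
  (\sum_(l < Q) \sum_(l' < Q) (l + i == l' + k) = Q - ((i - k) + (k - i)))%N.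
Proof.
move=> ik; rewrite exchange_big /=.
rewrite (eq_bigr (fun l : 'I_Q => (l < Q - (k - i) : nat)%N)); last first.
  move=> l' _; rewrite (_ : (l' < _)%N = (l' + (k - i) < Q)%N); last by lia.
  rewrite -sum_eq_nat; apply: eq_bigr => l _; congr nat_of_bool.
  by apply/eqP/eqP; lia.
by rewrite sum_ltn; lia.
Qed.

Lemma count_diag Q i k :
  (\sum_(l < Q) \sum_(l' < Q) (l + i == l' + k) = Q - ((i - k) + (k - i)))%N.
Proof.
case: (leqP i k) => [|/ltnW] h; first exact: count_diag_le.
rewrite addnC -(count_diag_le Q h) exchange_big /=.
by apply: eq_bigr => l _; apply: eq_bigr => l' _; rewrite eq_sym.
Qed.

(** The Fejer kernel is a square, hence nonnegative. *)
Lemma fejer_kernel (h Q : nat) (w : C) : rnorm w = 1 ->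
  (forall i j, (i < 2 ^ h)%N -> (j < 2 ^ h)%N ->
    \sum_(k < 2 ^ h) (w ^+ k) ^+ i * (w ^+ k) ^- j = (2 ^ h * (i == j))%:R) ->
  (0 < Q)%N ->
  exists F : nat -> R, [/\ forall s, 0 <= F s,
    (Q <= 2 ^ h)%N -> \sum_(s < 2 ^ h) F s = (2 ^ h)%:R &
    forall i k, (i + Q <= 2 ^ h)%N -> (k + Q <= 2 ^ h)%N ->
    \sum_(s < 2 ^ h) (F s)%:C * (w ^+ s) ^+ i * (w ^+ s) ^- k =
      (2 ^ h)%:R * kf Q i k].
Proof.
move=> w1 orth Q0.
have w0 : w != 0 by rewrite -rnorm_gt0 w1 ltr01.
have wconj k : ((w ^+ k)^*)%C = w ^- k.
  have e : w * w^*%C = 1 by rewrite -rnorm_sqrE w1 expr1n.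
  rewrite rmorphXn -exprVn; congr (_ ^+ _).
  by apply: (mulfI w0); rewrite e mulfV.
pose F s : R := rnorm (\sum_(l < Q) (w ^+ s) ^+ l) ^+ 2 / Q%:R.
have QC : (Q%:R : C) != 0 by rewrite pnatr_eq0 -lt0n.
have FE s : (F s)%:C = (\sum_(l < Q) \sum_(l' < Q) (w ^+ s) ^+ l * (w ^+ s) ^- l') / Q%:R.
  rewrite /F rmorphM /= rnorm_sqrE fmorphV rmorph_nat; congr (_ / _).
  rewrite rmorph_sum /= big_distrlr /=; apply: eq_bigr => l _; apply: eq_bigr => l' _.
  by rewrite -[X in (X^*)%C]exprM wconj exprM.
have main i k : (i + Q <= 2 ^ h)%N -> (k + Q <= 2 ^ h)%N ->
    \sum_(s < 2 ^ h) (F s)%:C * (w ^+ s) ^+ i * (w ^+ s) ^- k =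
      (2 ^ h)%:R * kf Q i k.
  move=> hi hk.
  transitivity (\sum_(s < 2 ^ h) \sum_(l < Q) \sum_(l' < Q)
     (w ^+ s) ^+ (l + i) * (w ^+ s) ^- (l' + k) / Q%:R).
    apply: eq_bigr => s _; rewrite FE -!mulrA mulr_suml.
    apply: eq_bigr => l _; rewrite mulr_suml; apply: eq_bigr => l' _.
    by rewrite !exprD invfM; ring.
  rewrite exchange_big /=.
  under eq_bigr => l _.
    rewrite exchange_big /=.
    under eq_bigr => l' _.
      rewrite -mulr_suml orth; last 2 first.
        by rewrite (leq_trans _ hi)// addnC ltn_add2l.
        by rewrite (leq_trans _ hk)// addnC ltn_add2l.
      rewrite natrM -mulrA.
      over.
    rewrite -mulr_sumr -mulr_suml.
    over.
  rewrite -mulr_sumr -mulr_suml /kf -count_diag natr_sum; congr (_ * (_ / _)).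
  by apply: eq_bigr => l _; rewrite natr_sum.
exists F; split => //.
- by move=> s; rewrite divr_ge0// sqr_ge0.
- move=> hQ; apply: complexI; rewrite rmorph_sum rmorph_nat /=.
  have := main 0%N 0%N hQ hQ; rewrite /kf !subnn subn0 mulfV// mulr1 => <-.
  by apply: eq_bigr => s _; rewrite !expr0 invr1 !mulr1.
Qed.

End FejerWeights.

(** * Polynomials as finitely supported sequences *)

Section SequenceSpace.
Variables (R : realType) (E : completeNormedModType R[i]).
Local Notation C := R[i].
Variable j : E -> nat -> C.
Hypothesis j_linear : forall (a : C) (x y : E) (n : nat),
  j (a *: x + y) n = a * j x n + j y n.
Hypothesis j_inj : injective j.
Hypothesis F_sub : forall u : nat -> C, finsupp u -> exists x : E, j x = u.
Hypothesis F_dense : dense [set x : E | finsupp (j x)].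
Hypothesis coord_cont : forall n : nat, continuous (fun x : E => j x n : R[i]^o).

Lemma j0 n : j 0 n = 0.
Proof. by have := j_linear (-1) 0 0 n; rewrite scaleN1r oppr0 addr0 mulN1r addNr. Qed.

Lemma jD x y n : j (x + y) n = j x n + j y n.
Proof. by have := j_linear 1 x y n; rewrite scale1r mul1r. Qed.

Lemma jZ a x n : j (a *: x) n = a * j x n.
Proof. by have := j_linear a x 0 n; rewrite !addr0 j0 addr0. Qed.

Lemma jB x y n : j (x - y) n = j x n - j y n.
Proof. by rewrite jD -scaleN1r jZ mulN1r. Qed.

Definition emb (q : {poly C}) : E := seq_lift j (fun n => q`_n).

Lemma seq_liftE u x : j x = u -> seq_lift j u = x.
Proof.
move=> jx; rewrite /seq_lift; apply: j_inj.
by case: xgetP => [y -> /= -> //|/(_ x)]; rewrite jx.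
Qed.

Lemma jemb q : j (emb q) = fun n => q`_n.
Proof.
have [x jx] : exists x, j x = fun n => q`_n.
  by apply: F_sub; exists (size q) => n h; rewrite nth_default.
by rewrite /emb (seq_liftE jx).
Qed.

Lemma emb_eq x (q : {poly C}) : (forall n, j x n = q`_n) -> x = emb q.
Proof. by move=> h; apply: j_inj; rewrite jemb; apply/funext. Qed.

Lemma embD p q : emb (p + q) = emb p + emb q.
Proof. by apply/esym/emb_eq => n; rewrite jD !jemb coefD. Qed.

Lemma embZ c p : emb (c *: p) = c *: emb p.
Proof. by apply/esym/emb_eq => n; rewrite jZ !jemb coefZ. Qed.

Lemma emb0 : emb 0 = 0.
Proof. by apply/esym/emb_eq => n; rewrite j0 coef0. Qed.

Lemma embB p q : emb (p - q) = emb p - emb q.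
Proof. by rewrite embD -scaleN1r embZ scaleN1r. Qed.

Lemma emb_sum I (r : seq I) (P : pred I) (F : I -> {poly C}) :
  emb (\sum_(i <- r | P i) F i) = \sum_(i <- r | P i) emb (F i).
Proof. by elim/big_rec2: _ => [|i y1 y2 _ <-]; rewrite ?emb0// embD. Qed.

Lemma finsupp_emb x : finsupp (j x) -> exists q, x = emb q.
Proof.
case=> M hM; exists (\poly_(i < M) j x i); apply: emb_eq => n.
by rewrite coef_poly; case: ltnP => // /hM.
Qed.

Lemma emb_dense x e : 0 < e -> exists q, rnorm (x - emb q) < e.
Proof.
move=> e0.
have e0C : 0 < e%:C by rewrite ltcR.
have [|y [xy /finsupp_emb[q yE]]] := F_dense _ (ball_open x e%:C).
  by exists x; exact: ballxx.
by exists q; move: xy; rewrite yE -ball_normE /ball_ /= normE ltcR.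
Qed.

Lemma coord_bounded n : exists2 c, 0 <= c & forall x, rnorm (j x n) <= c * rnorm x.
Proof.
have /cvgrPdist_lt/(_ 1 ltr01) := @coord_cont n 0.
move=> /nbhs_ballP[d /= d0 hd].
have dE : d = (complex.Re d)%:C.
  by move: d0; case: d {hd} => a b; rewrite ltcE /= => /andP[/eqP -> _].
have d0' : 0 < complex.Re d by rewrite dE ltcR in d0.
set d' := complex.Re d in dE d0'.
exists (2 / d'); first by rewrite divr_ge0// ltW.
move=> x; have [->|x0] := eqVneq x 0; first by rewrite j0 !rnorm0 mulr0.
have nx : 0 < rnorm x by rewrite rnorm_gt0.
pose t := d' / 2 / rnorm x.
have t0 : 0 < t by rewrite !divr_gt0.
have : ball (0 : E) d (t%:C *: x).
  rewrite -ball_normE /ball_ /= sub0r normrN normE dE ltcR rnormZ rnorm_real.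
  rewrite gtr0_norm// /t divfK ?gt_eqF// ltr_pdivrMr// ltr_pMr//.
  by rewrite ltrDl.
move=> /hd /=; rewrite j0 sub0r normrN jZ normE ltcR rnormM rnorm_real gtr0_norm//.
move=> h; rewrite -ler_pdivrMr// mulrC.
move: h; rewrite /t mulrC; set z := rnorm (j x n) => h.
rewrite -(ler_pM2r d0') -(ler_pM2r (_ : 0 < 2^-1)) ?invr_gt0//.
rewrite [X in _ <= X](_ : _ = 1); last by field; rewrite gt_eqF.
by rewrite (le_trans _ (ltW h))//; apply: eq_ler; field; rewrite gt_eqF.
Qed.

Variable K : R.
Hypothesis K0 : 0 < K.
Hypothesis rot : forall z x, rnorm z = 1 ->
  exists2 y, j y = rotate z (j x) & rnorm y <= K * rnorm x.

Definition emb_norm (q : {poly C}) : R := rnorm (emb q).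
Local Notation N := emb_norm.

Lemma N_ge0 q : 0 <= N q. Proof. exact: rnorm_ge0. Qed.
Lemma ND p q : N (p + q) <= N p + N q. Proof. by rewrite /N embD rnormD. Qed.
Lemma NZ c p : N (c *: p) = rnorm c * N p. Proof. by rewrite /N embZ rnormZ. Qed.
Lemma N0 : N 0 = 0. Proof. by rewrite /N emb0 rnorm0. Qed.
Lemma N_sum I (r : seq I) (P : pred I) (F : I -> {poly C}) :
  N (\sum_(i <- r | P i) F i) <= \sum_(i <- r | P i) N (F i).
Proof. by rewrite /N emb_sum rnorm_sum. Qed.

Lemma N_gt0 q : (0 < N q) = (q != 0).
Proof.
rewrite /N rnorm_gt0; apply/idP/idP; apply: contra => /eqP h; first by rewrite h emb0.
apply/eqP/polyP => i; have := congr1 (fun u => u i) (jemb q).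
by rewrite h j0 coef0.
Qed.

Definition rotp (w : C) (q : {poly C}) : {poly C} := \poly_(i < size q) (w ^+ i * q`_i).

Lemma coef_rotp w q i : (rotp w q)`_i = w ^+ i * q`_i.
Proof. by rewrite coef_poly; case: ltnP => // h; rewrite nth_default// mulr0. Qed.

Lemma N_rotp w q : rnorm w = 1 -> N (rotp w q) <= K * N q.
Proof.
move=> w1; have [y jy] := rot (emb q) w1.
rewrite (_ : y = emb (rotp w q))//; apply: emb_eq => n.
by rewrite jy /rotate jemb coef_rotp.
Qed.

(** Averaging over rotations extracts a coefficient. *)
Lemma coef_average (P : {poly C} -> R) (M : R) (q : {poly C}) i :
  (forall p q, P (p + q) <= P p + P q) -> (forall c p, P (c *: p) = rnorm c * P p) ->
  (forall w, rnorm w = 1 -> P (rotp w q) <= M) -> P (q`_i *: 'X^i) <= M.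
Proof.
move=> PD PZ PM.
have Psum (I : Type) (r : seq I) (F : I -> {poly C}) :
    P (\sum_(i <- r) F i) <= \sum_(i <- r) P (F i).
  elim/big_rec2: _ => [|k y1 y2 _ h]; last by rewrite (le_trans (PD _ _))// lerD2l.
  by rewrite -(scale0r 0) PZ rnorm0 mul0r.
have [h hh] := exists_pow2_ge (maxn (size q) i.+1).
have [w [w1 orth]] := unit_roots R h.
have n0 : 0 < (2 ^ h)%:R :> R by rewrite ltr0n expn_gt0.
have E1 : \sum_(k < 2 ^ h) (w ^+ k) ^- i *: rotp (w ^+ k) q = (2 ^ h)%:R *: (q`_i *: 'X^i).
  apply/polyP => l; rewrite coef_sum.
  under eq_bigr do rewrite coefZ coef_rotp mulrA [_ ^- _ * _]mulrC.
  rewrite -mulr_suml !coefZ coefXn.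
  case: (ltnP l (2 ^ h)) => hl.
    rewrite orth//; last by rewrite (leq_trans _ hh)// leq_maxr.
    by case: eqVneq => [->|]; rewrite ?muln1 ?muln0 ?mulr1 ?mulr0 ?mul0r ?mulr0.
  rewrite nth_default ?mulr0; last by rewrite (leq_trans _ hl)// (leq_trans _ hh)// leq_maxl.
  case: eqVneq => [e|]; rewrite ?mulr0//; move: hl; rewrite e leqNgt.
  by rewrite (leq_trans _ hh)// leq_maxr.
rewrite -(ler_pM2l n0) -(rnorm_nat R) -PZ -E1 (le_trans (Psum _ _ _))//.
apply: (@le_trans _ _ (\sum_(k < 2 ^ h) M)).
  apply: ler_sum => k _; rewrite PZ rnormV !rnormX w1 !expr1n invr1 mul1r.
  by apply: PM; rewrite rnormX w1 expr1n.
by rewrite sumr_const card_ord rnorm_nat mulr_natl.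
Qed.

Lemma N_coef (q : {poly C}) i : rnorm q`_i * N 'X^i <= K * N q.
Proof.
by rewrite -NZ; apply: coef_average => [p p'|c p|w]; [exact: ND|exact: NZ|exact: N_rotp].
Qed.

Lemma coord_le x i : rnorm (j x i) * N 'X^i <= K * rnorm x.
Proof.
have [c c0 hc] := coord_bounded i.
apply/ler_addgt0Pr => e e0.
pose d := e / (c * N 'X^i + K + 1).
have D0 : 0 < c * N 'X^i + K + 1.
  by have := mulr_ge0 c0 (N_ge0 'X^i); have := K0; lra.
have d0 : 0 < d by rewrite divr_gt0.
have [q hq] := emb_dense x d0.
have h1 : rnorm (j x i) <= rnorm q`_i + c * d.
  have := hc (x - emb q); rewrite jB jemb => h.
  rewrite -(subrK q`_i (j x i)) addrC (le_trans (rnormD _ _))// lerD2l (le_trans h)//.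
  by rewrite ler_wpM2l// ltW.
have h2 : N q <= rnorm x + d.
  rewrite /N -(subrK x (emb q)) addrC (le_trans (rnormD _ _))// lerD2l rnorm_distC.
  exact: ltW.
have h3 := N_coef q i.
have h4 : K * N q <= K * (rnorm x + d) by rewrite ler_wpM2l// ltW.
have h5 : rnorm (j x i) * N 'X^i <= (rnorm q`_i + c * d) * N 'X^i.
  by rewrite ler_wpM2r// N_ge0.
have h6 : (c * N 'X^i + K) * d <= e.
  rewrite /d mulrA ler_pdivrMr// mulrC ler_pM2l// lerDl//.
by move: h6 h5 h4 h3; rewrite !mulrDl !mulrDr; lra.
Qed.

(** A matrix loses nothing but the factor [K ^+ 2] when its diagonals are
    multiplied by Fejer weights: the result is an average of the conjugates of
    the matrix by rotations.  As a sum over the roots of unity only sees a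
    diagonal up to a period, the columns are first replaced by polynomials. *)
Lemma fejer_op (x : nat -> E) b Q (q : {poly C}) : (0 < Q)%N -> 0 <= b ->
  (forall n (p : {poly C}), (size p <= n)%N ->
     rnorm (\sum_(k < n) p`_k *: x k) <= b * N p) ->
  N (\sum_(k < size q) q`_k *: \poly_(i < k + Q) (kf R Q i k * j (x k) i))
    <= K ^+ 2 * b * N q.
Proof.
move=> Q0 b0 hx; set n := size q.
pose A := \sum_(k < n) rnorm q`_k.
pose D := K * A + \sum_(k < n) rnorm q`_k * ((k + Q)%:R * K) + 1.
have A0 : 0 <= A by apply: sumr_ge0 => k _; exact: rnorm_ge0.
have D0 : 0 < D.
  rewrite /D ltr_wpDl// addr_ge0//; first by rewrite mulr_ge0// ltW.
  by apply: sumr_ge0 => k _; rewrite !mulr_ge0 ?rnorm_ge0 ?(ltW K0).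
apply/ler_addgt0Pr => e e0.
pose d := e / D; have d0 : 0 < d by rewrite divr_gt0.
have /choice[g hg] k : exists p, rnorm (x k - emb p) < d by exact: emb_dense.
have [h hh] := exists_pow2_ge (\max_(k < n) maxn (size (g k)) k + Q).
have sg (k : 'I_n) : (size (g k) + Q <= 2 ^ h)%N.
  rewrite (leq_trans _ hh)// leq_add2r.
  by rewrite (bigD1 k)//= !leq_max leqnn.
have kh (k : 'I_n) : (k + Q <= 2 ^ h)%N.
  rewrite (leq_trans _ hh)// leq_add2r.
  by rewrite (bigD1 k)//= !leq_max leqnn orbT.
have [w [w1 orth]] := unit_roots R h.
have w0 : w != 0 by rewrite -rnorm_gt0 w1 ltr01.
have ws s : rnorm (w ^+ s) = 1 by rewrite rnormX w1 expr1n.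
have wsV s : rnorm (w ^- s) = 1 by rewrite rnormV ws invr1.
have [F [F0 F1 FK]] := fejer_kernel w1 orth Q0.
have QH : (Q <= 2 ^ h)%N by rewrite (leq_trans _ hh)// leq_addl.
pose V s := rotp (w ^+ s) (\sum_(k < n) (w ^- s ^+ k * q`_k) *: g k).
have NV s : N (V s) <= K * (b * (K * N q) + A * d).
  rewrite (le_trans (N_rotp _ (ws s)))// ler_wpM2l ?(ltW K0)//.
  rewrite /N emb_sum.
  have -> : \sum_(k < n) emb ((w ^- s ^+ k * q`_k) *: g k) =
     \sum_(k < n) (rotp (w ^- s) q)`_k *: x k -
     \sum_(k < n) (w ^- s ^+ k * q`_k) *: (x k - emb (g k)).
    rewrite -sumrB; apply: eq_bigr => k _.
    by rewrite coef_rotp scalerBr opprB addrC subrK embZ.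
  rewrite (le_trans (rnormB _ _))// lerD//.
    rewrite (le_trans (hx _ _ _))//; first by rewrite size_poly.
    by rewrite ler_wpM2l// N_rotp.
  rewrite (le_trans (rnorm_sum _ _ _))// /A mulr_suml; apply: ler_sum => k _.
  by rewrite rnormZ rnormM rnormX wsV expr1n mul1r ler_wpM2l ?rnorm_ge0// ltW.
pose G := \sum_(k < n) q`_k *: \poly_(i < k + Q) (kf R Q i k * (g k)`_i).
have n0 : 0 < (2 ^ h)%:R :> R by rewrite ltr0n expn_gt0.
have GE : \sum_(s < 2 ^ h) (F s)%:C *: V s = (2 ^ h)%:R *: G.
  apply/polyP => i; rewrite coef_sum coefZ /G coef_sum mulr_sumr.
  under eq_bigr => s _ do rewrite coefZ /V coef_rotp coef_sum mulr_sumr mulr_sumr.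
  rewrite exchange_big /=; apply: eq_bigr => k _.
  rewrite coefZ coef_poly.
  rewrite (eq_bigr (fun s : 'I_(2 ^ h) => ((F s)%:C * (w ^+ s) ^+ i * (w ^+ s) ^- k)
      * (q`_k * (g k)`_i))); last first.
    by move=> s _; rewrite coefZ exprVn; ring.
  rewrite -mulr_suml.
  case: (ltnP i (size (g k))) => hi; last first.
    by rewrite (nth_default _ hi) !mulr0 if_same !mulr0.
  rewrite FK//; last by rewrite (leq_trans _ (sg k))// leq_add2r ltnW.
  case: ltnP => hik; first by ring.
  by rewrite kf_ge ?hik ?orbT// !(mulr0, mul0r).
have NG : N G <= K * (b * (K * N q) + A * d).
  rewrite -(ler_pM2l n0) -(rnorm_nat R) -NZ -GE rnorm_nat.
  rewrite -(F1 QH) mulr_suml (le_trans (N_sum _ _ _))//.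
  by apply: ler_sum => s _; rewrite NZ rnorm_real (ger0_norm (F0 s)) ler_wpM2l.
set H := \sum_(k < n) _.
have HG : H - G = \sum_(k < n) q`_k *: \sum_(i < k + Q)
    (kf R Q i k * j (x k - emb (g k)) i) *: 'X^i.
  rewrite -sumrB; apply: eq_bigr => k _; rewrite -scalerBr; congr (_ *: _).
  rewrite -(poly_def (k + Q) (fun i => kf R Q i k * j (x k - emb (g k)) i)).
  apply/polyP => i; rewrite coefB !coef_poly.
  by case: ltnP; rewrite ?subr0// jB jemb mulrBr.
have NHG : N (H - G) <= (\sum_(k < n) rnorm q`_k * ((k + Q)%:R * K)) * d.
  rewrite HG (le_trans (N_sum _ _ _))// mulr_suml; apply: ler_sum => k _.
  rewrite NZ -mulrA ler_wpM2l ?rnorm_ge0// (le_trans (N_sum _ _ _))//.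
  apply: (@le_trans _ _ (\sum_(i < k + Q) K * d)); last first.
    by rewrite sumr_const card_ord -[X in X <= _]mulr_natl mulrA.
  apply: ler_sum => i _; rewrite NZ rnormM -mulrA.
  apply: (@le_trans _ _ (1 * (rnorm (j (x k - emb (g k)) i) * N 'X^i))).
    by rewrite ler_wpM2r ?rnorm_kf// mulr_ge0 ?rnorm_ge0 ?N_ge0.
  rewrite mul1r (le_trans (coord_le _ _))// ler_wpM2l ?(ltW K0)// ltW//.
rewrite -(subrK G H) (le_trans (ND _ _))//.
have : D * d = e by rewrite /d mulrC divfK// gt_eqF.
by have := ltW d0; rewrite /D; move: NHG NG; rewrite expr2 !mulrDl !mulrDr; lra.
Qed.

End SequenceSpace.

(** * Fejer means and banded matrices *)

Section FejerPolynomials.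
Variable R : realType.
Local Notation C := R[i].

(** [z ^- Q * (fej Q c).[z]] is the Fejer mean of the series with coefficients
    [c]. *)
Definition fej Q (c : int -> C) : {poly C} :=
  \poly_(e < Q.*2) (kf R Q e Q * c (e%:Z - Q%:Z)).

Definition fejop Q (ent : nat -> nat -> C) (q : {poly C}) : {poly C} :=
  \sum_(k < size q) q`_k *: \poly_(i < k + Q) (kf R Q i k * ent i k).

Lemma fejop_wide n Q ent (q : {poly C}) : (size q <= n)%N ->
  fejop Q ent q = \sum_(k < n) q`_k *: \poly_(i < k + Q) (kf R Q i k * ent i k).
Proof.
move=> h; rewrite /fejop.
rewrite (big_ord_widen n (fun k => q`_k *: \poly_(i < k + Q) (kf R Q i k * ent i k)) h).
rewrite big_mkcond; apply: eq_bigr => i _; case: ltnP => // hi.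
by rewrite nth_default// scale0r.
Qed.

Lemma fejop_MXn Q ent (g : {poly C}) :
  fejop Q ent ('X^Q * g) = \sum_(k < size g) g`_k *:
    \sum_(e < Q.*2) (kf R Q e Q * ent (k + e)%N (k + Q)%N) *: 'X^(k + e).
Proof.
have h1 : (size ('X^Q * g)%R <= Q + size g)%N.
  by rewrite (leq_trans (size_polyMleq _ _))// size_polyXn addSn.
rewrite (fejop_wide _ _ h1) big_split_ord /= big1 ?add0r => [|i _]; last first.
  by rewrite coefXnM ltn_ord scale0r.
apply: eq_bigr => k _; rewrite coefXnM ltnNge leq_addr /= addKn; congr (_ *: _).
apply/polyP => i; rewrite coef_poly coef_sum.
under eq_bigr => e _ do rewrite coefZ coefXn.
case: (ltnP i k) => ik.
  rewrite big1 => [|e _]; last first.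
    by rewrite (_ : (i == _) = false) ?mulr0//; apply/eqP; lia.
  by rewrite kf_ge ?mul0r ?if_same//; apply/orP; left; lia.
rewrite (_ : (i < _)%N = (i - k < Q.*2)%N); last by rewrite -addnn; lia.
case: ltnP => h.
  rewrite (bigD1 (Ordinal h))//= subnKC// eqxx mulr1 big1 ?addr0 => [|e he].
    rewrite [(Q + k)%N]addnC; congr (_ * _).
    by rewrite -(kf_shift _ _ (i - k) Q k) subnK// addnC.
  rewrite (_ : (i == _) = false) ?mulr0//; apply/eqP => ie.
  by move/eqP: he; apply; apply: val_inj => /=; lia.
rewrite big1 => [//|e _]; rewrite (_ : (i == _) = false) ?mulr0//; apply/eqP.
by move: (ltn_ord e); lia.
Qed.

Lemma drop_fejop Q ent (q : {poly C}) :
  drop_poly Q (fejop Q ent q) = \sum_(k < size q) q`_k *: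
    \sum_(e < Q.*2) (kf R Q e Q * ent (k + Q - e)%N k) *: drop_poly e 'X^k.
Proof.
rewrite /fejop drop_poly_sum; apply: eq_bigr => k _.
rewrite drop_polyZ; congr (_ *: _).
apply/polyP => i; rewrite coef_drop_poly coef_poly coef_sum.
under eq_bigr => e _ do rewrite coefZ coef_drop_poly coefXn.
case: (ltnP k i) => ik.
  rewrite big1 => [|e _]; last first.
    by rewrite (_ : (_ == _ :> nat) = false) ?mulr0//; apply/eqP; lia.
  by rewrite ltn_add2r ltnNge (ltnW ik).
case: (ltnP (k - i) Q.*2) => h.
  rewrite (bigD1 (Ordinal h))//= subnKC// eqxx mulr1 big1 ?addr0 => [|e he].
    rewrite (_ : (k + Q - (k - i))%N = (i + Q)%N); last by lia.
    rewrite [kf R Q (k - i) Q]kf_sym -(kf_shift _ _ Q (k - i) i) subnK// [(Q + i)%N]addnC.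
    case: ltnP => // hh; by rewrite kf_ge ?mul0r// hh orbT.
  rewrite (_ : (_ == _ :> nat) = false) ?mulr0//; apply/eqP => ie.
  by move/eqP: he; apply; apply: val_inj => /=; lia.
rewrite big1 => [|e _].
  by rewrite kf_ge ?mul0r ?if_same//; apply/orP; left; move: h; rewrite -addnn; lia.
rewrite (_ : (_ == _ :> nat) = false) ?mulr0//; apply/eqP.
by move: (ltn_ord e); lia.
Qed.

Lemma sub_index_le (k e Q : nat) : (e < Q.*2)%N -> (k <= k + Q - e + Q)%N.
Proof. by rewrite -addnn; lia. Qed.

Lemma fej_mul Q c (g : {poly C}) :
  fej Q c * g = \sum_(k < size g) g`_k *:
    \sum_(e < Q.*2) (kf R Q e Q * c (e%:Z - Q%:Z)) *: 'X^(k + e).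
Proof.
rewrite -{1}[g]coefK poly_def mulr_sumr; apply: eq_bigr => k _.
rewrite -scalerAr; congr (_ *: _).
rewrite /fej poly_def mulr_suml; apply: eq_bigr => e _.
by rewrite -scalerAl -exprD addnC.
Qed.

(** On the polynomials divisible by [X^Q] the band is not cut off by the corner of
    the matrix, and a Toeplitz band is multiplication by its symbol; [dl] is the
    deviation of [ent] from a Toeplitz matrix. *)
Lemma fej_mulE Q c dl ent (g : {poly C}) :
  (forall i k : nat, ent i k = c (i%:Z - k%:Z) - dl i k) ->
  fej Q c * g = fejop Q ent ('X^Q * g) + \sum_(k < size g) g`_k *:
    \sum_(e < Q.*2) (kf R Q e Q * dl (k + e)%N (k + Q)%N) *: 'X^(k + e).
Proof.
move=> h; rewrite fej_mul fejop_MXn -big_split; apply: eq_bigr => k _ /=.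
rewrite -scalerDr -big_split; congr (_ *: _); apply: eq_bigr => e _ /=.
rewrite -scalerDl -mulrDr h subrK !PoszD; congr ((_ * c _) *: _).
by ring.
Qed.

(** Inversion of the circle exchanges the roles of S and S_{-1}. *)
Lemma fej_rev Q c (z : C) : z != 0 ->
  (fej Q (fun d => c (- d))).[z] = z ^+ Q.*2 * (fej Q c).[z^-1].
Proof.
move=> z0; rewrite !horner_poly mulr_sumr.
case: Q => [|Q]; first by rewrite !big_ord0.
have k0 : kf R Q.+1 0 Q.+1 = 0 by rewrite kf_ge// add0n leqnn.
rewrite doubleS [LHS]big_ord_recl [RHS]big_ord_recl /= !k0 !(mul0r, mulr0) !add0r.
rewrite [LHS](reindex_inj rev_ord_inj) /=; apply: eq_bigr => e _.
have hE : (bump 0 ((Q.*2).+1 - e.+1) = Q.*2.+2 - bump 0 e)%N.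
  by rewrite /bump /=; move: (ltn_ord e); lia.
have he : (bump 0 e < Q.*2.+2)%N by rewrite /bump /=; move: (ltn_ord e); lia.
move: (bump 0 e) he hE => a ha ->.
rewrite (_ : kf R Q.+1 (Q.*2.+2 - a) Q.+1 = kf R Q.+1 a Q.+1); last first.
  by rewrite /kf; congr (_%:R / _); move: ha; rewrite -addnn; lia.
rewrite (_ : - (Posz (Q.*2.+2 - a)%N - Q.+1%:Z) = a%:Z - Q.+1%:Z); last first.
  by move: ha; rewrite -addnn; lia.
rewrite exprVn [X in _ = X]mulrCA; congr (_ * _).
rewrite -{2}(subnK (ltnW ha)) exprD mulfK// expf_neq0//.
Qed.

Lemma geom_tail (t : R) I n : 0 <= t -> t < 1 ->
  \sum_(k < n | (I <= k)%N) t ^+ k <= t ^+ I / (1 - t).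
Proof.
move=> t0 t1; have t1' : 0 < 1 - t by rewrite subr_gt0.
rewrite ler_pdivlMr//.
suff -> : (\sum_(k < n | (I <= k)%N) t ^+ k) * (1 - t) =
    if (I <= n)%N then t ^+ I - t ^+ n else 0.
  by case: ifP => _; rewrite ?exprn_ge0// gerBl exprn_ge0.
elim: n => [|n ih].
  by rewrite big_ord0 mul0r; case: I => // ; rewrite leqnn subrr.
rewrite big_mkcond big_ord_recr -big_mkcond /= mulrDl ih [(I <= n.+1)%N]leq_eqVlt ltnS.
case: (leqP I n) => In; rewrite ?orbT; first by rewrite exprS; ring.
rewrite add0r mul0r orbF; case: eqP => // ->; rewrite subrr//.
Qed.

End FejerPolynomials.

(** * Polynomials in the shifts on a critical circle *)

Section PolynomialNorm.
Variable R : realType.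
Local Notation C := R[i].
Variables (K : R) (N : {poly C} -> R).
Hypothesis K0 : 0 < K.
Hypothesis N_ge0 : forall q, 0 <= N q.
Hypothesis ND : forall p q, N (p + q) <= N p + N q.
Hypothesis NZ : forall c p, N (c *: p) = rnorm c * N p.
Hypothesis N_gt0 : forall q, (0 < N q) = (q != 0).
Hypothesis N_rotp : forall w q, rnorm w = 1 -> N (rotp w q) <= K * N q.

Let N_sum I (r : seq I) (P : pred I) (F : I -> {poly C}) :
  N (\sum_(i <- r | P i) F i) <= \sum_(i <- r | P i) N (F i).
Proof.
elim/big_rec2: _ => [|k y1 y2 _ h]; last by rewrite (le_trans (ND _ _))// lerD2l.
by rewrite -(scale0r 0) NZ rnorm0 mul0r.
Qed.

Let N_coef (q : {poly C}) i : rnorm q`_i * N 'X^i <= K * N q.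
Proof. by rewrite -NZ; apply: coef_average => // w; exact: N_rotp. Qed.

Let N0 : N 0 = 0.
Proof. by rewrite -(scale0r 0) NZ rnorm0 mul0r. Qed.

Definition opN (L : {poly C} -> {poly C}) : R :=
  sup [set N (L q) | q in [set q | N q <= 1]].

Section Opn.
Variables (L : {poly C} -> {poly C}) (c : R).
Hypothesis LZ : forall a q, L (a *: q) = a *: L q.
Hypothesis Lc : forall q, N (L q) <= c * N q.

Let opN_has_sup : has_sup [set N (L q) | q in [set q | N q <= 1]].
Proof.
split; first by exists (N (L 0)), 0 => //=; rewrite N0 ler01.
exists `|c| => _ [q /= q1 <-].
rewrite (le_trans (Lc q))// (@le_trans _ _ (`|c| * N q))//.
  by rewrite ler_wpM2r// ler_norm.
by rewrite -[X in _ <= X]mulr1 ler_wpM2l.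
Qed.

Lemma opNP q : N (L q) <= opN L * N q.
Proof.
have [->|q0] := eqVneq q 0.
  by rewrite -(scale0r 0) LZ !scale0r N0 mulr0.
have Nq : 0 < N q by rewrite N_gt0.
rewrite -ler_pdivrMr//.
have a0 : 0 <= (N q)^-1 by rewrite invr_ge0.
rewrite mulrC -(ger0_norm a0) -(rnorm_real (N q)^-1) -NZ -LZ.
apply: sup_ubound; first by case: opN_has_sup.
exists ((N q)^-1%:C *: q) => //=.
by rewrite NZ rnorm_real ger0_norm// mulVf// gt_eqF.
Qed.

Lemma opN_ge0 : 0 <= opN L.
Proof.
apply: (le_trans (N_ge0 (L 0))); apply: sup_ubound; first by case: opN_has_sup.
by exists 0 => //=; rewrite N0 ler01.
Qed.

End Opn.

Lemma opN_le L c : 0 <= c -> (forall q, N (L q) <= c * N q) -> opN L <= c.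
Proof.
move=> c0 Lc; apply: ge_sup; first by exists (N (L 0)), 0 => //=; rewrite N0 ler01.
move=> _ [q /= q1 <-]; rewrite (le_trans (Lc q))//.
by rewrite -[X in _ <= X]mulr1 ler_wpM2l.
Qed.

Lemma fej_error_le (B : R) Q (u : nat -> nat -> C) (g : {poly C}) : 1 <= B ->
  (forall q, N ('X * q) <= B * N q) ->
  N (\sum_(k < size g) g`_k *: \sum_(e < Q.*2) (kf R Q e Q * u k e) *: 'X^(k + e))
  <= B ^+ Q.*2 * \sum_(k < size g) rnorm g`_k * N 'X^k * \sum_(e < Q.*2) rnorm (u k e).
Proof.
move=> B1 hB; have B0 : 0 <= B := le_trans ler01 B1.
have XB i q : N ('X^i * q) <= B ^+ i * N q.
  elim: i => [|i ih]; first by rewrite expr0 !mul1r.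
  by rewrite !exprS -!mulrA (le_trans (hB _))// ler_wpM2l.
rewrite (le_trans (N_sum _ _ _))// mulr_sumr; apply: ler_sum => k _.
rewrite NZ -[_ * N 'X^k * _]mulrA [X in _ <= X]mulrCA; apply: ler_wpM2l; first exact: rnorm_ge0.
rewrite (le_trans (N_sum _ _ _))// mulrCA mulr_sumr mulr_sumr.
apply: ler_sum => e _; rewrite NZ rnormM.
rewrite (@le_trans _ _ (1 * rnorm (u k e) * N 'X^(k + e)))//.
  by rewrite ler_wpM2r// ler_wpM2r ?rnorm_ge0// rnorm_kf.
rewrite mul1r mulrA [X in _ <= X]mulrC; apply: ler_wpM2l; first exact: rnorm_ge0.
rewrite addnC exprD [X in _ <= X]mulrC (le_trans (XB _ _))// ler_wpM2r//.
by rewrite ler_weXn2l// ltnW.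
Qed.

(** Both shifts are treated at once, as operators [s] which the conjugation by a
    rotation multiplies by a scalar. *)
Section PolynomialAction.
Variables (s : {poly C} -> {poly C}) (B : R).
Hypothesis sL : forall a p q, s (a *: p + q) = a *: s p + s q.
Hypothesis B1 : 1 <= B.
Hypothesis sB : forall q, N (s q) <= B * N q.
Hypothesis s_rot : forall w, rnorm w = 1 -> exists2 w', rnorm w' = 1 &
  forall q, rotp w' (s q) = w *: s (rotp w' q).

Let B0 : 0 <= B := le_trans ler01 B1.

Let s0 : s 0 = 0.
Proof. by have := sL (-1) 0 0; rewrite scaleN1r oppr0 addr0 scaleN1r addNr. Qed.

Let sD p q : s (p + q) = s p + s q.
Proof. by have := sL 1 p q; rewrite !scale1r. Qed.

Let sZ a p : s (a *: p) = a *: s p.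
Proof. by have := sL a p 0; rewrite s0 !addr0. Qed.

Let s_sum I (r : seq I) (P : pred I) (F : I -> {poly C}) :
  s (\sum_(i <- r | P i) F i) = \sum_(i <- r | P i) s (F i).
Proof. by elim/big_rec2: _ => [|k y1 y2 _ <-]; rewrite ?s0 ?sD. Qed.

Let itD i p q : iter i s (p + q) = iter i s p + iter i s q.
Proof. by elim: i => //= i ->. Qed.

Let itZ i a p : iter i s (a *: p) = a *: iter i s p.
Proof. by elim: i => //= i ->. Qed.

Let itB i q : N (iter i s q) <= B ^+ i * N q.
Proof.
elim: i => [|i ih]; first by rewrite expr0 mul1r.
by rewrite iterS exprS -mulrA (le_trans (sB _))// ler_wpM2l.
Qed.

Definition act (y q : {poly C}) : {poly C} := \sum_(i < size y) y`_i *: iter i s q.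

Let act_wide n (y q : {poly C}) : (size y <= n)%N ->
  act y q = \sum_(i < n) y`_i *: iter i s q.
Proof.
move=> h; rewrite /act (big_ord_widen n (fun i => y`_i *: iter i s q) h).
rewrite big_mkcond; apply: eq_bigr => i _; case: ltnP => // hi.
by rewrite nth_default// scale0r.
Qed.

Let actD y z q : act (y + z) q = act y q + act z q.
Proof.
pose n := maxn (size y) (size z).
rewrite !(@act_wide n) ?leq_maxl ?leq_maxr ?(leq_trans (size_polyD _ _))//.
by rewrite -big_split; apply: eq_bigr => i _; rewrite coefD scalerDl.
Qed.

Let actZl a y q : act (a *: y) q = a *: act y q.
Proof.
rewrite (@act_wide (size y)) ?size_scale_leq// /act scaler_sumr.
by apply: eq_bigr => i _; rewrite coefZ scalerA.
Qed.

Let actDr y p q : act y (p + q) = act y p + act y q.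
Proof.
by rewrite /act -big_split; apply: eq_bigr => i _; rewrite itD scalerDr.
Qed.

Let actZr a y q : act y (a *: q) = a *: act y q.
Proof.
rewrite /act scaler_sumr; apply: eq_bigr => i _.
by rewrite itZ !scalerA mulrC.
Qed.

Let act0 y : act y 0 = 0.
Proof. by have := actZr 0 y 0; rewrite !scale0r. Qed.

Let act_sumr I (r : seq I) (P : pred I) (F : I -> {poly C}) y :
  act y (\sum_(i <- r | P i) F i) = \sum_(i <- r | P i) act y (F i).
Proof.
by elim/big_rec2: _ => [|k y1 y2 _ <-]; rewrite ?act0 ?actDr.
Qed.

Let actX y q : act ('X * y) q = s (act y q).
Proof.
have h : (size ('X * y)%R <= (size y).+1)%N.
  by rewrite (leq_trans (size_polyMleq _ _))// size_polyX.
rewrite (act_wide _ h) big_ord_recl coefXM /= scale0r add0r /act s_sum.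
by apply: eq_bigr => i _; rewrite coefXM /= sZ.
Qed.

Let actC c q : act c%:P q = c *: q.
Proof.
by rewrite (@act_wide 1) ?size_polyC ?leq_b1// big_ord1 coefC.
Qed.

Let actM y z q : act (y * z) q = act y (act z q).
Proof.
elim/poly_ind: y => [|y c ih].
  by rewrite mul0r /act size_poly0 !big_ord0.
rewrite mulrDl actD mul_polyC actZl [y * 'X]mulrC -mulrA actX ih.
by rewrite actD actX actC.
Qed.

Let act_Xn i q : act 'X^i q = iter i s q.
Proof.
elim: i => [|i ih]; first by rewrite expr0 -polyC1 actC scale1r.
by rewrite exprS actX ih.
Qed.

Let actB y q : N (act y q) <= (\sum_(i < size y) rnorm y`_i * B ^+ i) * N q.
Proof.
rewrite (le_trans (N_sum _ _ _))// mulr_suml; apply: ler_sum => i _.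
by rewrite NZ -mulrA ler_wpM2l ?rnorm_ge0.
Qed.

Let n y := opN (act y).

Let nP y q : N (act y q) <= n y * N q.
Proof. by apply: opNP (actB y) _ => a p; exact: actZr. Qed.

Let n_ge0 y : 0 <= n y.
Proof. exact: opN_ge0 (actB y). Qed.

(** Rotating [y] amounts to conjugating y(s) by a rotation. *)
Let act_rot w y q : rnorm w = 1 -> N (act (rotp w y) q) <= K ^+ 2 * n y * N q.
Proof.
move=> w1; have [w' w'1 hw] := s_rot w1.
have w'0 : w' != 0 by rewrite -rnorm_gt0 w'1 ltr01.
have it_rot i p : rotp w' (iter i s p) = w ^+ i *: iter i s (rotp w' p).
  elim: i => [|i ih]; first by rewrite expr0 scale1r.
  by rewrite iterS hw ih sZ scalerA -exprS.
have rotpK p : rotp w' (rotp w'^-1 p) = p.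
  apply/polyP => i; rewrite !coef_rotp mulrA -exprMn mulfV// expr1n mul1r//.
have rotpL a p p' : rotp w' (a *: p + p') = a *: rotp w' p + rotp w' p'.
  by apply/polyP => i; rewrite !(coef_rotp, coefD, coefZ); ring.
have rotp_sum m (F : 'I_m -> {poly C}) : rotp w' (\sum_(i < m) F i) = \sum_(i < m) rotp w' (F i).
  elim/big_rec2: _ => [|k y1 y2 _ <-]; last by rewrite -[X in X + _]scale1r rotpL scale1r.
  by apply/polyP => i; rewrite coef_rotp !coef0 mulr0.
have -> : act (rotp w y) q = rotp w' (act y (rotp w'^-1 q)).
  rewrite (@act_wide (size y)) ?size_poly// /act rotp_sum.
  apply: eq_bigr => i _; rewrite coef_rotp -[_ *: iter i s (rotp _ _)]addr0 rotpL.
  rewrite it_rot rotpK scalerA mulrC -[LHS]addr0; congr (_ + _).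
  by apply/polyP => k; rewrite coef_rotp coef0 mulr0.
rewrite (le_trans (N_rotp _ w'1))// expr2 -!mulrA ler_wpM2l ?(ltW K0)//.
rewrite (le_trans (nP _ _))// mulrCA ler_wpM2l// N_rotp// rnormV w'1 invr1//.
Qed.

Let n_pnorm : pnorm (K ^+ 2) B n.
Proof.
have nc y c : 0 <= c -> (forall q, N (act y q) <= c * N q) -> n y <= c.
  by move=> c0 hc; apply: opN_le.
have nD p q : n (p + q) <= n p + n q.
  apply: nc => [|u]; first exact: addr_ge0.
  by rewrite actD (le_trans (ND _ _))// mulrDl lerD.
have nZle c p : n (c *: p) <= rnorm c * n p.
  apply: nc => [|u]; first by rewrite mulr_ge0// rnorm_ge0.
  by rewrite actZl NZ -mulrA ler_wpM2l ?rnorm_ge0.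
have nZ c p : n (c *: p) = rnorm c * n p.
  apply/eqP; rewrite eq_le nZle /=.
  have [->|c0] := eqVneq c 0; first by rewrite rnorm0 mul0r.
  have rc : 0 < rnorm c by rewrite rnorm_gt0.
  rewrite -ler_pdivlMl// -rnormV.
  by apply: le_trans (nZle _ _); rewrite scalerA mulVf// scale1r.
split => //.
- move=> p i; apply: coef_average => // w w1.
  by apply: nc => [|q]; [rewrite mulr_ge0// sqr_ge0|exact: act_rot].
- move=> p; apply: nc => [|q]; first exact: mulr_ge0.
  by rewrite actX (le_trans (sB _))// -mulrA ler_wpM2l.
Qed.

Variable r : R.
Hypothesis r0 : 0 < r.
Hypothesis s_growth : forall l, r ^+ l <= opN (iter l s).
Hypothesis s_radius : forall rho, 1 < rho ->
  exists c, forall l, opN (iter l s) <= c * (r * rho) ^+ l.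

Let n_Xn l : n 'X^l = opN (iter l s).
Proof. by congr opN; apply/funext => q; rewrite act_Xn. Qed.

Let spectral_value_bound (p : {poly C}) be Q la : rnorm la = r -> 0 <= be ->
  (forall e, 0 < e -> exists I, forall y,
    n (p * 'X^I * y) <= be * n ('X^(Q + I) * y) + e * n ('X^I * y)) ->
  rnorm p.[la] <= be * r ^+ Q.
Proof.
move=> lar be0 H.
apply: (@eigenvalue_bound _ (fun l => opN (iter l s) / r ^+ l) (K ^+ 2) B r be la) => //.
- move=> rho rho1; have [c hc] := s_radius rho1; exists c => l.
  by rewrite ler_pdivrMr ?exprn_gt0// -mulrA -exprMn [rho * r]mulrC.
- by rewrite exprn_gt0.
- exact: lt_le_trans ltr01 B1.
move=> e e0; have [I hI] := H e e0; exists I => W; exists n.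
have n1 : 1 <= n 1 by rewrite -(expr0 'X) n_Xn; have := s_growth 0; rewrite expr0.
split => //; first exact: lt_le_trans ltr01 n1.
- move=> k l; rewrite divfK ?expf_neq0 ?gt_eqF// exprD -n_Xn mulrC.
  rewrite mulrC; apply: opN_le => [|q]; first exact: mulr_ge0.
  by rewrite mulrC actM (le_trans (nP _ _))// -mulrA ler_wpM2l.
- move=> l; rewrite (le_trans (_ : _ <= r ^+ l))//.
    rewrite -[X in _ <= X]mul1r ler_wpM2r ?exprn_ge0 ?(ltW r0)//.
    by apply: opN_le => // q; rewrite -polyC1 actC scale1r mul1r.
  rewrite n_Xn mulrAC ler_pdivlMr ?exprn_gt0//.
  by apply: ler_pM; rewrite ?exprn_ge0 ?(ltW r0).
Qed.

Variables (c : int -> C) (dl : nat -> nat -> C) (ent : nat -> nat -> C) (be : R) (Q : nat).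
Hypothesis be0 : 0 <= be.
Hypothesis hfej : forall q, N (fejop Q ent q) <= be * N q.
Hypothesis ent_dl : forall i k, ent i k = c (i%:Z - k%:Z) - dl i k.
Variables (D th : R).
Hypothesis D0 : 0 <= D.
Hypothesis th0 : 0 <= th.
Hypothesis th1 : th < 1.
Hypothesis hdl : forall i k, (k <= i + Q)%N -> (i <= k + Q)%N ->
  rnorm (dl i k) <= D * th ^+ k.

Let tail_vanish (M e : R) : 0 <= M -> 0 < e -> exists I, M * (th ^+ I / (1 - th)) <= e.
Proof.
move=> M0 e0; have t1 : 0 < 1 - th by rewrite subr_gt0.
have M1 : 0 < M + 1 by rewrite ltr_wpDl.
have [I hI] := @pow_vanish _ th (e * (1 - th) / (M + 1)) th0 th1
  (divr_gt0 (mulr_gt0 e0 t1) M1).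
exists I; rewrite mulrA ler_pdivrMr// mulrC.
move: hI; rewrite ltr_pdivlMr// => /ltW; apply: le_trans.
by rewrite ler_wpM2l ?exprn_ge0// lerDl.
Qed.

(** [eigenvalue_bound] for the norm of y(S) as a function of [y].  Multiplication
    by the Fejer polynomial is the weighted band of [ent] up to [dl]; as [dl]
    decays geometrically along the diagonals, a further shift by [X^I] makes its
    contribution small. *)
Lemma circle_forward (la : C) : (forall q, s q = 'X * q) -> rnorm la = r ->
  rnorm (fej Q c).[la] <= be * r ^+ Q.
Proof.
move=> sE lar.
have itE i q : iter i s q = 'X^i * q.
  by elim: i => [|i ih]; rewrite ?expr0 ?mul1r// iterS ih sE exprS mulrA.
have actE y q : act y q = y * q.
  rewrite /act -[in RHS](coefK y) poly_def mulr_suml; apply: eq_bigr => i _.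
  by rewrite itE scalerAl.
apply: spectral_value_bound => // e e0.
pose M := B ^+ Q.*2 * (K * ((Q.*2)%:R * D)).
have M0 : 0 <= M by rewrite !mulr_ge0 ?exprn_ge0 ?(ltW K0).
have [I hI] := tail_vanish M0 e0; exists I => y.
apply: opN_le => [|q]; first by rewrite addr_ge0// mulr_ge0// ltW.
set g := 'X^I * y * q.
rewrite actE (_ : _ * _ * _ = fej Q c * g); last by rewrite /g; ring.
rewrite (fej_mulE _ _ ent_dl) (le_trans (ND _ _))// mulrDl lerD//.
  rewrite (le_trans (hfej _))// -mulrA ler_wpM2l//.
  by rewrite (_ : 'X^Q * g = act ('X^(Q + I) * y) q) ?nP// actE exprD /g; ring.
rewrite (le_trans (@fej_error_le B Q (fun k e => dl (k + e) (k + Q))%N g B1 _))//.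
  by move=> p; rewrite -sE.
have Ng : N g <= n ('X^I * y) * N q by rewrite /g -actE nP.
apply: (@le_trans _ _ (B ^+ Q.*2 * \sum_(k < size g | (I <= k)%N)
    K * N g * ((Q.*2)%:R * (D * th ^+ k)))).
  rewrite ler_wpM2l ?exprn_ge0// [X in _ <= X]big_mkcond; apply: ler_sum => k _.
  case: (leqP I k) => kI; last first.
    have -> : g`_k = 0 by move: (nat_of_ord k) kI => i iI; rewrite /g -mulrA coefXnM iI.
    by rewrite rnorm0 !mul0r.
  apply: ler_pM => //; first by rewrite mulr_ge0 ?rnorm_ge0.
    by apply: sumr_ge0 => *; exact: rnorm_ge0.
  apply: (@le_trans _ _ (\sum_(e < Q.*2) D * th ^+ k)).
    apply: ler_sum => i _.
    have h1 : (k + Q <= k + i + Q)%N by rewrite leq_add2r leq_addr.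
    have h2 : (k + i <= k + Q + Q)%N by rewrite -addnA leq_add2l addnn ltnW.
    rewrite (le_trans (hdl h1 h2))//.
    by rewrite ler_wpM2l// exprD ler_piMr ?exprn_ge0// exprn_ile1// ltW.
  by rewrite sumr_const card_ord mulr_natl.
rewrite -mulr_sumr -mulr_sumr -mulr_sumr.
apply: (@le_trans _ _ (M * (th ^+ I / (1 - th)) * N g)).
  rewrite /M (_ : B ^+ _ * (K * N g * _) = B ^+ Q.*2 * (K * ((Q.*2)%:R * D)) *
    N g * (\sum_(k < size g | (I <= k)%N) th ^+ k)); last by ring.
  rewrite [X in _ <= X]mulrAC; apply: ler_wpM2l.
    by rewrite mulr_ge0.
  exact: geom_tail.
rewrite -[X in _ <= X]mulrA; apply: ler_pM => //.
by rewrite mulr_ge0// divr_ge0 ?exprn_ge0// subr_ge0 ltW.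
Qed.

(** The Fejer polynomial in S_{-1} is the weighted band of [ent] followed by
    [drop_poly Q], up to [dl].  The factor [X^I] now kills the monomials of
    degree less than [I], where [dl] may be large. *)
Lemma circle_backward (la : C) : (forall q, s q = drop_poly 1 q) ->
  rnorm la = r -> rnorm (fej Q (fun d => c (- d))).[la] <= be * r ^+ Q.
Proof.
move=> sE lar.
have itE i q : iter i s q = drop_poly i q.
  elim: i => [|i ih]; first by rewrite drop_poly0l.
  by rewrite iterS ih sE; apply/polyP => k; rewrite !coef_drop_poly; congr (q`_ _); lia.
have fejE q : act (fej Q (fun d => c (- d))) q =
    drop_poly Q (fejop Q ent q) + \sum_(k < size q) q`_k *:
    \sum_(e < Q.*2) (kf R Q e Q * dl (k + Q - e)%N k) *: drop_poly e 'X^k.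
  rewrite drop_fejop -big_split.
  rewrite -{1}[q]coefK poly_def act_sumr; apply: eq_bigr => k _ /=.
  rewrite actZr -scalerDr; congr (_ *: _).
  rewrite (@act_wide Q.*2) ?size_poly// -big_split; apply: eq_bigr => e _ /=.
  rewrite -scalerDl -mulrDr ent_dl subrK itE coef_poly ltn_ord.
  case: (leqP e k) => ek; last first.
    by rewrite drop_poly_eq0 ?scaler0// size_polyXn.
  have ek' : (e <= k + Q)%N by rewrite (leq_trans ek)// leq_addr.
  congr ((_ * c _) *: _); rewrite -(subzn ek') PoszD.
  by ring.
apply: spectral_value_bound => // e e0.
pose M := B ^+ Q.*2 * (K * ((Q.*2)%:R * D)).
have M0 : 0 <= M by rewrite !mulr_ge0 ?exprn_ge0 ?(ltW K0).
have [I hI] := tail_vanish M0 e0; exists I => y.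
apply: opN_le => [|q]; first by rewrite addr_ge0// mulr_ge0// ltW.
rewrite (_ : _ * _ * _ = 'X^I * y * fej Q (fun d => c (- d))); last by ring.
rewrite actM fejE actDr (le_trans (ND _ _))// mulrDl lerD//.
  rewrite -itE -act_Xn -actM (_ : 'X^I * y * _ = 'X^(Q + I) * y); last first.
    by rewrite exprD; ring.
  by apply: (le_trans (nP _ _)); rewrite [be * _]mulrC -mulrA; apply: ler_wpM2l.
set m := n ('X^I * y).
have m0 : 0 <= m by exact: n_ge0.
rewrite act_sumr (le_trans (N_sum _ _ _))//.
apply: (@le_trans _ _ (\sum_(k < size q | (I <= k)%N)
    K * N q * ((Q.*2)%:R * (D * th ^+ k * (B ^+ Q.*2 * m))))).
  rewrite [X in _ <= X]big_mkcond; apply: ler_sum => k _.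
  rewrite actZr NZ act_sumr.
  have dropE e' : act ('X^I * y) (drop_poly e' 'X^k) = iter e' s (act ('X^I * y) 'X^k).
    by rewrite -itE -!act_Xn -!actM mulrC.
  case: (leqP I k) => kI; last first.
    rewrite big1 ?N0 ?mulr0// => e' _; rewrite actZr dropE.
    rewrite [_ * y]mulrC actM act_Xn (itE I) drop_poly_eq0 ?size_polyXn//.
    by rewrite act0 -act_Xn act0 scaler0.
  apply: (@le_trans _ _ (rnorm q`_k * (N 'X^k * ((Q.*2)%:R * (D * th ^+ k * (B ^+ Q.*2 * m)))))).
    rewrite ler_wpM2l ?rnorm_ge0// (le_trans (N_sum _ _ _))//.
    apply: (@le_trans _ _ (\sum_(e' < Q.*2) (D * th ^+ k * (B ^+ Q.*2 * m)) * N 'X^k)).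
      apply: ler_sum => e' _; rewrite actZr NZ rnormM -!mulrA.
      rewrite dropE; apply: (@le_trans _ _ (1 * (rnorm (dl (k + Q - e')%N k) *
         (B ^+ Q.*2 * (m * N 'X^k))))).
        apply: ler_pM; rewrite ?rnorm_ge0 ?rnorm_kf// ?mulr_ge0 ?rnorm_ge0//.
        rewrite ler_wpM2l ?rnorm_ge0// (le_trans (itB _ _))//.
        apply: ler_pM => //; first exact: exprn_ge0.
        by rewrite ler_weXn2l// ltnW.
      rewrite mul1r [X in _ <= X]mulrA; apply: ler_wpM2r; first by rewrite !mulr_ge0 ?exprn_ge0.
      have h1 : (k <= k + Q - e' + Q)%N.
        exact: sub_index_le.
      have h2 : (k + Q - e' <= k + Q)%N by rewrite leq_subr.
      exact: hdl.
    by rewrite sumr_const card_ord -mulr_natl; apply: eq_ler; ring.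
  rewrite mulrA ler_wpM2r//.
  by rewrite !mulr_ge0 ?exprn_ge0.
rewrite -mulr_sumr -mulr_sumr -mulr_suml -mulr_sumr.
apply: (@le_trans _ _ (M * (th ^+ I / (1 - th)) * (m * N q))).
  rewrite /M (_ : K * N q * _ = B ^+ Q.*2 * (K * ((Q.*2)%:R * D)) *
    (m * N q) * (\sum_(k < size q | (I <= k)%N) th ^+ k)); last by ring.
  rewrite [X in _ <= X]mulrAC; apply: ler_wpM2l.
    by apply: mulr_ge0; [exact: M0|exact: mulr_ge0].
  exact: geom_tail.
by rewrite -[X in _ <= X]mulrA; apply: ler_wpM2r => //; rewrite mulr_ge0.
Qed.

End PolynomialAction.

End PolynomialNorm.

(** * Coincidence of the two critical circles *)

Section DegenerateCircle.
Variable R : realType.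
Local Notation C := R[i].
Variables (K : R) (N : {poly C} -> R) (B r : R).
Hypothesis K0 : 0 < K.
Hypothesis N_ge0 : forall q, 0 <= N q.
Hypothesis ND : forall p q, N (p + q) <= N p + N q.
Hypothesis NZ : forall c p, N (c *: p) = rnorm c * N p.
Hypothesis N_gt0 : forall q, (0 < N q) = (q != 0).
Hypothesis N_rotp : forall w q, rnorm w = 1 -> N (rotp w q) <= K * N q.
Hypothesis B1 : 1 <= B.
Hypothesis N_X : forall q, N ('X * q) <= B * N q.
Hypothesis r0 : 0 < r.
Hypothesis fwd : forall rho, 1 < rho ->
  exists c, forall l q, N ('X^l * q) <= c * (r * rho) ^+ l * N q.
Hypothesis bwd : forall rho, 1 < rho ->
  exists c, forall l q, N (drop_poly l q) <= c * (r^-1 * rho) ^+ l * N q.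

Let sum_const_ge (x : R) I n :
  \sum_(k < n | (I <= k)%N) x = (n - I)%:R * x.
Proof.
elim: n => [|n ih]; first by rewrite big_ord0 mul0r.
rewrite big_mkcond big_ord_recr -big_mkcond /= ih.
case: leqP => h; last by rewrite addr0; congr (_%:R * _); lia.
by rewrite subSn// -natr1 mulrDl mul1r.
Qed.

Variables (c : int -> C) (dl : nat -> nat -> C) (ent : nat -> nat -> C) (be : R) (Q : nat).
Hypothesis be0 : 0 <= be.
Hypothesis hfej : forall q, N (fejop Q ent q) <= be * N q.
Hypothesis ent_dl : forall i k, ent i k = c (i%:Z - k%:Z) - dl i k.
Hypothesis hdl : forall e, 0 < e -> exists k0, forall i k, (k0 <= k)%N ->
  (k <= i + Q)%N -> (i <= k + Q)%N -> rnorm (dl i k) <= e.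

(** After rescaling by [r] both shifts have subexponential powers, which bound
    the norms of the monomials from above and from below.  Approximate
    eigenvectors of bounded length therefore exist arbitrarily far from the
    origin, where the perturbation [dl] is small. *)
Lemma circle_degenerate (la : C) : rnorm la = r ->
  rnorm (fej Q c).[la] <= be * r ^+ Q.
Proof.
move=> lar; have B0 : 0 < B := lt_le_trans ltr01 B1.
have fP l q : N ('X^l * q) <= opN N ( *%R 'X^l) * N q.
  have [c1 hc1] := fwd (ltr1n R 2 : 1 < 2).
  apply: (@opNP _ _ N_ge0 NZ N_gt0 _ (c1 * (r * 2) ^+ l)) => // a p.
  by rewrite scalerAr.
have bP l q : N (drop_poly l q) <= opN N (drop_poly l) * N q.
  have [c1 hc1] := bwd (ltr1n R 2 : 1 < 2).
  by apply: (@opNP _ _ N_ge0 NZ N_gt0 _ (c1 * (r^-1 * 2) ^+ l)) => // a p; exact: drop_polyZ.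
have f0 l : 0 <= opN N ( *%R 'X^l).
  have := le_trans (N_ge0 _) (fP l 1); rewrite pmulr_lge0// N_gt0 oner_eq0//.
have b0 l : 0 <= opN N (drop_poly l).
  have := le_trans (N_ge0 _) (bP l 1); rewrite pmulr_lge0// N_gt0 oner_eq0//.
pose f l := opN N ( *%R 'X^l) / r ^+ l + opN N (drop_poly l) * r ^+ l.
have rl l : 0 < r ^+ l by rewrite exprn_gt0.
apply: (@eigenvalue_bound _ f K B r be la) => //.
  move=> rho rho1; have [c1 hc1] := fwd rho1; have [c2 hc2] := bwd rho1.
  have rho0 : 0 <= rho by rewrite ltW// (lt_trans _ rho1).
  exists (`|c1| + `|c2|) => l; rewrite mulrDl; apply: lerD.
    rewrite ler_pdivrMr// -mulrA -exprMn [rho * r]mulrC.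
    apply: opN_le => // [|q]; first by rewrite mulr_ge0// exprn_ge0// mulr_ge0// ltW.
    rewrite (le_trans (hc1 _ _))// ler_wpM2r// ler_wpM2r ?ler_norm//.
    by rewrite exprn_ge0// mulr_ge0// ltW.
  rewrite -ler_pdivlMr// -mulrA -exprVn -exprMn [rho * _]mulrC.
  apply: opN_le => // [|q].
    by rewrite mulr_ge0// exprn_ge0// mulr_ge0// invr_ge0 ltW.
  rewrite (le_trans (hc2 _ _))// ler_wpM2r// ler_wpM2r ?ler_norm//.
  by rewrite exprn_ge0// mulr_ge0// invr_ge0 ltW.
move=> e e0; exists 0%N => W.
pose M1 := B ^+ Q.*2 * (W%:R * (K * (Q.*2)%:R)).
have M10 : 0 <= M1 by rewrite !mulr_ge0 ?exprn_ge0 ?(ltW K0) ?(ltW B0).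
have e1 : 0 < e / (M1 + 1) by rewrite divr_gt0// ltr_wpDl.
have [k0 hk0] := hdl e1.
exists (fun y => N ('X^k0 * y)); split.
- split => [p|p q|a p|p i|p].
  + exact: N_ge0.
  + by rewrite mulrDr.
  + by rewrite -scalerAr NZ.
  + have := @coef_average _ N (K * N ('X^k0 * p)) ('X^k0 * p) (k0 + i) ND NZ.
    rewrite coefXnM ltnNge leq_addr /= addKn exprD scalerAr; apply => w.
    exact: N_rotp.
  + by rewrite mulrCA.
- by rewrite N_gt0 mulr1 -size_poly_eq0 size_polyXn.
- move=> k l; rewrite (_ : 'X^k0 * _ = 'X^l * ('X^k0 * 'X^k)); last first.
    by rewrite exprD; ring.
  rewrite (le_trans (fP _ _))//.
  by rewrite ler_wpM2r// mulrDl divfK ?gt_eqF// lerDl !mulr_ge0// ltW.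
- move=> l; rewrite mulr1.
  have := bP l 'X^(k0 + l).
  rewrite [in drop_poly _ _]exprD drop_polyMXn_id exprD => h.
  rewrite /f mulrDl (le_trans (_ : _ <= opN N (drop_poly l) * r ^+ l * N ('X^k0 * 'X^l)))//.
    by rewrite mulrAC ler_wpM2r// ltW.
  by rewrite lerDr !mulr_ge0// invr_ge0 ltW.
move=> y sy; rewrite expr0 mulr1 mul1r addn0.
set g := 'X^k0 * y.
rewrite (_ : 'X^k0 * (_ * y) = fej Q c * g); last by rewrite /g; ring.
rewrite (fej_mulE _ _ ent_dl) (le_trans (ND _ _))// lerD//.
  by rewrite (_ : 'X^k0 * _ = 'X^Q * g)// /g; ring.
have sg : (size g - k0 <= W)%N.
  rewrite leq_subLR (leq_trans (size_polyMleq _ _))// size_polyXn addSn /=.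
  by rewrite leq_add2l.
rewrite (le_trans (@fej_error_le _ N N_ge0 ND NZ B Q (fun k e => dl (k + e) (k + Q))%N g B1 N_X))//.
apply: (@le_trans _ _ (B ^+ Q.*2 * \sum_(k < size g | (k0 <= k)%N)
    (K * N g * ((Q.*2)%:R * (e / (M1 + 1)))))).
  rewrite ler_wpM2l ?exprn_ge0 ?(ltW B0)// [X in _ <= X]big_mkcond; apply: ler_sum => k _.
  case: (leqP k0 k) => kI; last first.
    have -> : g`_k = 0 by move: (nat_of_ord k) kI => i iI; rewrite /g coefXnM iI.
    by rewrite rnorm0 !mul0r.
  apply: ler_pM => //; first by rewrite mulr_ge0 ?rnorm_ge0.
  - by apply: sumr_ge0 => *; exact: rnorm_ge0.
  - by rewrite -NZ; apply: coef_average => // w; exact: N_rotp.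
  apply: (@le_trans _ _ (\sum_(i < Q.*2) e / (M1 + 1))).
    apply: ler_sum => i _; apply: hk0.
    - by rewrite (leq_trans kI)// leq_addr.
    - by rewrite leq_add2r leq_addr.
    - by rewrite -addnA leq_add2l addnn ltnW.
  by rewrite sumr_const card_ord mulr_natl.
rewrite sum_const_ge.
apply: (@le_trans _ _ (M1 * (e / (M1 + 1)) * N g)).
  rewrite /M1 (_ : B ^+ _ * _ = (B ^+ Q.*2 * ((size g - k0)%:R * (K * (Q.*2)%:R))) *
    (e / (M1 + 1) * N g)); last by rewrite /M1; ring.
  rewrite -[X in _ <= X]mulrA; apply: ler_wpM2r; first by rewrite mulr_ge0// ltW.
  rewrite ler_wpM2l ?exprn_ge0 ?(ltW B0)// ler_wpM2r ?ler_nat//.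
  by rewrite mulr_ge0// ltW.
rewrite ler_wpM2r// mulrCA ler_piMr ?(ltW e0)// ler_pdivrMr ?ltr_wpDl// mul1r.
by rewrite lerDl.
Qed.

End DegenerateCircle.

(** * Coefficients of Laurent polynomials *)

Section WindowSums.
Variable R : realType.
Local Notation C := R[i].

(** Finite windows replace two-sided series: the estimates hold for every
    window. *)
Definition wsum (D : nat) (F : int -> R) : R := \sum_(e < D.*2) F (e%:Z - D%:Z).

Lemma wsum_ge0 D F : (forall d, 0 <= F d) -> 0 <= wsum D F.
Proof. by move=> h; apply: sumr_ge0. Qed.

Lemma ler_wsum D F G : (forall d, F d <= G d) -> wsum D F <= wsum D G.
Proof. by move=> h; apply: ler_sum. Qed.

Lemma wsumD D F G : wsum D (fun d => F d + G d) = wsum D F + wsum D G.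
Proof. exact: big_split. Qed.

Lemma wsumZ D x F : wsum D (fun d => x * F d) = x * wsum D F.
Proof. by rewrite /wsum mulr_sumr. Qed.

Lemma wsum_split D M F : (D <= M)%N ->
  wsum M F = wsum D F + wsum M (fun d => if (- D%:Z <= d) && (d < D%:Z) then 0 else F d).
Proof.
move=> DM; rewrite -[X in _ = wsum _ X + _](_ : (fun d => F d) = F)//.
have split3 G : wsum M G = \sum_(e < M - D) G (e%:Z - M%:Z) +
    (wsum D G + \sum_(e < M - D) G (e%:Z + D%:Z)).
  rewrite /wsum (_ : M.*2 = (M - D) + (D.*2 + (M - D)))%N; last by lia.
  rewrite !big_split_ord /=; congr (_ + (_ + _)); apply: eq_bigr => e _; congr G.
    by rewrite PoszD -subzn//; ring.
  by rewrite !PoszD -addnn PoszD -subzn//; ring.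
rewrite !split3 [X in _ = _ + (X + (_ + _))](eq_bigr (fun e : 'I_(M - D) => F (e%:Z - M%:Z))); last first.
  move=> e _; case: ifP => //; move: (ltn_ord e) => h; lia.
rewrite [X in _ = _ + (_ + (X + _))](_ : _ = 0); last first.
  apply: big1 => e _; case: ifP => // /negP[]; move: (ltn_ord e) => h; lia.
rewrite [X in _ = _ + (_ + (_ + X))](eq_bigr (fun e : 'I_(M - D) => F (e%:Z + D%:Z))); last first.
  move=> e _; case: ifP => // h; exfalso; move: h; lia.
by ring.
Qed.

Lemma wsum_mono D M F : (forall d, 0 <= F d) -> (D <= M)%N -> wsum D F <= wsum M F.
Proof.
move=> F0 DM; rewrite (wsum_split F DM) lerDl; apply: wsum_ge0 => d.
by case: ifP.
Qed.

(** Coefficients with integer indices, for the Laurent polynomial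
    [z ^- n * p.[z]]. *)
Definition lcoef (n : nat) (p : {poly C}) (d : int) : C :=
  if d + n%:Z is Posz i then p`_i else 0.

Lemma lcoef_nat n p i : lcoef n p (i%:Z - n%:Z) = p`_i.
Proof. by rewrite /lcoef subrK. Qed.

Lemma lcoef_neg n p d : d + n%:Z < 0 -> lcoef n p d = 0.
Proof. by rewrite /lcoef; case: (d + n%:Z). Qed.

Lemma lcoefB n p q d : lcoef n (p - q) d = lcoef n p d - lcoef n q d.
Proof. by rewrite /lcoef; case: (_ + _) => i; rewrite ?coefB ?subrr. Qed.

Lemma lcoefMXn k n p d : lcoef (k + n) ('X^k * p) d = lcoef n p d.
Proof.
rewrite /lcoef PoszD [k%:Z + _]addrC addrA.
case: (d + n%:Z) => i.
  by rewrite -PoszD coefXnM ltnNge leq_addl /= addnK.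
case E : (Negz i + k%:Z) => [l|//]; rewrite coefXnM.
by case: ltnP => // h; move: E; rewrite NegzE; lia.
Qed.

Definition lsq (r : R) (u : int -> C) (d : int) : R := rnorm (u d) ^+ 2 * (r ^+ 2) ^ d.

Lemma lsq_ge0 r u d : 0 <= lsq r u d.
Proof. by rewrite mulr_ge0 ?sqr_ge0// exprz_ge0// sqr_ge0. Qed.

Variable r : R.
Hypothesis r0 : 0 < r.

Let r20 : r ^+ 2 != 0. Proof. by rewrite expf_neq0// gt_eqF. Qed.

Let powE (i : nat) n : (r ^+ 2) ^ (i%:Z - n%:Z) * r ^+ (2 * n) = r ^+ (2 * i).
Proof. by rewrite expfzDr// -exprnN -exprnP -!exprM mulfVK// expf_neq0// gt_eqF. Qed.

Lemma l2_wsum n (p : {poly C}) D : (n <= D)%N -> (size p <= n + D)%N ->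
  l2 r p = r ^+ (2 * n) * wsum D (lsq r (lcoef n p)).
Proof.
move=> nD sp; rewrite (l2_widen r sp) /wsum.
rewrite (_ : D.*2 = (D - n) + (n + D))%N; last by lia.
rewrite [X in _ = _ * X]big_split_ord /= [X in _ = _ * (X + _)]big1 ?add0r => [|e _]; last first.
  rewrite /lsq lcoef_neg ?rnorm0 ?expr0n ?mul0r//.
  by move: (ltn_ord e) => /= h; lia.
rewrite mulr_sumr; apply: eq_bigr => e _.
rewrite (_ : ((D - n)%N + e)%N%:Z - D%:Z = e%:Z - n%:Z); last first.
  by rewrite PoszD -subzn//; ring.
by rewrite /lsq lcoef_nat mulrCA [r ^+ (2 * n) * _]mulrC powE.
Qed.

Lemma wsum_le_l2 n (p : {poly C}) D : r ^+ (2 * n) * wsum D (lsq r (lcoef n p)) <= l2 r p.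
Proof.
rewrite (@l2_wsum n p (maxn D (n + size p))); last 2 first.
  by rewrite leq_max leq_addr orbT.
  by rewrite (leq_trans (leq_addl n _))// (leq_trans _ (leq_addl n _))// leq_maxr.
rewrite ler_wpM2l ?exprn_ge0 ?(ltW r0)//; apply: wsum_mono; last exact: leq_maxl.
by move=> d; exact: lsq_ge0.
Qed.

Lemma lsqD2 u v d : lsq r (fun d => u d + v d) d <= 2 * (lsq r u d + lsq r v d).
Proof.
rewrite /lsq -mulrDl mulrA ler_wpM2r ?exprz_ge0 ?sqr_ge0//.
apply: (@le_trans _ _ ((rnorm (u d) + rnorm (v d)) ^+ 2)).
  by rewrite ler_sqr ?nnegrE ?addr_ge0 ?rnorm_ge0// rnormD.
have := sqr_ge0 (rnorm (u d) - rnorm (v d)); rewrite sqrrB sqrrD; lra.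
Qed.

(** On a fixed window the coefficients of the Fejer mean of order [M] tend to
    those of [u]; Parseval bounds the former for each [M]. *)
Lemma fej_wsum_le (u : int -> C) (b : R) D : 0 <= b ->
  (forall Q z, (0 < Q)%N -> rnorm z = r -> rnorm (fej Q u).[z] <= b * r ^+ Q) ->
  wsum D (lsq r u) <= b ^+ 2.
Proof.
move=> b0 h; apply/ler_addgt0Pr => e e0.
(* on the window the squares of the Fejer weights of order M are at least
   1 - 2 D / M *)
have win M : (D <= M)%N -> (0 < M)%N -> (1 - D.*2%:R / M%:R) * wsum D (lsq r u) <= b ^+ 2.
  move=> DM M0.
  have h1 : wsum M (lsq r (lcoef M (fej M u))) <= b ^+ 2.
    have rM : 0 < r ^+ (2 * M) by rewrite exprn_gt0.
    rewrite -(ler_pM2l rM) (le_trans (wsum_le_l2 _ _ _))//.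
    rewrite mulrC mulnC exprM -exprMn; apply: l2_le_sup; first exact: ltW.
    by move=> z; exact: h.
  apply: le_trans h1; apply: le_trans (wsum_mono _ DM); last by move=> d; exact: lsq_ge0.
  rewrite -wsumZ; apply: ler_sum => e' _; set d : int := e'%:Z - D%:Z.
  have [i iE] : exists i : nat, d = i%:Z - M%:Z.
    exists (e' + (M - D))%N; rewrite /d PoszD -subzn//; ring.
  have iM : (i < M.*2)%N by move: iE (ltn_ord e'); rewrite /d; lia.
  rewrite /lsq iE lcoef_nat coef_poly iM rnormM exprMn mulrA.
  rewrite ler_wpM2r ?exprz_ge0 ?sqr_ge0// ler_wpM2r ?sqr_ge0//.
  have k1 := kf_cvg R i M M0.
  have k2 := ler_rnormB (1 : C) (1 - kf R M i M).
  rewrite rnorm1 (_ : 1 - (1 - _) = kf R M i M) in k2; last by ring.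
  have k3 : ((i - M) + (M - i))%:R / M%:R <= D%:R / M%:R :> R.
    rewrite ler_pM2r ?invr_gt0 ?ltr0n// ler_nat.
    by move: iE (ltn_ord e'); rewrite /d; lia.
  have k4 : 1 - D%:R / M%:R <= rnorm (kf R M i M) by lra.
  have k5 : 0 <= D%:R / M%:R :> R by rewrite divr_ge0.
  have k6 : 0 <= 1 - D%:R / M%:R :> R.
    by rewrite subr_ge0 ler_pdivrMr ?ltr0n// mul1r ler_nat.
  have k7 : (1 - D%:R / M%:R) ^+ 2 <= rnorm (kf R M i M) ^+ 2.
    by rewrite ler_sqr ?nnegrE ?rnorm_ge0.
  rewrite (le_trans _ k7)// sqrrB expr1n -addnn natrD mulrDl.
  have := sqr_ge0 (D%:R / M%:R : R); lra.
have w0 : 0 <= wsum D (lsq r u) by apply: wsum_ge0 => d; exact: lsq_ge0.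
have [M hM] := exists_natr_gt (D.*2%:R * (wsum D (lsq r u)) / e).
have DM' : (D <= M.+1 + D)%N by exact: leq_addl.
have := win (M.+1 + D)%N DM' isT.
rewrite mulrBl mul1r lerBlDr => /le_trans; apply; rewrite lerD2l.
rewrite mulrAC ler_pdivrMr ?ltr0n//.
move: hM; rewrite ltr_pdivrMr// => /ltW /le_trans; apply.
by rewrite mulrC ler_wpM2l ?(ltW e0)// ler_nat leq_addr.
Qed.

End WindowSums.

(** * Limits of sequences *)

Section Eventually.
Variable R : realType.
Local Notation C := R[i].

(** Convergence to zero, for the nonnegative sequences that occur here. *)
Definition ev_small (u : nat -> R) := forall e, 0 < e -> exists M0, forall M, (M0 <= M)%N -> u M <= e.

Lemma ev_small_le u v : (forall M, u M <= v M) -> ev_small v -> ev_small u.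
Proof.
by move=> uv h e /h[M0 hM]; exists M0 => M /hM; apply: le_trans; exact: uv.
Qed.

Lemma ev_smallD u v : ev_small u -> ev_small v -> ev_small (fun M => u M + v M).
Proof.
move=> hu hv e e0; have e20 : 0 < e / 2 by rewrite divr_gt0.
have [M1 h1] := hu _ e20; have [M2 h2] := hv _ e20.
exists (maxn M1 M2) => M; rewrite geq_max => /andP[/h1 a /h2 b].
by rewrite [e]splitr lerD.
Qed.

Lemma ev_smallZ x u : 0 <= x -> ev_small u -> ev_small (fun M => x * u M).
Proof.
move=> x0 hu e e0; have x1 : 0 < x + 1 by rewrite ltr_wpDl.
have [M0 h] := hu (e / (x + 1)) (divr_gt0 e0 x1); exists M0 => M /h hM.
rewrite (le_trans (ler_wpM2l x0 hM))// mulrCA ler_piMr ?(ltW e0)//.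
by rewrite ler_pdivrMr// mul1r lerDl.
Qed.

Lemma ev_small_sum n (F : nat -> nat -> R) : (forall i, ev_small (F i)) ->
  ev_small (fun M => \sum_(i < n) F i M).
Proof.
move=> h; elim: n => [|n ih].
  by move=> e e0; exists 0%N => M _; rewrite big_ord0 ltW.
by apply: ev_small_le (ev_smallD ih (h n)) => M; rewrite big_ord_recr.
Qed.

Lemma ev_small_sqr u : (forall M, 0 <= u M) -> ev_small u -> ev_small (fun M => u M ^+ 2).
Proof.
move=> u0 hu e e0; have e1 : 0 < Num.min 1 e by rewrite lt_min ltr01.
have [M0 h] := hu _ e1; exists M0 => M /h; rewrite le_min => /andP[h1 h2].
by rewrite expr2 (le_trans _ h2)// ler_piMr.
Qed.

(** The real norm is used, so that convergence follows from real estimates. *)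
Definition ccvg (u : nat -> C) (l : C) := ev_small (fun M => rnorm (u M - l)).

Lemma le_of_ev_small (x y : R) : (forall e, 0 < e -> x <= y + e) -> x <= y.
Proof. by move=> h; apply/ler_addgt0Pr. Qed.

Let real_cauchy (u : nat -> R) :
  (forall e, 0 < e -> exists M0, forall M, (M0 <= M)%N -> `|u M - u M0| <= e) ->
  exists l, ev_small (fun M => `|u M - l|).
Proof.
move=> h; have /cvg_ex[l /= ul] : cvgn u.
  apply: cauchy_cvg; apply/cauchy_exP => e e0.
  have e20 : 0 < e / 2 by rewrite divr_gt0.
  have [M0 hM] := h _ e20.
  exists (u M0); exists M0 => // M /= /hM hh.
  rewrite -ball_normE /ball_ /= distrC (le_lt_trans hh)//.
  by rewrite ltr_pdivrMr// ltr_pMr// ltrDl.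
exists l => e e0; have /cvgrPdist_le/(_ e e0)[M0 _ hM] := ul.
by exists M0 => M /hM; rewrite distrC.
Qed.

Lemma rnorm_le_ReIm (z : C) : rnorm z <= `|complex.Re z| + `|complex.Im z|.
Proof.
rewrite -ler_sqr ?nnegrE ?addr_ge0 ?rnorm_ge0// rnorm_sqr sqrrD !real_normK ?num_real//.
by rewrite -subr_ge0 (_ : _ - _ = `|complex.Re z| * `|complex.Im z| *+ 2) ?mulrn_wge0 ?mulr_ge0//; ring.
Qed.

Lemma Re_le_rnorm (z : C) : `|complex.Re z| <= rnorm z.
Proof. by rewrite -ler_sqr ?nnegrE ?rnorm_ge0// rnorm_sqr real_normK ?num_real// lerDl sqr_ge0. Qed.

Lemma Im_le_rnorm (z : C) : `|complex.Im z| <= rnorm z.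
Proof. by rewrite -ler_sqr ?nnegrE ?rnorm_ge0// rnorm_sqr real_normK ?num_real// lerDr sqr_ge0. Qed.

Lemma ccauchy (u : nat -> C) :
  (forall e, 0 < e -> exists M0, forall M, (M0 <= M)%N -> rnorm (u M - u M0) <= e) ->
  exists l, ccvg u l.
Proof.
move=> h.
have [a ha] : exists l, ev_small (fun M => `|complex.Re (u M) - l|).
  apply: real_cauchy => e /h[M0 hM]; exists M0 => M /hM; apply: le_trans.
  by rewrite -raddfB Re_le_rnorm.
have [b hb] : exists l, ev_small (fun M => `|complex.Im (u M) - l|).
  apply: real_cauchy => e /h[M0 hM]; exists M0 => M /hM; apply: le_trans.
  by rewrite -raddfB Im_le_rnorm.
exists (a +i* b); apply: ev_small_le (ev_smallD ha hb) => M.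
by case: (u M) => x y; exact: rnorm_le_ReIm.
Qed.

End Eventually.

Lemma absz_window (d : int) (D : nat) : (- D%:Z <= d) && (d < D%:Z) -> (absz d <= D)%N.
Proof. by lia. Qed.

Lemma index_cancel (n k l : nat) : (l < n)%N -> (k <= l)%N -> (n + k - l + (l - k) = n)%N.
Proof. by lia. Qed.

(** * Powers of Fejer means in the mean square *)

Section PowersOfFejerMeans.
Variable R : realType.
Local Notation C := R[i].
Variable a : int -> C.

Let P M := fej M a.

(** The coefficients of the m-th power of the Laurent polynomial
    [z ^- M * (fej M a).[z]]. *)
Definition pow_coef m M (d : int) : C := lcoef (m * M) (P M ^+ m) d.

Definition fejer_toeplitz M (q : {poly C}) := fejop M (fun i k => a (i%:Z - k%:Z)) q.

Lemma fejer_toeplitzE M q : fejer_toeplitz M q = drop_poly M (P M * q).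
Proof.
rewrite /fejer_toeplitz /P fej_mul drop_poly_sum; apply: eq_bigr => k _.
rewrite drop_polyZ; congr (_ *: _); apply/polyP => i.
rewrite coef_poly coef_drop_poly coef_sum.
under eq_bigr => e _ do rewrite coefZ coefXn.
case: (ltnP (i + M) k) => ik.
  rewrite big1 => [|e _]; last first.
    by rewrite (_ : (_ == _ :> nat) = false) ?mulr0//; apply/eqP; lia.
  by rewrite kf_ge ?mul0r ?if_same//; apply/orP; left; lia.
rewrite (_ : (i < _)%N = (i + M - k < M.*2)%N); last by rewrite -addnn; lia.
case: ltnP => h.
  rewrite (bigD1 (Ordinal h))//= subnKC// eqxx mulr1 big1 ?addr0 => [|e he].
    congr (_ * a _).
      by rewrite -(kf_shift _ _ i k M) -(kf_shift _ _ (i + M - k) M k) subnK// [(M + k)%N]addnC.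
    by rewrite -(subzn ik) PoszD; ring.
  rewrite (_ : (_ == _ :> nat) = false) ?mulr0//; apply/eqP => ie.
  by move/eqP: he; apply; apply: val_inj => /=; lia.
rewrite big1 => [//|e _].
rewrite (_ : (_ == _ :> nat) = false) ?mulr0//; apply/eqP.
by move: (ltn_ord e); lia.
Qed.

Lemma lcoef_fej (u : int -> C) M d : (0 < M)%N ->
  exists k : C, [/\ rnorm k <= 1, rnorm (1 - k) <= (absz d)%:R / M%:R &
    lcoef M (fej M u) d = k * u d].
Proof.
move=> M0; have MR : 0 < M%:R :> R by rewrite ltr0n.
case: (boolP ((- M%:Z <= d) && (d < M%:Z))) => hd.
  have [i iE] : exists i : nat, d = i%:Z - M%:Z.
    by exists (absz (d + M%:Z)%R); lia.
  exists (kf R M i M); split; first exact: rnorm_kf.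
    rewrite (le_trans (kf_cvg _ _ _ M0))// ler_pM2r ?invr_gt0// ler_nat.
    by rewrite iE; lia.
  by rewrite iE lcoef_nat coef_poly ifT//; lia.
exists 0; split; rewrite ?rnorm0 ?ler01//.
  by rewrite subr0 rnorm1 ler_pdivlMr// mul1r ler_nat; lia.
rewrite mul0r /lcoef; case E : (d + M%:Z) => [i|//].
rewrite coef_poly ifF//; apply/negbTE; rewrite -leqNgt; lia.
Qed.

Lemma l2_take r n (p : {poly C}) : l2 r (take_poly n p) <= l2 r p.
Proof.
rewrite (@l2_widen _ r (size p)); last first.
  by apply/leq_sizeP => i hi; rewrite coef_take_poly nth_default ?if_same.
apply: ler_sum => i _; rewrite coef_take_poly; case: ifP => // _.
by rewrite rnorm0 expr0n mul0r mulr_ge0 ?sqr_ge0// exprM exprn_ge0// sqr_ge0.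
Qed.

Lemma l2_take_drop r n (p q : {poly C}) :
  l2 r (take_poly n p + 'X^n * drop_poly n q) <= l2 r (take_poly n p) + l2 r q.
Proof.
set L := maxn n (n + maxn (size p) (size q)).
have nn i (u : {poly C}) : 0 <= rnorm u`_i ^+ 2 * r ^+ (2 * i).
  by rewrite mulr_ge0 ?sqr_ge0// exprM exprn_ge0// sqr_ge0.
rewrite !(@l2_widen _ r L).
- rewrite -big_split; apply: ler_sum => i _ /=.
  rewrite coefD coef_take_poly coefXnM coef_drop_poly.
  case: ltnP => h.
    by rewrite addr0 lerDl; exact: nn.
  by rewrite add0r subnK// rnorm0 expr0n mul0r add0r lexx.
- by rewrite (leq_trans _ (leq_maxr _ _))// (leq_trans (leq_maxr (size p) _))// leq_addl.
- by rewrite (leq_trans _ (leq_maxl _ _))// size_take_poly.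
- apply/leq_sizeP => i; rewrite geq_max => /andP[h1 h2].
  rewrite coefD coef_take_poly ltnNge h1 add0r coefXnM ltnNge h1 /=.
  rewrite coef_drop_poly subnK// nth_default// (leq_trans _ h2)//.
  by rewrite (leq_trans (leq_maxr (size p) _))// leq_addl.
Qed.

Section OneCircle.
Variables (r b : R).
Hypothesis r0 : 0 < r.
Hypothesis b1 : 1 <= b.
Hypothesis P_le : forall Q z, (0 < Q)%N -> rnorm z = r -> rnorm (P Q).[z] <= b * r ^+ Q.

Let b0 : 0 <= b := le_trans ler01 b1.

Lemma monotone_tail (u : nat -> R) (x e : R) : (forall n, u n <= x) -> 0 < e ->
  exists n, forall k, u k <= u n + e.
Proof.
move=> ux e0; have hs : has_sup (range u).
  by split; [exists (u 0%N), 0%N|exists x => _ [n _ <-]].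
have [_ [n _ <-] hn] := sup_adherent e0 hs.
exists n => k; rewrite -lerBlDr ltW// (le_lt_trans _ hn)// lerB//.
by apply: sup_ubound; [case: hs|exists k].
Qed.

(** On a large window the Fejer weights of high orders nearly agree; outside it
    the tail of the square summable coefficients is small. *)
Lemma fejer_cauchy e : 0 < e -> exists2 M0, (0 < M0)%N & forall M, (M0 <= M)%N ->
  l2 r (P M - 'X^(M - M0) * P M0) <= e * r ^+ (2 * M).
Proof.
move=> e0; pose A D := wsum D (lsq r a).
have A_le D : A D <= b ^+ 2 by exact: fej_wsum_le.
have e8 : 0 < e / 8 by rewrite divr_gt0.
have [D hD] := monotone_tail A_le e8.
pose x : R := (2 * D%:R) ^+ 2 * b ^+ 2.
have x0 : 0 <= x by rewrite mulr_ge0 ?sqr_ge0.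
have [M1 hM1] := exists_natr_gt (x / (e / 2)).
exists (maxn M1.+1 D); first by rewrite leq_max.
set M0 := maxn _ _ => M M0M.
have M0p : (0 < M0)%N by rewrite leq_max.
have Mp : (0 < M)%N by exact: leq_trans M0M.
have DM : (D <= M)%N by rewrite (leq_trans _ M0M)// leq_maxr.
have sP n : (size (P n) <= n.*2)%N by exact: size_poly.
rewrite (@l2_wsum _ _ r0 M _ M)//; last first.
  rewrite addnn (leq_trans (size_polyD _ _))// geq_max size_polyN sP /=.
  rewrite (leq_trans (size_polyMleq _ _))// size_polyXn addSn /=.
  by rewrite (leq_trans (leq_add (leqnn _) (sP _)))//; move: M0M; rewrite -!addnn; lia.
rewrite mulrC ler_pM2r ?exprn_gt0//.
have lE d : lsq r (lcoef M (P M - 'X^(M - M0) * P M0)) d <=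
    (2 * D%:R / M0%:R) ^+ 2 * lsq r a d +
    4 * (if (- D%:Z <= d) && (d < D%:Z) then 0 else lsq r a d).
  have [k [k1 k2 kE]] := lcoef_fej a d Mp.
  have [k' [k1' k2' kE']] := lcoef_fej a d M0p.
  rewrite /lsq lcoefB kE -{1}(subnK M0M) lcoefMXn kE' -mulrBl rnormM exprMn -[X in X <= _]mulrA.
  rewrite -/(lsq r a d).
  have kk : rnorm (k - k') <= 2 by rewrite (le_trans (rnormB _ _))// -[2]/(1 + 1) lerD.
  have kk' : rnorm (k - k') <= 2 * (absz d)%:R / M0%:R.
    rewrite (_ : k - k' = (1 - k') - (1 - k)); last by ring.
    rewrite (le_trans (rnormB _ _))// -mulrA mulr2n mulrDl !mul1r lerD//.
    by rewrite (le_trans k2)// ler_wpM2l// lef_pV2 ?posrE ?ltr0n// ler_nat.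
  case: ifP => hd.
    rewrite mulr0 addr0 ler_wpM2r ?lsq_ge0// ler_sqr ?nnegrE ?rnorm_ge0 ?divr_ge0 ?mulr_ge0//.
    rewrite (le_trans kk')// ler_wpM2r ?invr_ge0// ler_wpM2l// ler_nat; exact: absz_window.
  rewrite (@le_trans _ _ (4 * lsq r a d))//.
    rewrite ler_wpM2r ?lsq_ge0// (_ : 4 = 2 ^+ 2 :> R); last by ring.
    by rewrite ler_sqr ?nnegrE ?rnorm_ge0.
  by rewrite lerDr mulr_ge0 ?sqr_ge0 ?lsq_ge0.
rewrite (le_trans (ler_wsum _ lE))// wsumD !wsumZ.
have hout : wsum M (fun d => if (- D%:Z <= d) && (d < D%:Z) then 0 else lsq r a d) <= e / 8.
  have := hD M; rewrite /A (wsum_split _ DM); lra.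
have h2 : (2 * D%:R / M0%:R) ^+ 2 * wsum M (lsq r a) <= e / 2.
  apply: (@le_trans _ _ ((2 * D%:R / M0%:R) ^+ 2 * b ^+ 2)).
    by rewrite ler_wpM2l ?sqr_ge0// A_le.
  rewrite exprMn mulrAC -/x exprVn ler_pdivrMr ?exprn_gt0 ?ltr0n//.
  move: hM1; rewrite ltr_pdivrMr ?divr_gt0// mulrC => /ltW /le_trans; apply.
  rewrite ler_wpM2l ?divr_ge0 ?(ltW e0)//.
  apply: (@le_trans _ _ M0%:R); first by rewrite ler_nat leq_maxl.
  by rewrite expr2 ler_peMr// ler1n.
lra.
Qed.

(** A difference of powers is a combination of bounded polynomials with the
    difference of the bases. *)
Lemma power_cauchy m e : 0 < e -> exists2 M0, (0 < M0)%N & forall M, (M0 <= M)%N ->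
  l2 r (P M ^+ m - 'X^(m * M - m * M0) * P M0 ^+ m) <= e * r ^+ (2 * (m * M)).
Proof.
move=> e0.
suff [c c0 hc] : exists2 c, 0 <= c & forall M0 M x, (0 < M0)%N -> (M0 <= M)%N -> 0 <= x ->
    l2 r (P M - 'X^(M - M0) * P M0) <= x * r ^+ (2 * M) ->
    l2 r (P M ^+ m - 'X^(m * M - m * M0) * P M0 ^+ m) <= c * x * r ^+ (2 * (m * M)).
  have c1 : 0 < c + 1 by rewrite ltr_wpDl.
  have [M0 M0p h] := fejer_cauchy (divr_gt0 e0 c1).
  exists M0 => // M M0M; have x0 : 0 <= e / (c + 1) by rewrite divr_ge0 ?ltW.
  apply: le_trans (hc M0 M _ M0p M0M x0 (h M M0M)) _.
  rewrite ler_wpM2r ?exprn_ge0 ?(ltW r0)// mulrCA ler_piMr ?(ltW e0)//.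
  by rewrite ler_pdivrMr// mul1r lerDl.
elim: m => [|m [c c0 ih]].
  exists 0 => // M0 M x _ _ _ _; rewrite !mul0n !expr0 mul1r subrr.
  by rewrite /l2 size_poly0 big_ord0 !mul0r.
exists (2 * (b ^+ 2 * c + b ^+ m ^+ 2)).
  by rewrite mulr_ge0// addr_ge0 ?sqr_ge0// mulr_ge0 ?sqr_ge0.
move=> M0 M x M0p M0M x0 h; have Mp : (0 < M)%N := leq_trans M0p M0M.
set Y := 'X^(M - M0) * P M0 in h.
have YE k : 'X^(k * M - k * M0) * P M0 ^+ k = Y ^+ k.
  by rewrite /Y exprMn -exprM -mulnBr mulnC.
rewrite YE; have := ih _ _ _ M0p M0M x0 h; rewrite YE => hm.
rewrite (_ : _ - _ = P M * (P M ^+ m - Y ^+ m) + Y ^+ m * (P M - Y)); last first.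
  by rewrite !exprS; ring.
have Yb z : rnorm z = r -> rnorm (Y ^+ m).[z] <= b ^+ m * r ^+ (m * M).
  move=> zr; rewrite horner_exp rnormX /Y hornerM hornerXn rnormM rnormX zr.
  rewrite mulnC exprM -exprMn lerXn2r ?nnegrE ?mulr_ge0 ?rnorm_ge0 ?exprn_ge0 ?(ltW r0)//.
  rewrite -(subnK M0M) exprD mulrCA (subnK M0M).
  by rewrite ler_wpM2l ?exprn_ge0 ?(ltW r0)// P_le.
have RE k : r ^+ (2 * k) = r ^+ k ^+ 2 by rewrite mulnC exprM.
have hA : l2 r (P M * (P M ^+ m - Y ^+ m)) <= b ^+ 2 * c * x * r ^+ (2 * (m.+1 * M)).
  apply: le_trans (l2M _ (ltW r0) (fun z => @P_le M z Mp)) _.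
  apply: le_trans (ler_wpM2l (sqr_ge0 _) hm) _.
  by apply: eq_ler; rewrite mulSn !RE exprD; ring.
have hB : l2 r (Y ^+ m * (P M - Y)) <= b ^+ m ^+ 2 * x * r ^+ (2 * (m.+1 * M)).
  apply: le_trans (l2M _ (ltW r0) Yb) _.
  apply: le_trans (ler_wpM2l (sqr_ge0 _) h) _.
  by apply: eq_ler; rewrite mulSn !RE exprD; ring.
apply: le_trans (l2D _ _ _) _.
move: hA hB; set s1 := l2 r _; set s2 := l2 r _; set R1 := r ^+ _ => hA hB.
by lra.
Qed.

Let pow_coef_shift m M0 M d : (M0 <= M)%N ->
  lcoef (m * M) ('X^(m * M - m * M0) * P M0 ^+ m) d = pow_coef m M0 d.
Proof.
move=> h; have e : (m * M = (m * M - m * M0) + m * M0)%N by rewrite subnK// leq_mul2l h orbT.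
by rewrite {1}e lcoefMXn.
Qed.

Lemma pow_coef_wsum_cauchy m e : 0 < e -> exists M0, forall M D, (M0 <= M)%N ->
  wsum D (lsq r (fun d => pow_coef m M d - pow_coef m M0 d)) <= e.
Proof.
move=> /(power_cauchy m)[M0 _ h]; exists M0 => M D M0M.
have rM : 0 < r ^+ (2 * (m * M)) by rewrite exprn_gt0.
rewrite -(ler_pM2r rM) (le_trans _ (h M M0M))// mulrC.
rewrite (le_trans _ (wsum_le_l2 r0 (m * M) _ D))// ler_wpM2l ?(ltW rM)//.
by apply: ler_wsum => d; rewrite /lsq lcoefB pow_coef_shift.
Qed.

Lemma pow_coef_cvg m d : exists l, ccvg (fun M => pow_coef m M d) l.
Proof.
apply: ccauchy => e e0.
have w0 : 0 < (r ^+ 2) ^ d by rewrite exprz_gt0// exprn_gt0.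
have [M0 h] := pow_coef_wsum_cauchy m (mulr_gt0 (exprn_gt0 2 e0) w0).
exists M0 => M /(h M (absz d).+1) hM.
have h2 : lsq r (fun d => pow_coef m M d - pow_coef m M0 d) d <= e ^+ 2 * (r ^+ 2) ^ d.
  apply: le_trans hM; rewrite /wsum.
  have hd : (absz (d + (absz d).+1%:Z)%R < ((absz d).+1).*2)%N by lia.
  rewrite (bigD1 (Ordinal hd))//= (_ : (absz (d + _)%R)%:Z - _ = d); last by lia.
  by rewrite lerDl; apply: sumr_ge0 => *; exact: lsq_ge0.
move: h2; rewrite /lsq ler_pM2r// ler_sqr ?nnegrE ?rnorm_ge0//.
exact: ltW.
Qed.

Variable c : nat -> int -> C.
Hypothesis c_lim : forall m d, ccvg (fun M => pow_coef m M d) (c m d).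

Let wsum_lim m D : ev_small (fun M => wsum D (lsq r (fun d => pow_coef m M d - c m d))).
Proof.
apply: (@ev_small_sum _ D.*2 (fun i M =>
  lsq r (fun d => pow_coef m M d - c m d) (i%:Z - D%:Z))) => i; set d := _ - _.
have w0 : 0 <= (r ^+ 2) ^ d by rewrite exprz_ge0// exprn_ge0// ltW.
apply: ev_small_le (ev_smallZ w0 (ev_small_sqr _ (c_lim m d))) => M //.
  by rewrite /lsq mulrC.
exact: rnorm_ge0.
Qed.

Lemma pow_coef_wsum_lim m e : 0 < e -> exists M0, forall M D, (M0 <= M)%N ->
  wsum D (lsq r (fun d => pow_coef m M d - c m d)) <= e.
Proof.
move=> e0; have e8 : 0 < e / 16 by rewrite divr_gt0.
have [M0 h] := pow_coef_wsum_cauchy m e8; exists M0 => M D M0M.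
have [M1 h1] := wsum_lim m D e8.
pose M' := maxn M0 M1.
have hM' := h M' D (leq_maxl _ _); have hM := h M D M0M.
have hc := h1 M' (leq_maxr _ _).
pose u d := pow_coef m M d - pow_coef m M0 d.
pose v d := pow_coef m M0 d - pow_coef m M' d.
pose w d := pow_coef m M' d - c m d.
have hv : wsum D (lsq r v) <= e / 16.
  by apply: le_trans hM'; apply: ler_wsum => d; rewrite /lsq /v rnorm_distC.
have split3 d : lsq r (fun d => pow_coef m M d - c m d) d <=
    2 * lsq r u d + (4 * lsq r v d + 4 * lsq r w d).
  have h2 := lsqD2 r v w d; have h3 := lsqD2 r u (fun d => v d + w d) d.
  have -> : lsq r (fun d => pow_coef m M d - c m d) d = lsq r (fun d => u d + (v d + w d)) d.
    by congr (rnorm _ ^+ 2 * _); rewrite /u /v /w; ring.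
  lra.
apply: le_trans (ler_wsum _ split3) _; rewrite !wsumD !wsumZ.
move: hv hc hM; rewrite -/u -/w; lra.
Qed.

(** The m-th power of a Fejer mean is close in the mean square to the series with
    coefficients [c m], whose norm its own Fejer means bound; the factor 2 is
    the price of splitting the square of a sum. *)
Lemma power_l2 m be e : 0 <= be ->
  (forall Q z, (0 < Q)%N -> rnorm z = r -> rnorm (fej Q (c m)).[z] <= be * r ^+ Q) ->
  0 < e -> exists M0, forall M, (M0 <= M)%N ->
    l2 r (P M ^+ m) <= (2 * be ^+ 2 + e) * r ^+ (2 * (m * M)).
Proof.
move=> be0 hbe e0; have [M0 h] := pow_coef_wsum_lim m (divr_gt0 e0 (ltr0n _ 2 : 0 < 2)).
exists M0 => M /(h M); set D := maxn (m * M) (size (P M ^+ m)) => /(_ D) hD.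
rewrite (@l2_wsum _ _ r0 (m * M) _ D) ?leq_maxl//; last first.
  by rewrite (leq_trans (leq_maxr (m * M) _))// leq_addl.
rewrite mulrC ler_wpM2r ?exprn_ge0 ?(ltW r0)//.
have hc := fej_wsum_le r0 D be0 hbe.
have split2 d : lsq r (lcoef (m * M) (P M ^+ m)) d <=
    2 * lsq r (c m) d + 2 * lsq r (fun d => pow_coef m M d - c m d) d.
  have := lsqD2 r (c m) (fun d => pow_coef m M d - c m d) d.
  have -> : lsq r (fun d => c m d + (pow_coef m M d - c m d)) d =
     lsq r (lcoef (m * M) (P M ^+ m)) d.
    by congr (rnorm _ ^+ 2 * _); rewrite addrC subrK.
  by rewrite mulrDr.
apply: le_trans (ler_wsum _ split2) _; rewrite wsumD !wsumZ; lra.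
Qed.

(** * Defect of the powers of a Toeplitz matrix *)

(** Iterating the truncated Toeplitz matrix on [X^k] differs from multiplying by
    the power of the Laurent polynomial by what is cut off at the origin at each
    step, that is, by coefficients of index less than -k of the powers. *)
Let trunc m M k := iter m (fejer_toeplitz M) 'X^k.

Let defect m M k := P M ^+ m * 'X^k - 'X^(m * M) * trunc m M k.

Let drop_polyB n (p q : {poly C}) : drop_poly n (p - q) = drop_poly n p - drop_poly n q.
Proof. by apply/polyP => i; rewrite !(coefB, coef_drop_poly). Qed.

Let defectS m M k : defect m.+1 M k =
  take_poly (m.+1 * M) (P M ^+ m.+1 * 'X^k) +
  'X^(m.+1 * M) * drop_poly (m.+1 * M) (P M * defect m M k).
Proof.
have -> : P M * defect m M k = P M ^+ m.+1 * 'X^k - 'X^(m * M) * (P M * trunc m M k).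
  by rewrite /defect exprS; ring.
rewrite drop_polyB (_ : drop_poly _ ('X^(m * M) * _) = trunc m.+1 M k); last first.
  rewrite {2}/trunc iterS fejer_toeplitzE; apply/polyP => i.
  rewrite !coef_drop_poly coefXnM mulSn addnA ltnNge leq_addl /= addnK//.
rewrite /defect mulrBr addrA; congr (_ - _).
by rewrite -[LHS](poly_take_drop (m.+1 * M)) [_ * 'X^(m.+1 * M)]mulrC.
Qed.

Let defect_le m M k t : (0 < M)%N -> 0 <= t ->
  (forall s, (s <= m)%N ->
    l2 r (take_poly (s * M) (P M ^+ s * 'X^k)) <= t * r ^+ (2 * (k + s * M))) ->
  l2 r (defect m M k) <= m%:R * b ^+ (2 * m) * t * r ^+ (2 * (k + m * M)).
Proof.
move=> Mp t0; elim: m => [|m ih] h.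
  rewrite /defect /trunc /= mul0n !expr0 !mul1r subrr.
  by rewrite /l2 size_poly0 big_ord0 !mul0r.
rewrite defectS (le_trans (l2_take_drop _ _ _ _))//.
have h1 := h m.+1 (leqnn _).
have h2 := ih (fun s sm => h s (leqW sm)).
have h3 := l2M (defect m M k) (ltW r0) (fun z => @P_le M z Mp).
have RE n : r ^+ (2 * n) = r ^+ n ^+ 2 by rewrite mulnC exprM.
have r2 n : 0 <= r ^+ n ^+ 2 by rewrite sqr_ge0.
have h4 : l2 r (P M * defect m M k) <=
    m%:R * b ^+ (2 * m.+1) * t * r ^+ (2 * (k + m.+1 * M)).
  rewrite (le_trans h3)// (le_trans (ler_wpM2l (sqr_ge0 _) h2))//.
  have BE n : b ^+ (2 * n) = b ^+ n ^+ 2 by rewrite mulnC exprM.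
  by apply: eq_ler; rewrite !RE !BE mulSn addnCA !exprD !exprS; ring.
have h5 : t * r ^+ (2 * (k + m.+1 * M)) <= b ^+ (2 * m.+1) * t * r ^+ (2 * (k + m.+1 * M)).
  rewrite ler_wpM2r ?RE// ler_peMl// exprn_ege1//.
rewrite -natr1 !mulrDl mul1r addrC; apply: lerD; first exact: h4.
exact: le_trans h5.
Qed.

Let entry_le m M k t i : (0 < M)%N -> 0 <= t ->
  (forall s, (s <= m)%N ->
    l2 r (take_poly (s * M) (P M ^+ s * 'X^k)) <= t * r ^+ (2 * (k + s * M))) ->
  rnorm (pow_coef m M (i%:Z - k%:Z) - (trunc m M k)`_i) ^+ 2 * r ^+ (2 * i)
    <= m%:R * b ^+ (2 * m) * t * r ^+ (2 * k).
Proof.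
move=> Mp t0 h.
have E : (defect m M k)`_(i + m * M) = pow_coef m M (i%:Z - k%:Z) - (trunc m M k)`_i.
  rewrite /defect coefB; congr (_ - _); last by rewrite coefXnM ltnNge leq_addl /= addnK.
  rewrite /pow_coef -(lcoefMXn k) mulrC -(lcoef_nat (k + m * M)); congr lcoef.
  by rewrite !PoszD; ring.
have := le_trans (l2_coef r (defect m M k) (i + m * M)) (defect_le Mp t0 h).
have RE n n' : r ^+ (2 * (n + n')) = r ^+ (2 * n) * r ^+ (2 * n') by rewrite mulnDr exprD.
by rewrite E !RE !mulrA ler_pM2r ?exprn_gt0.
Qed.

(** [ent m i k] stands for the entry of the [m]-th power of an operator that is
    the strong limit of the truncated Toeplitz operators. *)
Variable ent : nat -> nat -> nat -> C.
Hypothesis ent_lim : forall m i k,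
  ccvg (fun M => (iter m (fejer_toeplitz M) 'X^k)`_i) (ent m i k).

Let entry_lim_le m i k x : 0 <= x ->
  (exists M0, forall M, (M0 <= M)%N -> (0 < M)%N ->
    rnorm (pow_coef m M (i%:Z - k%:Z) - (trunc m M k)`_i) <= x) ->
  rnorm (c m (i%:Z - k%:Z) - ent m i k) <= x.
Proof.
move=> x0 [M0 h]; apply: le_of_ev_small => e e0.
have e2 : 0 < e / 2 by rewrite divr_gt0.
have [M1 h1] := c_lim m (i%:Z - k%:Z) e2; have [M2 h2] := ent_lim m i k e2.
pose M := (maxn M0 (maxn M1 M2)).+1.
have hM0 : (M0 <= M)%N by rewrite leqW// leq_maxl.
have hM1 : (M1 <= M)%N by rewrite leqW// (leq_trans (leq_maxl M1 M2))// leq_maxr.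
have hM2 : (M2 <= M)%N by rewrite leqW// (leq_trans (leq_maxr M1 M2))// leq_maxr.
have := h M hM0 isT; have := h1 M hM1; have := h2 M hM2.
rewrite /trunc; set u := pow_coef _ _ _; set v := _`_i => h3 h4 h5.
have h6 := rnormD3 u (c m (i%:Z - k%:Z)) (ent m i k).
have h7 := rnormD3 v u (ent m i k).
rewrite rnorm_distC in h4; move: h3 h4 h5 h6 h7; lra.
Qed.

Let weight_ratio i k Q : (k <= i + Q)%N -> (i <= k + Q)%N ->
  r ^+ (2 * k) <= (1 + r ^+ (2 * Q) + r ^- (2 * Q)) * r ^+ (2 * i).
Proof.
have r0' := ltW r0.
have rp n : 0 < r ^+ n by rewrite exprn_gt0.
move=> h1 h2; case: (leP 1 r) => r1.
  apply: (@le_trans _ _ (r ^+ (2 * Q) * r ^+ (2 * i))).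
    by rewrite -exprD -mulnDr ler_weXn2l// leq_mul2l /= addnC.
  rewrite ler_wpM2r ?exprn_ge0// addrAC lerDr addr_ge0// invr_ge0 exprn_ge0//.
apply: (@le_trans _ _ (r ^- (2 * Q) * r ^+ (2 * i))).
  rewrite mulrC ler_pdivlMr// -exprD -mulnDr; apply: ler_wiXn2l => //; first exact: ltW.
  by rewrite leq_mul2l.
by rewrite ler_wpM2r ?exprn_ge0// lerDr addr_ge0// exprn_ge0.
Qed.

Let sqr_bound_of_weighted (z : C) i k Q x : 0 <= x -> (k <= i + Q)%N -> (i <= k + Q)%N ->
  rnorm z ^+ 2 * r ^+ (2 * i) <= x * r ^+ (2 * k) ->
  rnorm z ^+ 2 <= x * (1 + r ^+ (2 * Q) + r ^- (2 * Q)).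
Proof.
move=> x0 h1 h2 h; have ri : 0 < r ^+ (2 * i) by rewrite exprn_gt0.
rewrite -(ler_pM2r ri) (le_trans h)// -mulrA ler_wpM2l//.
exact: weight_ratio.
Qed.

(** The defect is driven by the coefficients of the powers of index less than -k.
    By [power_cauchy] these are small in the mean square for large [k],
    uniformly in the order of the Fejer mean. *)
Lemma defect_vanish m Q e : 0 < e -> exists k0, forall i k, (k0 <= k)%N ->
  (k <= i + Q)%N -> (i <= k + Q)%N -> rnorm (c m (i%:Z - k%:Z) - ent m i k) <= e.
Proof.
move=> e0.
pose G := m%:R * b ^+ (2 * m) * (1 + r ^+ (2 * Q) + r ^- (2 * Q)).
have G0 : 0 <= G.
  have := exprn_ge0 (2 * Q) (ltW r0); have : 0 <= r ^- (2 * Q) by rewrite invr_ge0 exprn_ge0 ?ltW.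
  by move=> g1 g2; rewrite /G !mulr_ge0 ?exprn_ge0// !addr_ge0.
have G1 : 0 < G + 1 by rewrite ltr_wpDl.
pose t := e ^+ 2 / (G + 1); have t0 : 0 < t by rewrite divr_gt0 ?exprn_gt0.
have /choice[M0 hM0] s : exists M0, (0 < M0)%N /\ forall M, (M0 <= M)%N ->
    l2 r (P M ^+ s - 'X^(s * M - s * M0) * P M0 ^+ s) <= t * r ^+ (2 * (s * M)).
  by have [M0 h1 h2] := power_cauchy s t0; exists M0.
pose L := \max_(s < m.+1) M0 s.
have L_le s : (s <= m)%N -> (M0 s <= L)%N.
  by move=> sm; rewrite /L (bigD1 (Ordinal (sm : (s < m.+1)%N)))//= leq_maxl.
exists (m * L)%N => i k Lk h1 h2; apply: entry_lim_le; first exact: ltW.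
exists L => M LM Mp.
have tail s : (s <= m)%N ->
    l2 r (take_poly (s * M) (P M ^+ s * 'X^k)) <= t * r ^+ (2 * (k + s * M)).
  move=> sm; have [_ hs] := hM0 s; have sL := L_le s sm.
  have hs' := hs M (leq_trans sL LM).
  have -> : take_poly (s * M) (P M ^+ s * 'X^k) =
      take_poly (s * M) ('X^k * (P M ^+ s - 'X^(s * M - s * M0 s) * P (M0 s) ^+ s)).
    apply/polyP => l; rewrite !coef_take_poly; case: ifP => // ls.
    rewrite mulrBr coefB [_ * 'X^k]mulrC mulrA -exprD [X in _ - X]coefXnM ifT ?subr0//.
    apply: (leq_trans ls); rewrite -leq_subLR.
    have : (s * M0 s <= k)%N by rewrite (leq_trans _ Lk)// leq_mul.
    lia.
  rewrite (le_trans (l2_take _ _ _))// l2MXn mulnDr exprD mulrCA ler_wpM2l//.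
  by rewrite exprn_ge0// ltW.
have := entry_le i Mp (ltW t0) tail.
have mb0 : 0 <= m%:R * b ^+ (2 * m) * t.
  by apply: mulr_ge0; [apply: mulr_ge0 => //; exact: exprn_ge0|exact: ltW].
move=> /(sqr_bound_of_weighted mb0 h1 h2) h3.
rewrite -ler_sqr ?nnegrE ?rnorm_ge0 ?(ltW e0)// (le_trans h3)//.
rewrite mulrAC -/G.
rewrite /t mulrCA ler_piMr ?exprn_ge0 ?(ltW e0)//.
by rewrite ler_pdivrMr// mul1r lerDl.
Qed.

(** Cauchy's estimates on the inner circle make the coefficients of index less
    than -k geometrically small on the outer one. *)
Lemma defect_geometric m Q r1 : 0 < r1 -> r1 < r ->
  (forall n z, (0 < n)%N -> rnorm z = r1 -> rnorm (P n).[z] <= b * r1 ^+ n) ->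
  exists2 D, 0 <= D & forall i k, (k <= i + Q)%N -> (i <= k + Q)%N ->
    rnorm (c m (i%:Z - k%:Z) - ent m i k) <= D * (r1 / r) ^+ k.
Proof.
move=> r10 r1r P1_le; set t := r1 / r.
have t0 : 0 < t by rewrite divr_gt0.
have t1 : t < 1 by rewrite ltr_pdivrMr// mul1r.
have tt0 : 0 <= t ^+ 2 by rewrite sqr_ge0.
have tt1 : t ^+ 2 < 1 by rewrite exprn_ilt1// ltW.
have s0 : 0 < 1 - t ^+ 2 by rewrite subr_gt0.
pose A := b ^+ (2 * m) / (1 - t ^+ 2).
have A0 : 0 <= A by rewrite divr_ge0 ?exprn_ge0// ltW.
pose G := m%:R * b ^+ (2 * m) * A * (1 + r ^+ (2 * Q) + r ^- (2 * Q)).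
have G0 : 0 <= G.
  have := exprn_ge0 (2 * Q) (ltW r0); have : 0 <= r ^- (2 * Q) by rewrite invr_ge0 exprn_ge0 ?ltW.
  move=> g1 g2; apply: mulr_ge0; last by lra.
  by apply: mulr_ge0 => //; apply: mulr_ge0 => //; exact: exprn_ge0.
have G10 : 0 <= 1 + G by move: G0; lra.
have tk k : 0 <= t ^+ k by rewrite exprn_ge0// ltW.
exists (1 + G) => //.
move=> i k h1 h2; apply: entry_lim_le; first exact: mulr_ge0.
exists 0%N => M _ Mp.
have At0 : 0 <= A * t ^+ (2 * k) by exact: mulr_ge0.
have tail s : (s <= m)%N ->
    l2 r (take_poly (s * M) (P M ^+ s * 'X^k)) <= A * t ^+ (2 * k) * r ^+ (2 * (k + s * M)).
  move=> sm; rewrite (@l2_widen _ r (s * M)) ?size_take_poly//.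
  apply: (@le_trans _ _ (\sum_(l < s * M) b ^+ (2 * m) * t ^+ (2 * k) *
      r ^+ (2 * (k + s * M)) * (t ^+ 2) ^+ (s * M - l))).
    apply: ler_sum => l _; rewrite coef_take_poly ltn_ord coefMXn.
    case: ltnP => kl.
      rewrite rnorm0 expr0n mul0r !mulr_ge0 ?exprn_ge0 ?(ltW t0) ?(ltW r0)//.
    have cst : rnorm (P M ^+ s)`_(l - k) * r1 ^+ (l - k) <= b ^+ s * r1 ^+ (s * M).
      apply: cauchy_estimate => [|z zr]; first exact: ltW.
      rewrite horner_exp rnormX mulnC exprM -exprMn.
      by rewrite lerXn2r ?nnegrE ?rnorm_ge0 ?P1_le// mulr_ge0 ?exprn_ge0 ?(ltW r10).
    have cst2 : rnorm (P M ^+ s)`_(l - k) <= b ^+ m * r1 ^+ (s * M + k - l).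
      rewrite -(ler_pM2r (exprn_gt0 (l - k) r10)) (le_trans cst)// -mulrA -exprD.
      rewrite (_ : (s * M + k - l + (l - k) = s * M)%N); last exact: index_cancel.
      by rewrite ler_wpM2r ?exprn_ge0 ?(ltW r10)// ler_weXn2l.
    have cst3 : rnorm (P M ^+ s)`_(l - k) ^+ 2 <= (b ^+ m * r1 ^+ (s * M + k - l)) ^+ 2.
      by rewrite ler_sqr ?nnegrE ?rnorm_ge0// mulr_ge0 ?exprn_ge0 ?(ltW r10).
    apply: le_trans (ler_wpM2r (exprn_ge0 _ (ltW r0)) cst3) _.
    have -> : r1 = t * r by rewrite divfK// gt_eqF.
    have -> : (s * M + k - l = k + (s * M - l))%N by rewrite addnC addnBA// ltnW.
    have RE (x : R) n : x ^+ (2 * n) = x ^+ n ^+ 2 by rewrite mulnC exprM.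
    have -> : (k + s * M = k + (s * M - l) + l)%N by rewrite -addnA subnK// ltnW.
    by apply: eq_ler; rewrite !RE exprMn !exprD [t ^+ 2 ^+ _]exprAC ![(t * r) ^+ _]exprMn; ring.
  rewrite -mulr_sumr (_ : A * _ * _ = b ^+ (2 * m) * t ^+ (2 * k) *
      r ^+ (2 * (k + s * M)) * (1 - t ^+ 2)^-1); last by rewrite /A; ring.
  apply: ler_wpM2l; first by rewrite !mulr_ge0 ?exprn_ge0// ltW.
  rewrite (reindex_inj rev_ord_inj) /=.
  apply: (@le_trans _ _ (\sum_(l < s * M | (0 <= l)%N) (t ^+ 2) ^+ l)).
    apply: ler_sum => l _; rewrite subKn//.
    by rewrite exprS ler_piMl ?exprn_ge0// ltW.
  by rewrite (le_trans (geom_tail _ _ tt0 tt1))// expr0 mul1r.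
have := entry_le i Mp At0 tail.
have mb0 : 0 <= m%:R * b ^+ (2 * m) * (A * t ^+ (2 * k)).
  by apply: mulr_ge0 => //; apply: mulr_ge0 => //; exact: exprn_ge0.
move=> /(sqr_bound_of_weighted mb0 h1 h2) h3.
rewrite -ler_sqr ?nnegrE ?rnorm_ge0 ?mulr_ge0//.
rewrite (le_trans h3)// [X in _ <= X]exprMn -exprM [(k * 2)%N]mulnC.
rewrite [_ * (A * _)]mulrA mulrAC -/G; apply: ler_wpM2r => //.
by rewrite sqrrD expr1n mul1r; have := sqr_ge0 G; move: G0; lra.
Qed.

End OneCircle.
End PowersOfFejerMeans.

(** * Powers of a Toeplitz operator *)

Section ToeplitzPowers.
Variables (R : realType) (E : completeNormedModType R[i]).
Local Notation C := R[i].
Variable j : E -> nat -> C.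
Hypothesis j_linear : forall (a : C) (x y : E) (n : nat),
  j (a *: x + y) n = a * j x n + j y n.
Hypothesis j_inj : injective j.
Hypothesis F_sub : forall u : nat -> C, finsupp u -> exists x : E, j x = u.
Hypothesis F_dense : dense [set x : E | finsupp (j x)].
Hypothesis coord_cont : forall n : nat, continuous (fun x : E => j x n : R[i]^o).
Variable K : R.
Hypothesis K0 : 0 < K.
Hypothesis rot : forall z x, rnorm z = 1 ->
  exists2 y, j y = rotate z (j x) & rnorm y <= K * rnorm x.

Local Notation emb := (emb j).
Local Notation N := (emb_norm j).

Let ND := ND j_linear j_inj F_sub.
Let NZ := NZ j_linear j_inj F_sub.
Let N_ge0 := @N_ge0 R E j.
Let N_gt0 := N_gt0 j_linear j_inj F_sub.
Let N_rotp := N_rotp j_inj F_sub rot.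
Let N_coef := N_coef j_linear j_inj F_sub rot.
Let emb_dense := emb_dense j_inj F_sub F_dense.
Let coord_le := coord_le j_linear j_inj F_sub F_dense coord_cont K0 rot.
Let fejer_op := fejer_op j_linear j_inj F_sub F_dense coord_cont K0 rot.
Let embB := embB j_linear j_inj F_sub.
Let embD := embD j_linear j_inj F_sub.
Let embZ := embZ j_linear j_inj F_sub.
Let jemb := jemb j_inj F_sub.
Let jB := jB j_linear.

(** Density and uniform boundedness; the latter is [fejer_op] for an operator of
    rank one. *)
Lemma fejer_mean_cvg x k : ev_small (fun M =>
  rnorm (emb (\poly_(i < k + M) (kf R M i k * j x i)) - x)).
Proof.
pose F M y := emb (\poly_(i < k + M) (kf R M i k * j y i)).
have FB M y : (0 < M)%N -> rnorm (F M y) <= K ^+ 3 * rnorm y.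
  move=> M0; have Xk : 0 < N 'X^k by rewrite N_gt0 -size_poly_eq0 size_polyXn.
  pose f l := if l == k then y else 0.
  have f_sum n (p : {poly C}) : (size p <= n)%N -> \sum_(l < n) p`_l *: f l = p`_k *: y.
    move=> sp; case: (ltnP k n) => kn.
      rewrite (bigD1 (Ordinal kn))//= /f eqxx big1 ?addr0// => l lk.
      rewrite ifF ?scaler0//; apply/negbTE; apply: contra lk => /eqP lk.
      by apply/eqP/val_inj.
    rewrite nth_default ?(leq_trans sp)// scale0r big1// => l _.
    by rewrite /f ifF ?scaler0//; apply/negbTE; move: (ltn_ord l) => h; lia.
  have := @fejer_op f (K * rnorm y / N 'X^k) M 'X^k M0.
  rewrite size_polyXn big_ord_recr /= coefXn eqxx scale1r /f eqxx.
  rewrite big1 ?add0r => [|l _]; last first.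
    by rewrite coefXn (_ : (_ == _) = false) ?scale0r//; move: (ltn_ord l) => h; lia.
  move=> h; rewrite /F -/(N _) (le_trans (h _ _))//.
  - by rewrite divr_ge0 ?mulr_ge0 ?rnorm_ge0 ?ltW.
  - move=> n p sp; rewrite f_sum// rnormZ mulrAC ler_pdivlMr// mulrAC [K * _ * _]mulrAC.
    by rewrite ler_wpM2r ?rnorm_ge0// N_coef.
  - by rewrite -mulrA divfK ?gt_eqF// !exprS; apply: eq_ler; ring.
have FBB M y z : F M (y - z) = F M y - F M z.
  rewrite /F -embB; congr emb; apply/polyP => i; rewrite coefB !coef_poly.
  by case: ifP; rewrite ?subr0// jB mulrBr.
have Fpoly (g : {poly C}) : ev_small (fun M => rnorm (F M (emb g) - emb g)).
  have h : ev_small (fun M => \sum_(i < size g) rnorm (1 - kf R M i k) * (rnorm g`_i * N 'X^i)).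
    apply: (@ev_small_sum _ _ (fun i M => rnorm (1 - kf R M i k) * (rnorm g`_i * N 'X^i))) => i e e0.
    have [c c0 hc] : exists2 c, 0 <= c & ((i - k) + (k - i))%:R * (rnorm g`_i * N 'X^i) <= c :> R.
      by exists (((i - k) + (k - i))%:R * (rnorm g`_i * N 'X^i)) => //; rewrite !mulr_ge0 ?rnorm_ge0.
    have [M0 hM0] := exists_natr_gt (c / e).
    exists M0.+1 => M MM; have Mp : (0 < M)%N := leq_trans (ltn0Sn _) MM.
    rewrite (le_trans (ler_wpM2r _ (kf_cvg _ _ _ Mp))) ?mulr_ge0 ?rnorm_ge0//.
    rewrite mulrAC ler_pdivrMr ?ltr0n// (le_trans hc)//.
    move: hM0; rewrite ltr_pdivrMr// mulrC => /ltW /le_trans; apply.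
    by rewrite ler_wpM2l ?ler_nat// ltW.
  move=> e /h[M0 hM0]; exists (maxn M0 (size g)) => M; rewrite geq_max => /andP[MM gM].
  apply: le_trans (hM0 M MM); rewrite /F -embB.
  rewrite (_ : _ - g = \sum_(i < size g) ((kf R M i k - 1) * g`_i) *: 'X^i).
    apply: le_trans (N_sum j_linear j_inj F_sub _ _ _) _; apply: ler_sum => i _.
    by rewrite NZ rnormM -mulrA rnorm_distC.
  rewrite -(poly_def _ (fun i => (kf R M i k - 1) * g`_i)).
  apply/polyP => i; rewrite coefB !coef_poly jemb.
  case: (ltnP i (size g)) => ig.
    by rewrite ifT ?mulrBl ?mul1r// (leq_trans ig)// (leq_trans gM)// leq_addl.
  by rewrite nth_default// mulr0 if_same subr0.
move=> e e0; have K1 : 0 < K ^+ 3 + 2 by rewrite addr_gt0 ?exprn_gt0.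
have [g hg] := emb_dense x (divr_gt0 e0 K1).
have [M0 hM0] := Fpoly g _ (divr_gt0 e0 K1).
exists M0.+1 => M MM; have Mp : (0 < M)%N := leq_trans (ltn0Sn _) MM.
have h1 := hM0 M (ltnW MM).
have h2 := FB M (x - emb g) Mp.
have h3 := rnormD3 (F M (emb g)) (F M x) x.
have h4 := rnormD3 (emb g) (F M (emb g)) x.
rewrite -FBB in h3; rewrite [rnorm (emb g - x)]rnorm_distC in h4.
have h5 : K ^+ 3 * rnorm (x - emb g) <= K ^+ 3 * (e / (K ^+ 3 + 2)).
  by rewrite ler_wpM2l ?exprn_ge0 ?ltW.
have h6 : (K ^+ 3 + 2) * (e / (K ^+ 3 + 2)) = e by rewrite mulrC divfK// gt_eqF.
rewrite -/(F M x); move: h6 (ltW hg) h1 h2 h3 h4 h5; rewrite mulrDl; lra.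
Qed.

Variables (T : E -> E) (tau : R) (a : int -> C).
Hypothesis T_lin : forall c x y, T (c *: x + y) = c *: T x + T y.
Hypothesis tau0 : 0 <= tau.
Hypothesis T_le : forall x, rnorm (T x) <= tau * rnorm x.
Hypothesis T_toep : forall i k, j (T (emb 'X^k)) i = a (i%:Z - k%:Z).

Let T0 : T 0 = 0.
Proof. by have := T_lin (-1) 0 0; rewrite scaleN1r oppr0 addr0 scaleN1r addNr. Qed.

Let TD x y : T (x + y) = T x + T y.
Proof. by have := T_lin 1 x y; rewrite !scale1r. Qed.

Let TZ c x : T (c *: x) = c *: T x.
Proof. by have := T_lin c x 0; rewrite T0 !addr0. Qed.

Let TB x y : T (x - y) = T x - T y.
Proof. by rewrite TD -scaleN1r TZ scaleN1r. Qed.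

Let iterT_le m x : rnorm (iter m T x) <= tau ^+ m * rnorm x.
Proof.
elim: m => [|m ih]; first by rewrite expr0 mul1r.
by rewrite iterS exprS -mulrA (le_trans (T_le _))// ler_wpM2l.
Qed.

Let iterTD m x y : iter m T (x + y) = iter m T x + iter m T y.
Proof. by elim: m => //= m ->. Qed.

Let iterTZ m c x : iter m T (c *: x) = c *: iter m T x.
Proof. by elim: m => //= m ->. Qed.

Let iterT_emb m n (p : {poly C}) : (size p <= n)%N ->
  \sum_(k < n) p`_k *: iter m T (emb 'X^k) = iter m T (emb p).
Proof.
move=> sp; have -> : p = \sum_(k < n) p`_k *: 'X^k.
  rewrite -(poly_def n (fun k => p`_k)); apply/polyP => i; rewrite coef_poly.
  by case: ltnP => // h; rewrite nth_default// (leq_trans sp).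
rewrite (emb_sum j_linear j_inj F_sub).
have -> : iter m T (\sum_(k < n) emb (p`_k *: 'X^k)) = \sum_(k < n) iter m T (emb (p`_k *: 'X^k)).
  elim/big_rec2: _ => [|k y1 y2 _ <-]; last by rewrite iterTD.
  by rewrite -(scale0r 0) iterTZ !scale0r.
apply: eq_bigr => k _; rewrite embZ iterTZ; congr (_ *: _).
rewrite coef_sum (bigD1 k)//= coefZ coefXn eqxx mulr1 big1 ?addr0// => l lk.
rewrite coefZ coefXn (_ : (_ == _) = false) ?mulr0//; apply/negbTE.
by rewrite eq_sym; apply: contra lk => /eqP lk; apply/eqP/val_inj.
Qed.

Definition entry m i k := j (iter m T (emb 'X^k)) i.

(** The constant [K ^+ 2] does not grow with [m]: this is why powers yield the
    sharp bound. *)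
Lemma fejer_power m Q q : (0 < Q)%N ->
  N (fejop Q (entry m) q) <= K ^+ 2 * tau ^+ m * N q.
Proof.
move=> Q0; apply: (@fejer_op (fun k => iter m T (emb 'X^k))) => //.
  exact: exprn_ge0.
by move=> n p sp; rewrite iterT_emb// iterT_le.
Qed.

Let FT_le M q : (0 < M)%N -> N (fejer_toeplitz a M q) <= K ^+ 2 * tau * N q.
Proof.
move=> M0; have := @fejer_power 1 M q M0; rewrite expr1.
rewrite (_ : fejop M (entry 1) q = fejer_toeplitz a M q)//.
by apply: eq_bigr => k _; congr (_ *: _); apply: eq_poly => i _; rewrite /entry T_toep.
Qed.

Let FTB M p q : fejer_toeplitz a M (p - q) = fejer_toeplitz a M p - fejer_toeplitz a M q.
Proof.
by rewrite !fejer_toeplitzE mulrBr; apply/polyP => i; rewrite !(coefB, coef_drop_poly).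
Qed.

Let FT_cvg q : ev_small (fun M => rnorm (emb (fejer_toeplitz a M q) - T (emb q))).
Proof.
have h : ev_small (fun M => \sum_(k < size q) rnorm q`_k *
    rnorm (emb (\poly_(i < k + M) (kf R M i k * j (T (emb 'X^k)) i)) - T (emb 'X^k))).
  apply: (@ev_small_sum _ _ (fun k M => rnorm q`_k *
    rnorm (emb (\poly_(i < k + M) (kf R M i k * j (T (emb 'X^k)) i)) - T (emb 'X^k)))) => k.
  by apply: ev_smallZ; [exact: rnorm_ge0|exact: fejer_mean_cvg].
apply: ev_small_le h => M.
have := iterT_emb 1 (leqnn (size q)); rewrite /= => <-; rewrite /fejer_toeplitz /fejop.
rewrite (emb_sum j_linear j_inj F_sub) -sumrB (le_trans (rnorm_sum _ _ _))//.
apply: ler_sum => k _; rewrite embZ -scalerBr rnormZ ler_wpM2l ?rnorm_ge0//.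
rewrite (_ : \poly_(i < k + M) _ = \poly_(i < k + M) (kf R M i k * a (i%:Z - k%:Z)))//.
by apply: eq_poly => i _; rewrite T_toep.
Qed.

(** The truncated Toeplitz operators are uniformly bounded, so that their
    powers converge strongly as well. *)
Let FT_iter_cvg m q :
  ev_small (fun M => rnorm (emb (iter m (fejer_toeplitz a M) q) - iter m T (emb q))).
Proof.
elim: m => [|m ih].
  by move=> e e0; exists 0%N => M _; rewrite subrr rnorm0 ltW.
set y := iter m T (emb q) => e e0.
pose L := K ^+ 2 * tau.
have L0 : 0 <= L by rewrite mulr_ge0// exprn_ge0// ltW.
have D0 : 0 < 2 * L + tau + 1 by move: L0 tau0; lra.
set d := e / (2 * L + tau + 1); have d0 : 0 < d by rewrite divr_gt0.
have [g hg] := emb_dense y d0.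
have [M1 h1] := ih _ d0; have [M2 h2] := FT_cvg g d0.
exists (maxn M1 M2).+1 => M MM; have Mp : (0 < M)%N := leq_trans (ltn0Sn _) MM.
have {}h1 : rnorm (emb (iter m (fejer_toeplitz a M) q) - y) <= d.
  by apply: h1; rewrite (leq_trans _ (ltnW MM))// leq_maxl.
have {}h2 : rnorm (emb (fejer_toeplitz a M g) - T (emb g)) <= d.
  by apply: h2; rewrite (leq_trans _ (ltnW MM))// leq_maxr.
rewrite !iterS -/y; set u := iter m _ q in h1 *.
have h3 := FT_le (u - g) Mp.
have h4 : N (u - g) <= 2 * d.
  have := rnormD3 y (emb u) (emb g); rewrite -embB -/(N _); move: (ltW hg); lra.
have h5 := T_le (emb g - y).
have h6 := rnormD3 (emb (fejer_toeplitz a M g)) (emb (fejer_toeplitz a M u)) (T y).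
have h7 := rnormD3 (T (emb g)) (emb (fejer_toeplitz a M g)) (T y).
rewrite -embB -FTB -/(N _) in h6; rewrite -TB in h7.
rewrite [rnorm (emb g - y)]rnorm_distC in h5.
have h8 : L * N (u - g) <= L * (2 * d) by rewrite ler_wpM2l.
have h9 : tau * rnorm (y - emb g) <= tau * d by rewrite ler_wpM2l// ltW.
have h10 : (2 * L + tau + 1) * d = e by rewrite /d mulrC divfK// gt_eqF.
rewrite -/L in h3.
move: (ltW d0) h10 h1 h2 h3 h5 h6 h7 h8 h9; lra.
Qed.

Lemma entry_lim m i k :
  ccvg (fun M => (iter m (fejer_toeplitz a M) 'X^k)`_i) (entry m i k).
Proof.
have Xi : 0 < N 'X^i by rewrite N_gt0 -size_poly_eq0 size_polyXn.
have c0 : 0 <= K / N 'X^i by rewrite divr_ge0// ltW.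
apply: ev_small_le (ev_smallZ c0 (FT_iter_cvg m 'X^k)) => M.
rewrite mulrAC ler_pdivlMr//.
by have := coord_le (emb (iter m (fejer_toeplitz a M) 'X^k) - iter m T (emb 'X^k)) i; rewrite jB jemb.
Qed.

End ToeplitzPowers.

(** * Growth rates of the shifts and circles of boundedness *)

Section ShiftIterates.
Variable R : realType.
Local Notation C := R[i].

Lemma bernoulli_sub (x : R) n : 0 <= x -> x <= 1 -> 1 - n%:R * x <= (1 - x) ^+ n.
Proof.
move=> x0 x1; elim: n => [|n ih]; first by rewrite mul0r subr0 expr0.
have h : 0 <= 1 - x by lra.
rewrite exprS (le_trans _ (ler_wpM2l h ih))//.
have : 0 <= n%:R * x * x by rewrite !mulr_ge0.
by rewrite -natr1; lra.
Qed.

Lemma iter_shiftX l (q : {poly C}) : iter l ( *%R 'X) q = 'X^l * q.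
Proof. by elim: l => [|l ih]; rewrite ?expr0 ?mul1r// iterS ih exprS mulrA. Qed.

Lemma iter_shiftD l (q : {poly C}) : iter l (drop_poly 1) q = drop_poly l q.
Proof.
elim: l => [|l ih]; first by rewrite drop_poly0l.
by rewrite iterS ih; apply/polyP => k; rewrite !coef_drop_poly; congr (q`_ _); lia.
Qed.

End ShiftIterates.

Section CirclesOfBoundedness.
Variable R : realType.
Local Notation C := R[i].
Variables (K : R) (N : {poly C} -> R).
Hypothesis K0 : 0 < K.
Hypothesis N_ge0 : forall q, 0 <= N q.
Hypothesis ND : forall p q, N (p + q) <= N p + N q.
Hypothesis NZ : forall c p, N (c *: p) = rnorm c * N p.
Hypothesis N_gt0 : forall q, (0 < N q) = (q != 0).
Hypothesis N_rotp : forall w q, rnorm w = 1 -> N (rotp w q) <= K * N q.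

Local Notation shiftX := ( *%R ('X : {poly C})).
Local Notation shiftD := (drop_poly 1).

(** The two halves of the formula for the spectral radius. *)
Record power_radius (s : {poly C} -> {poly C}) (rho : R) : Prop := PowerRadius {
  radius_gt0 : 0 < rho;
  radius_ge : forall l, rho ^+ l <= opN N (iter l s);
  radius_lim : forall t, 1 < t -> exists c, forall l, opN N (iter l s) <= c * (rho * t) ^+ l }.

Section Operator.
Variables (s : {poly C} -> {poly C}) (B : R).
Hypothesis sZ : forall a q, s (a *: q) = a *: s q.
Hypothesis B1 : 1 <= B.
Hypothesis sB : forall q, N (s q) <= B * N q.

Let B0 : 0 <= B := le_trans ler01 B1.

Let itZ l a q : iter l s (a *: q) = a *: iter l s q.
Proof. by elim: l => //= l ->. Qed.

Let itB l q : N (iter l s q) <= B ^+ l * N q.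
Proof.
elim: l => [|l ih]; first by rewrite expr0 mul1r.
by rewrite iterS exprS -mulrA (le_trans (sB _))// ler_wpM2l.
Qed.

Lemma opN_iterP l q : N (iter l s q) <= opN N (iter l s) * N q.
Proof. exact: (@opNP _ _ N_ge0 NZ N_gt0 _ (B ^+ l)). Qed.

Lemma opN_iter_ge0 l : 0 <= opN N (iter l s).
Proof. exact: (@opN_ge0 _ _ N_ge0 NZ _ (B ^+ l)). Qed.

Lemma opN_iter_le l : opN N (iter l s) <= B ^+ l.
Proof. by apply: (opN_le NZ) => //; exact: exprn_ge0. Qed.

Lemma opN_iterD k l : opN N (iter (k + l) s) <= opN N (iter k s) * opN N (iter l s).
Proof.
apply: (opN_le NZ) => [|q]; first by rewrite mulr_ge0 ?opN_iter_ge0.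
by rewrite iterD (le_trans (opN_iterP _ _))// -mulrA ler_wpM2l ?opN_iter_ge0// opN_iterP.
Qed.

(** Euclidean division of the exponent by [l0]. *)
Lemma opN_iter_small x l0 : 0 < x -> (0 < l0)%N -> opN N (iter l0 s) <= x ^+ l0 ->
  exists2 c, 0 <= c & forall l, opN N (iter l s) <= c * x ^+ l.
Proof.
move=> x0 l00 h.
pose c := \sum_(m < l0) (B / x) ^+ m.
have Bx m : 0 <= (B / x) ^+ m by rewrite exprn_ge0// divr_ge0// ltW.
have c0 : 0 <= c by apply: sumr_ge0.
exists c => // l.
rewrite {1}(divn_eq l l0); set q := (l %/ l0)%N; set m := (l %% l0)%N.
have hq : opN N (iter (q * l0) s) <= x ^+ (q * l0).
  elim: {m} q => [|q ih].
    by rewrite mul0n expr0; apply: (opN_le NZ) => // p; rewrite mul1r.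
  rewrite mulSn exprD (le_trans (opN_iterD _ _))//.
  by apply: ler_pM => //; exact: opN_iter_ge0.
apply: le_trans (opN_iterD _ _) _.
apply: (@le_trans _ _ (x ^+ (q * l0) * B ^+ m)).
  by apply: ler_pM; rewrite ?opN_iter_ge0// opN_iter_le.
have ml : (m < l0)%N by rewrite ltn_mod.
have hm : (B / x) ^+ m <= c.
  rewrite /c (bigD1 (Ordinal ml))//= lerDl; apply: sumr_ge0 => *; exact: Bx.
apply: (@le_trans _ _ ((B / x) ^+ m * x ^+ l)).
  rewrite [in x ^+ l](divn_eq l l0) exprD mulrCA ler_wpM2l ?exprn_ge0 ?(ltW x0)//.
  by rewrite -exprMn divfK// gt_eqF.
by rewrite ler_wpM2r ?exprn_ge0// ltW.
Qed.

(** The supremum of the radii dominated by all the powers: anything larger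
    exceeds the norm of some power, which then controls all the others. *)
Lemma radius_exists r : 0 < r -> (forall l, r ^+ l <= opN N (iter l s)) ->
  exists2 rho, r <= rho & power_radius s rho.
Proof.
move=> r0 hr.
pose A := [set x : R | 0 <= x /\ forall l, x ^+ l <= opN N (iter l s)].
have hsA : has_sup A.
  split; first by exists r; split; [exact: ltW|].
  exists B => x [x0 /(_ 1%N)]; rewrite expr1 => /le_trans; apply.
  by rewrite (le_trans (opN_iter_le 1))// expr1.
have rA : r <= sup A by apply: sup_ubound; [case: hsA|split => //; exact: ltW].
have s0 : 0 < sup A := lt_le_trans r0 rA.
exists (sup A) => //; split => //.
- move=> l; rewrite leNgt; apply/negP => hl.
  set o := opN N (iter l s) in hl.
  have o0 : 0 <= o by exact: opN_iter_ge0.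
  have sl : 0 < sup A ^+ l by rewrite exprn_gt0.
  pose e := (1 - o / sup A ^+ l) / l.+1%:R.
  have q1 : o / sup A ^+ l < 1 by rewrite ltr_pdivrMr// mul1r.
  have q0 : 0 <= o / sup A ^+ l by rewrite divr_ge0// ltW.
  have e0 : 0 < e by rewrite divr_gt0// subr_gt0.
  have l1 : 1 <= l.+1%:R :> R by rewrite ler1n.
  have e1 : e <= 1 by rewrite ler_pdivrMr// mul1r; lra.
  have se : 0 < sup A * e by rewrite mulr_gt0.
  have [y [y0 yA] hy] := sup_adherent se hsA.
  have hy2 : sup A * (1 - e) <= y by rewrite mulrBr mulr1 ltW.
  have : sup A ^+ l * (1 - l%:R * e) <= o.
    apply: le_trans (yA l); apply: (@le_trans _ _ ((sup A * (1 - e)) ^+ l)).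
      by rewrite exprMn ler_wpM2l ?(ltW sl)// bernoulli_sub// ltW.
    by rewrite lerXn2r ?nnegrE// mulr_ge0 ?(ltW s0)// subr_ge0.
  rewrite mulrC -ler_pdivlMr//.
  have : l.+1%:R * e = 1 - o / sup A ^+ l by rewrite /e mulrC divfK// gt_eqF.
  by rewrite -natr1 mulrDl mul1r; lra.
- move=> t t1; set x := sup A * t.
  have t0 : 0 < t := lt_trans ltr01 t1.
  have x0 : 0 < x by rewrite mulr_gt0.
  have [l0 hl0] : exists l, opN N (iter l s) < x ^+ l.
    apply: contrapT => h; have : x <= sup A.
      apply: sup_ubound; [by case: hsA|split; first exact: ltW] => l.
      by rewrite leNgt; apply/negP => hl; apply: h; exists l.
    by rewrite /x leNgt ltr_pMr// t1.
  have l00 : (0 < l0)%N.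
    rewrite lt0n; apply: contraTneq hl0 => ->; rewrite -leNgt expr0.
    by have := hr 0%N; rewrite expr0.
  by have [c _ hc] := opN_iter_small x0 l00 (ltW hl0); exists c.
Qed.

End Operator.

Definition fej_bounded (u : int -> C) (be r : R) := forall Q z, (0 < Q)%N ->
  rnorm z = r -> rnorm (fej Q u).[z] <= be * r ^+ Q.

Lemma fej_bounded_annulus u be r1 r r2 : 0 <= be -> 0 < r1 -> r1 <= r -> r <= r2 ->
  fej_bounded u be r1 -> fej_bounded u be r2 -> fej_bounded u be r.
Proof.
move=> be0 r10 h1 h2 b1 b2 Q z Q0 zr.
by apply: (max_annulus r10 h1 h2 be0) zr => w hw; [exact: b1|exact: b2].
Qed.

Lemma fej_bounded_disc u be r r2 : 0 <= be -> 0 < r -> r <= r2 ->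
  (forall n, u (Negz n) = 0) -> fej_bounded u be r2 -> fej_bounded u be r.
Proof.
move=> be0 r0 h2 u0 b2 Q z Q0 zr.
apply: (max_disc r0 h2 be0) zr => [i iQ|w hw]; last exact: b2.
rewrite coef_poly; case: ifP => // _.
have -> : i%:Z - Q%:Z = Negz (Q - i).-1 by lia.
by rewrite u0 mulr0.
Qed.

Lemma fej_bounded_exterior u be r1 r : 0 <= be -> 0 < r1 -> r1 <= r ->
  (forall n, u (Posz n.+1) = 0) -> fej_bounded u be r1 -> fej_bounded u be r.
Proof.
move=> be0 r10 h1 u0 b1 Q z Q0 zr.
apply: (max_exterior r10 h1 be0) zr => [|w hw]; last exact: b1.
apply/leq_sizeP => i iQ; rewrite coef_poly; case: ifP => // _.
have -> : i%:Z - Q%:Z = Posz (i - Q).-1.+1 by lia.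
by rewrite u0 mulr0.
Qed.

Section Powers.
Variables (a : int -> C) (tau : R) (ent : nat -> nat -> nat -> C).
Hypothesis tau0 : 0 <= tau.
Hypothesis ent1 : forall i k, ent 1 i k = a (i%:Z - k%:Z).
Hypothesis fejer_power : forall m Q q, (0 < Q)%N ->
  N (fejop Q (ent m) q) <= K ^+ 2 * tau ^+ m * N q.
Hypothesis ent_lim : forall m i k,
  ccvg (fun M => (iter m (fejer_toeplitz a M) 'X^k)`_i) (ent m i k).

Let bet m := K ^+ 2 * tau ^+ m.
Let bet0 m : 0 <= bet m.
Proof. by rewrite mulr_ge0// exprn_ge0// ltW. Qed.

(** The deviation from a Toeplitz matrix that [circle_forward] and
    [circle_backward] tolerate. *)
Definition geometric_defect m (u : int -> C) := exists2 th, 0 <= th < 1 &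
  forall Q, exists2 D, 0 <= D & forall i k, (k <= i + Q)%N -> (i <= k + Q)%N ->
    rnorm (u (i%:Z - k%:Z) - ent m i k) <= D * th ^+ k.

Lemma geometric_defect1 : geometric_defect 1 a.
Proof.
exists 0; first by rewrite lexx ltr01.
move=> Q; exists 0 => // i k _ _; by rewrite ent1 subrr rnorm0 mul0r.
Qed.

Lemma forward_bound B r m u : 1 <= B -> (forall q, N (shiftX q) <= B * N q) ->
  power_radius shiftX r -> geometric_defect m u -> fej_bounded u (bet m) r.
Proof.
move=> B1 sB [r0 rg rl] [th /andP[th0 th1] hth] Q z Q0 zr.
have [D D0 hD] := hth Q.
apply: (@circle_forward _ K N K0 N_ge0 ND NZ N_gt0 N_rotp shiftX B _ B1 sB _ r r0 rg rl
  u (fun i k => u (i%:Z - k%:Z) - ent m i k) (ent m) (bet m) Q (bet0 m) _ _ D th D0 th0 th1 hD) => //.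
- by move=> c p q; rewrite mulrDr scalerAr.
- move=> w w1; exists w => // q; apply/polyP => i.
  rewrite coef_rotp coefZ !coefXM coef_rotp; case: i => [|i] /=; first by rewrite !mulr0.
  by rewrite exprS mulrA.
- by move=> q; exact: fejer_power.
- by move=> i k; rewrite opprB addrC subrK.
Qed.

Lemma backward_bound B r m u : 1 <= B -> (forall q, N (shiftD q) <= B * N q) ->
  0 < r -> power_radius shiftD r^-1 -> geometric_defect m u -> fej_bounded u (bet m) r.
Proof.
move=> B1 sB r0 [r0' rg rl] [th /andP[th0 th1] hth] Q z Q0 zr.
have [D D0 hD] := hth Q.
have z0 : z != 0 by rewrite -rnorm_gt0 zr.
have zV0 : z^-1 != 0 by rewrite invr_eq0.
have : rnorm (fej Q (fun d => u (- d))).[z^-1] <= bet m * r^-1 ^+ Q.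
  apply: (@circle_backward _ K N K0 N_ge0 ND NZ N_gt0 N_rotp shiftD B _ B1 sB _ r^-1 r0' rg rl
    u (fun i k => u (i%:Z - k%:Z) - ent m i k) (ent m) (bet m) Q (bet0 m) _ _ D th D0 th0 th1 hD) => //.
  - by move=> c p q; apply/polyP => i; rewrite !(coefD, coefZ, coef_drop_poly).
  - move=> w w1; exists w^-1; first by rewrite rnormV w1 invr1.
    have w0 : w != 0 by rewrite -rnorm_gt0 w1 ltr01.
    move=> q; apply/polyP => i; rewrite coef_rotp coefZ !coef_drop_poly coef_rotp.
    by rewrite addn1 exprS !mulrA mulfV// mul1r.
  - by move=> q; exact: fejer_power.
  - by move=> i k; rewrite opprB addrC subrK.
  - by rewrite rnormV zr.
have rQ : 0 < r ^+ Q by rewrite exprn_gt0.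
rewrite fej_rev// invrK rnormM rnormX rnormV zr !exprVn -addnn exprD.
rewrite ler_pdivrMl ?mulr_gt0// => /le_trans; apply.
by apply: eq_ler; field; rewrite gt_eqF.
Qed.

Variable c : nat -> int -> C.
Hypothesis c_lim : forall m d, ccvg (fun M => pow_coef a m M d) (c m d).

Definition all_powers_bounded r := fej_bounded a (bet 1) r /\ forall m, fej_bounded (c m) (bet m) r.

Let b := 1 + bet 1.
Let b1 : 1 <= b. Proof. by rewrite lerDl. Qed.

Let weaken r : 0 < r -> fej_bounded a (bet 1) r -> fej_bounded a b r.
Proof.
move=> r0 h Q z Q0 zr; rewrite (le_trans (h Q z Q0 zr))// ler_wpM2r ?exprn_ge0 ?(ltW r0)//.
by rewrite /b lerDr.
Qed.

Lemma two_circles_defect r1 r m : 0 < r1 -> r1 < r -> fej_bounded a (bet 1) r1 ->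
  fej_bounded a (bet 1) r -> geometric_defect m (c m).
Proof.
move=> r10 r1r h1 h2; have r0 := lt_trans r10 r1r.
exists (r1 / r); first by rewrite divr_ge0 ?(ltW r10) ?(ltW r0)//= ltr_pdivrMr// mul1r.
by move=> Q; apply: (defect_geometric r0 b1 (weaken r0 h2) c_lim ent_lim m Q r10 r1r (weaken r10 h1)).
Qed.

Lemma ccvg_eq0 (u : nat -> C) l : (forall M, u M = 0) -> ccvg u l -> l = 0.
Proof.
move=> u0 h; apply/eqP; rewrite -rnorm_eq0 eq_le rnorm_ge0 andbT.
apply/ler_addgt0Pr => e /h[M0 /(_ M0 (leqnn _))]; rewrite u0 sub0r rnormN add0r//.
Qed.

(** In the absence of negative coefficients the maximum principle provides a
    smaller circle, as [two_circles_defect] requires. *)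
Lemma analytic_case B r rp : 1 <= B -> (forall q, N (shiftX q) <= B * N q) ->
  power_radius shiftX rp -> (forall n, a (Negz n) = 0) -> 0 < r -> r <= rp ->
  all_powers_bounded r.
Proof.
move=> B1 sB Rp a0 r0 rrp; have rp0 := radius_gt0 Rp.
have h1 : fej_bounded a (bet 1) rp := forward_bound B1 sB Rp geometric_defect1.
have rp2 : 0 < rp / 2 by rewrite divr_gt0.
have rp2' : rp / 2 < rp by rewrite ltr_pdivrMr// ltr_pMr// ltrDl.
have h2 : fej_bounded a (bet 1) (rp / 2) by exact: fej_bounded_disc (ltW rp2') a0 h1.
have hc m : fej_bounded (c m) (bet m) rp.
  exact: forward_bound B1 sB Rp (two_circles_defect m rp2 rp2' h2 h1).
split; first exact: fej_bounded_disc rrp a0 h1.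
move=> m; apply: fej_bounded_disc rrp _ (hc m) => // n.
apply: ccvg_eq0 (c_lim m (Negz n)) => M; rewrite /pow_coef.
have -> : fej M a = 'X^M * drop_poly M (fej M a).
  rewrite -[LHS](poly_take_drop M) (_ : take_poly M _ = 0) ?add0r 1?mulrC//.
  apply/polyP => i; rewrite coef_take_poly coef0; case: ltnP => // iM.
  rewrite coef_poly; case: ifP => // _.
  have -> : i%:Z - M%:Z = Negz (M - i).-1 by lia.
  by rewrite a0 mulr0.
have -> P : lcoef (m * M) (('X^M * P) ^+ m) (Negz n) = lcoef 0 (P ^+ m) (Negz n).
  by rewrite exprMn -exprM [(M * m)%N]mulnC -{1}[(m * M)%N]addn0 lcoefMXn.
by apply: lcoef_neg.
Qed.

Lemma coanalytic_case B r rm : 1 <= B -> (forall q, N (shiftD q) <= B * N q) ->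
  0 < rm -> power_radius shiftD rm^-1 -> (forall n, a (Posz n.+1) = 0) -> rm <= r ->
  all_powers_bounded r.
Proof.
move=> B1 sB rm0 Rm a0 rrm.
have h1 : fej_bounded a (bet 1) rm := backward_bound B1 sB rm0 Rm geometric_defect1.
have rm2 : rm < rm * 2 by rewrite ltr_pMr// ltrDl.
have h2 : fej_bounded a (bet 1) (rm * 2) by exact: fej_bounded_exterior (ltW rm2) a0 h1.
have hc m : fej_bounded (c m) (bet m) rm.
  exact: backward_bound B1 sB rm0 Rm (two_circles_defect m rm0 rm2 h1 h2).
split; first exact: fej_bounded_exterior rrm a0 h1.
move=> m; apply: fej_bounded_exterior rrm _ (hc m) => // n.
apply: ccvg_eq0 (c_lim m (Posz n.+1)) => M; rewrite /pow_coef /lcoef.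
rewrite -PoszD nth_default//.
have sM : (size (fej M a) <= M.+1)%N.
  apply/leq_sizeP => i iQ; rewrite coef_poly; case: ifP => // _.
  have -> : i%:Z - M%:Z = Posz (i - M).-1.+1 by lia.
  by rewrite a0 mulr0.
rewrite (leq_trans (size_poly_exp_leq _ _))// addSn ltnS (leq_trans _ (leq_addl _ _))//.
by rewrite mulnC leq_mul2l -subn1 leq_subLR add1n sM orbT.
Qed.

(** Two distinct critical circles make the defects geometric, and the maximum
    principle fills the annulus; if they coincide, [circle_degenerate]
    applies. *)
Lemma bilateral_case B r rm rp : 1 <= B -> (forall q, N (shiftX q) <= B * N q) ->
  (forall q, N (shiftD q) <= B * N q) ->
  0 < rm -> power_radius shiftX rp -> power_radius shiftD rm^-1 -> rm <= r -> r <= rp ->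
  all_powers_bounded r.
Proof.
move=> B1 sB sB' rm0 Rp Rm rmr rrp; have rp0 := radius_gt0 Rp.
have hp : fej_bounded a (bet 1) rp := forward_bound B1 sB Rp geometric_defect1.
have hm : fej_bounded a (bet 1) rm := backward_bound B1 sB' rm0 Rm geometric_defect1.
split; first exact: (fej_bounded_annulus (bet0 1) rm0 rmr rrp hm hp).
move=> m; have := le_trans rmr rrp; rewrite le_eqVlt => /orP[/eqP rE|rmrp].
  have re : r = rp by apply/eqP; rewrite eq_le rrp -rE rmr.
  move=> Q z Q0 zr.
  apply: (@circle_degenerate _ K N B r K0 N_ge0 ND NZ N_gt0 N_rotp B1 sB _ _ _
    (c m) (fun i k => c m (i%:Z - k%:Z) - ent m i k) (ent m) (bet m) Q (bet0 m)) => //.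
  - by rewrite re.
  - move=> t t1; have [c1 hc1] := radius_lim Rp t1; exists c1 => l q.
    rewrite -iter_shiftX re (le_trans (opN_iterP _ B1 sB _ _))//.
      by move=> x p; rewrite scalerAr.
    by rewrite ler_wpM2r.
  - move=> t t1; have [c1 hc1] := radius_lim Rm t1; exists c1 => l q.
    rewrite -iter_shiftD re -rE (le_trans (opN_iterP _ B1 sB' _ _))//.
      by move=> x p; exact: drop_polyZ.
    by rewrite ler_wpM2r.
  - by move=> q; exact: fejer_power.
  - by move=> i k; rewrite opprB addrC subrK.
  - by move=> e e0; rewrite re in z zr *; exact: (defect_vanish rp0 b1 (weaken rp0 hp) c_lim ent_lim m Q e0).
have gd := two_circles_defect m rm0 rmrp hm hp.
apply: (fej_bounded_annulus (bet0 m) rm0 rmr rrp).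
  exact: backward_bound B1 sB' rm0 Rm gd.
exact: forward_bound B1 sB Rp gd.
Qed.

End Powers.

End CirclesOfBoundedness.

(** * Integrals over the circle *)

Section CircleIntegrals.
Variable R : realType.
Local Notation C := R[i].
Local Notation mu := (@lebesgue_measure R).
Local Notation I := (`[0%R, (2 * pi)%R]%classic : set R).
Local Notation Re := (@complex.Re R).
Local Notation Im := (@complex.Im R).

Lemma complexReD (x y : C) : Re (x + y) = Re x + Re y. Proof. by case: x y => [? ?] [? ?]. Qed.
Lemma complexImD (x y : C) : Im (x + y) = Im x + Im y. Proof. by case: x y => [? ?] [? ?]. Qed.
Lemma complexReM (x y : C) : Re (x * y) = Re x * Re y - Im x * Im y. Proof. by case: x y => [? ?] [? ?]. Qed.
Lemma complexImM (x y : C) : Im (x * y) = Re x * Im y + Im x * Re y. Proof. by case: x y => [? ?] [? ?]. Qed.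

Lemma cisD (s t : R) : cis (s + t) = cis s * cis t.
Proof.
apply/eqP; rewrite eq_complex /cis complexReM complexImM /= cosD sinD.
by apply/andP; split; apply/eqP => //; rewrite addrC.
Qed.

Lemma cis0 : cis (0 : R) = 1.
Proof. by rewrite /cis cos0 sin0. Qed.

Lemma rnorm_cis (t : R) : rnorm (cis t : C) = 1.
Proof.
apply/eqP; rewrite -[_ == _](@eqrXn2 _ 2%N) ?rnorm_ge0//.
by rewrite rnorm_sqr /= cos2Dsin2 expr1n.
Qed.

Lemma cis_neq0 (t : R) : cis t != 0.
Proof. by rewrite -rnorm_gt0 rnorm_cis. Qed.

Lemma cisN (t : R) : cis (- t) = (cis t)^-1.
Proof. by apply: (mulfI (cis_neq0 t)); rewrite -cisD subrr cis0 mulfV// cis_neq0. Qed.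

Lemma cisX (t : R) n : cis t ^+ n = cis (n%:R * t).
Proof.
elim: n => [|n ih]; first by rewrite mul0r cis0.
by rewrite exprS ih -cisD -natr1 mulrDl mul1r addrC.
Qed.

Lemma cis_expz (t : R) (d : int) : cis t ^ d = cis (d%:~R * t).
Proof.
case: d => n; first exact: cisX.
by rewrite NegzE -exprnN cisX -cisN mulrNz mulNr.
Qed.

Lemma cis2pi : cis (2 * pi : R) = 1.
Proof. by rewrite /cis mulr_natl cos2pi sin2pi. Qed.

Let pi2 : 0 < 2 * pi :> R.
Proof. by rewrite mulr_gt0// pi_gt0. Qed.

Definition ccont (g : R -> C) :=
  continuous (fun t => Re (g t)) /\ continuous (fun t => Im (g t)).

Lemma ccont_cst c : ccont (fun=> c).
Proof. by split => t; exact: cst_continuous. Qed.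

Lemma ccontD f g : ccont f -> ccont g -> ccont (fun t => f t + g t).
Proof.
move=> [f1 f2] [g1 g2]; split => t.
  have -> : (fun t => Re (f t + g t)) = (fun t => Re (f t) + Re (g t)).
    by apply/funext => s; rewrite complexReD.
  by apply: cvgD; [exact: f1|exact: g1].
have -> : (fun t => Im (f t + g t)) = (fun t => Im (f t) + Im (g t)).
  by apply/funext => s; rewrite complexImD.
by apply: cvgD; [exact: f2|exact: g2].
Qed.

Lemma ccontM f g : ccont f -> ccont g -> ccont (fun t => f t * g t).
Proof.
move=> [f1 f2] [g1 g2]; split => t.
  have -> : (fun t => Re (f t * g t)) = (fun t => Re (f t) * Re (g t) - Im (f t) * Im (g t)).
    by apply/funext => s; rewrite complexReM.
  by apply: cvgB; apply: cvgM; [exact: f1|exact: g1|exact: f2|exact: g2].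
have -> : (fun t => Im (f t * g t)) = (fun t => Re (f t) * Im (g t) + Im (f t) * Re (g t)).
  by apply/funext => s; rewrite complexImM.
by apply: cvgD; apply: cvgM; [exact: f1|exact: g2|exact: f2|exact: g1].
Qed.

Lemma ccont_sum n (F : nat -> R -> C) : (forall i, ccont (F i)) ->
  ccont (fun t => \sum_(i < n) F i t).
Proof.
move=> h; elim: n => [|n ih].
  under [X in ccont X]eq_fun do rewrite big_ord0.
  exact: ccont_cst.
under [X in ccont X]eq_fun do rewrite big_ord_recr/=.
exact: ccontD.
Qed.

Lemma continuous_scaled (c : R) (g : R -> R) : continuous g -> continuous (fun t => g (c * t)).
Proof.
move=> cg t; apply: (@continuous_comp _ _ _ (fun t => c * t) g); last exact: cg.
by apply: cvgM; [exact: cst_continuous|exact: cvg_id].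
Qed.

Lemma ccont_expz (d : int) : ccont (fun t => cis t ^ d).
Proof.
under [X in ccont X]eq_fun do rewrite cis_expz.
by split; apply: continuous_scaled; [exact: continuous_cos|exact: continuous_sin].
Qed.

Lemma ccont_poly (p : {poly C}) r : ccont (fun t => p.[r%:C * cis t]).
Proof.
under [X in ccont X]eq_fun do rewrite horner_coef.
apply: (@ccont_sum _ (fun i t => p`_i * (r%:C * cis t) ^+ i)) => i.
apply: ccontM; first exact: ccont_cst.
under [X in ccont X]eq_fun do rewrite exprMn.
by apply: ccontM; [exact: ccont_cst|exact: (ccont_expz i)].
Qed.

Lemma ccont_sqr g : ccont g -> continuous (fun t => rnorm (g t) ^+ 2).
Proof.
move=> [g1 g2] t.
have -> : (fun t => rnorm (g t) ^+ 2) = (fun t => Re (g t) ^+ 2 + Im (g t) ^+ 2).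
  by apply/funext => s; rewrite rnorm_sqr.
by apply: cvgD; apply: cvgM; by [apply: g1|apply: g2].
Qed.

Lemma cont_integrable (f : R -> R) : continuous f -> mu.-integrable I (EFin \o f).
Proof.
move=> cf; apply: continuous_compact_integrable; first exact: segment_compact.
exact: continuous_subspaceT.
Qed.

Definition cint (g : R -> C) : C := cintegral I g.

Lemma eq_cint f g : f =1 g -> cint f = cint g.
Proof. by move=> fg; congr (cint _); apply/funext. Qed.

Lemma cintD f g : ccont f -> ccont g -> cint (fun t => f t + g t) = cint f + cint g.
Proof.
move=> [f1 f2] [g1 g2]; rewrite /cint /cintegral; apply/eqP; rewrite eq_complex.
rewrite complexReD complexImD /=; apply/andP; split; apply/eqP; rewrite -RintegralD ?cont_integrable//.
  by apply: eq_Rintegral => t _; rewrite complexReD.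
by apply: eq_Rintegral => t _; rewrite complexImD.
Qed.

Lemma cintZ c f : ccont f -> cint (fun t => c * f t) = c * cint f.
Proof.
move=> [f1 f2]; rewrite /cint /cintegral; apply/eqP; rewrite eq_complex.
have ZR (x : R) (h : R -> R) : continuous h -> continuous (fun t => x * h t).
  by move=> ch t; apply: cvgM; [exact: cst_continuous|exact: ch].
rewrite complexReM complexImM /=; apply/andP; split; apply/eqP.
  rewrite -!RintegralZl ?cont_integrable// -RintegralB ?cont_integrable//; try exact: ZR.
  by apply: eq_Rintegral => t _; rewrite complexReM.
rewrite -!RintegralZl ?cont_integrable// -RintegralD ?cont_integrable//; try exact: ZR.
by apply: eq_Rintegral => t _; rewrite complexImM.
Qed.

Lemma cint0 : cint (fun=> 0) = 0.
Proof.
by rewrite /cint /cintegral !Rintegral_cst// !mul0r.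
Qed.

Lemma cint_sum n (F : nat -> R -> C) : (forall i, ccont (F i)) ->
  cint (fun t => \sum_(i < n) F i t) = \sum_(i < n) cint (F i).
Proof.
move=> h; elim: n => [|n ih].
  by rewrite big_ord0 -[RHS]cint0; apply: eq_cint => t; rewrite big_ord0.
rewrite big_ord_recr /= -ih -(cintD (ccont_sum n h) (h n)).
by apply: eq_cint => t; rewrite big_ord_recr.
Qed.

Lemma FTC_circle (f F : R -> R) : continuous f -> (forall x, is_derive x (1:R) F (f x)) ->
  \int[mu]_(t in I) f t = F (2 * pi) - F 0.
Proof.
move=> cf hF.
have cF : continuous F.
  by move=> x; apply/differentiable_continuous/derivable1_diffP; case: (hF x).
rewrite /Rintegral (@continuous_FTC2 _ f F) //.
- exact: continuous_subspaceT.
- split.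
  + by move=> x _; case: (hF x).
  + by apply: cvg_at_right_filter; exact: cF.
  + by apply: cvg_at_left_filter; exact: cF.
- by move=> x _; rewrite derive1E; case: (hF x).
Qed.

Lemma cint_expz (d : int) : cint (fun t => cis t ^ d) = (2 * pi * (d == 0)%:R)%:C.
Proof.
have [->|d0] := eqVneq d 0.
  rewrite (@eq_cint _ (fun=> 1))// /cint /cintegral !Rintegral_cst//=.
  by rewrite lebesgue_measure_itv /= lte_fin pi2 /= subr0 mul0r mul1r mulr1.
pose c : R := d%:~R; have c0 : c != 0 by rewrite intr_eq0.
rewrite (@eq_cint _ (fun t => cis (c * t))); last by move=> t; rewrite cis_expz.
have := cis_expz (2 * pi) d; rewrite cis2pi exp1rz -/c => /esym/eqP.
rewrite /cis eq_complex /= => /andP[/eqP e1 /eqP e2].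
have der1 x : is_derive x (1 : R) (fun t : R => c^-1 * sin (c * t)) (cos (c * x)).
  by apply: is_derive_eq; rewrite /GRing.scale /= mulr1 mulrC mulfK.
have der2 x : is_derive x (1 : R) (fun t : R => - c^-1 * cos (c * t)) (sin (c * x)).
  apply: is_derive_eq; rewrite /GRing.scale /= mulr1 mulrA mulrNN.
  by rewrite mulrAC mulVf// mul1r.
have := FTC_circle (continuous_scaled (c := c) (@continuous_cos R)) der1.
have := FTC_circle (continuous_scaled (c := c) (@continuous_sin R)) der2.
rewrite /cint /cintegral /= => -> ->.
by rewrite mulr0 sin0 cos0 e1 e2 !subrr mulr0.
Qed.

End CircleIntegrals.

(** * Mean squares of Laurent polynomials *)

Section LaurentPolynomials.
Variable R : realType.
Local Notation C := R[i].
Local Notation mu := (@lebesgue_measure R).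
Local Notation I := (`[0%R, (2 * pi)%R]%classic : set R).

Definition circle_laurent (r : R) M (p : {poly C}) (t : R) : C :=
  (r%:C * cis t) ^- M * p.[r%:C * cis t].

Definition mean_sqr (g : R -> C) : R := \int[mu]_(t in I) (rnorm (g t) ^+ 2).

Variable r : R.
Hypothesis r0 : 0 < r.

Let rC0 : (r%:C : C) != 0.
Proof. by rewrite -rnorm_gt0 rnorm_real gtr0_norm. Qed.

Lemma rnorm_rcis (t : R) : rnorm (r%:C * cis t) = r.
Proof. by rewrite rnormM rnorm_cis mulr1 rnorm_real gtr0_norm. Qed.

Lemma circle_laurentE M p t : circle_laurent r M p t = r%:C ^- M * cis t ^ (- M%:Z) * p.[r%:C * cis t].
Proof. by rewrite /circle_laurent exprMn invfM [cis t ^- M]exprnN. Qed.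

Lemma ccont_circle_laurent M p : ccont (circle_laurent r M p).
Proof.
have -> : circle_laurent r M p =
    fun t => r%:C ^- M * cis t ^ (- M%:Z) * p.[r%:C * cis t].
  by apply/funext => t; exact: circle_laurentE.
apply: ccontM; last exact: ccont_poly.
by apply: ccontM; [exact: ccont_cst|exact: ccont_expz].
Qed.

Lemma rnorm_circle_laurent M p t :
  rnorm (circle_laurent r M p t) = r ^- M * rnorm p.[r%:C * cis t].
Proof. by rewrite /circle_laurent rnormM rnormV rnormX rnorm_rcis. Qed.

Lemma fourier_circle_laurent M p (n : int) :
  cint (fun t => circle_laurent r M p t * cis t ^ (- n)) = (2 * pi)%:C * (lcoef M p n * r%:C ^ n).
Proof.
pose F i t := (r%:C ^- M * (p`_i * r%:C ^+ i)) * cis t ^ (i%:Z - M%:Z - n) : C.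
rewrite (@eq_cint _ _ (fun t => \sum_(i < size p) F i t)); last first.
  move=> t; rewrite circle_laurentE horner_coef mulr_sumr mulr_suml; apply: eq_bigr => i _.
  rewrite /F exprMn !expfzDr ?cis_neq0// -exprnP.
  by set u := cis t ^ (- M%:Z); set v := cis t ^ (- n); ring.
have cF i : ccont (F i) by apply: ccontM; [exact: ccont_cst|exact: ccont_expz].
have cE i : cint (F i) = r%:C ^- M * (p`_i * r%:C ^+ i) * (2 * pi * (i%:Z - M%:Z - n == 0)%:R)%:C.
  by rewrite -cint_expz -cintZ//; exact: ccont_expz.
rewrite cint_sum//; under eq_bigr => i _ do rewrite cE.
rewrite /lcoef; case E : (n + M%:Z) => [l|l]; last first.
  rewrite mul0r mulr0 big1 // => i _.
  have -> : (i%:Z - M%:Z - n == 0) = false by apply/negP => /eqP; lia.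
  by rewrite mulr0 mulr0.
have e (i : nat) : (i%:Z - M%:Z - n == 0) = (i == l) by apply/eqP/eqP; lia.
under eq_bigr => i _ do rewrite e.
have rl : (r%:C : C) ^ n = r%:C ^- M * r%:C ^+ l.
  have -> : n = - M%:Z + l%:Z by lia.
  by rewrite expfzDr// -exprnN.
have [ls|sl] := ltnP l (size p); last first.
  rewrite nth_default// mul0r mulr0 big1 // => i _.
  by rewrite ltn_eqF ?mulr0 ?mulr0// (leq_trans (ltn_ord i)).
rewrite (bigD1 (Ordinal ls))//= eqxx mulr1 big1 ?addr0 => [|i].
  by rewrite rl; ring.
by rewrite -val_eqE /= => /negPf ->; rewrite !mulr0.
Qed.

Lemma mean_sqr_poly (p : {poly C}) :
  mean_sqr (fun t => p.[r%:C * cis t]) = 2 * pi * l2 r p.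
Proof.
pose F i t := (p`_i * r%:C ^+ i) * cis t ^ i%:Z : C.
pose F' i t := ((p`_i)^*%C * r%:C ^+ i) * cis t ^ (- i%:Z) : C.
have FE t : p.[r%:C * cis t] = \sum_(i < size p) F i t.
  by rewrite horner_coef; apply: eq_bigr => i _; rewrite /F exprMn mulrA.
have conjcis (t : R) : (cis t)^*%C = (cis t)^-1.
  by rewrite -cisN /cis /= cosN sinN.
have FE' t : (p.[r%:C * cis t])^*%C = \sum_(i < size p) F' i t.
  rewrite horner_coef rmorph_sum; apply: eq_bigr => i _.
  have conjX (u : C) k : ((u ^+ k)^*)%C = (u^*)%C ^+ k by exact: (rmorphXn (@conjc R)).
  have conjM (u v : C) : ((u * v)^*)%C = (u^*)%C * (v^*)%C by exact: (rmorphM (@conjc R)).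
  rewrite /F' /= conjM conjX conjM exprMn conjcis conjc_real.
  by rewrite exprVn exprnN mulrA.
have cF i : ccont (F i) by apply: ccontM; [exact: ccont_cst|exact: ccont_expz].
have cF' i : ccont (F' i) by apply: ccontM; [exact: ccont_cst|exact: ccont_expz].
have : cint (fun t => \sum_(i < size p) \sum_(k < size p) F i t * F' k t) =
    (2 * pi * l2 r p)%:C.
  rewrite (@cint_sum _ _ (fun i t => \sum_(k < size p) F i t * F' k t)); last first.
    by move=> i; apply: (@ccont_sum _ _ (fun k t => F i t * F' k t)) => k; exact: ccontM.
  rewrite /l2 mulr_sumr rmorph_sum; apply: eq_bigr => i _.
  rewrite (@cint_sum _ _ (fun k t => F i t * F' k t)); last by move=> k; exact: ccontM.
  have e (k : nat) : cint (fun t => F i t * F' k t) =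
      (p`_i * r%:C ^+ i) * ((p`_k)^*%C * r%:C ^+ k) * (2 * pi * (i%:Z - k%:Z == 0)%:R)%:C.
    rewrite -cint_expz -cintZ; last exact: ccont_expz.
    by apply: eq_cint => t; rewrite /F /F' expfzDr ?cis_neq0//; ring.
  under eq_bigr => k _ do rewrite e.
  rewrite (bigD1 i)//= subrr eqxx mulr1 big1 ?addr0 => [|k ki].
    have -> : p`_i * r%:C ^+ i * ((p`_i)^*%C * r%:C ^+ i) =
        (p`_i * (p`_i)^*%C) * ((r ^+ (2 * i))%:C).
      by rewrite mulnC exprM rmorphXn rmorphXn /=; ring.
    by rewrite -rnorm_sqrE -!rmorphM /=; congr (_%:C); ring.
  have -> : (i%:Z - k%:Z == 0) = false.
    by apply/negP; rewrite subr_eq0 => /eqP[/val_inj E]; rewrite E eqxx in ki.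
  by rewrite !mulr0.
rewrite /cint /cintegral => /(congr1 (@complex.Re R)) /= <-.
rewrite /mean_sqr; apply: eq_Rintegral => t _.
rewrite (_ : \sum_(i < _) _ = p.[r%:C * cis t] * (p.[r%:C * cis t])^*%C).
  by rewrite -rnorm_sqrE.
rewrite FE' {1}FE mulr_suml; apply: eq_bigr => i _.
by rewrite mulr_sumr.
Qed.

Lemma mean_sqr_laurent M p : mean_sqr (circle_laurent r M p) = r ^- (2 * M) * (2 * pi * l2 r p).
Proof.
rewrite -mean_sqr_poly /mean_sqr -RintegralZl//; last first.
  by apply: cont_integrable; apply: ccont_sqr; exact: ccont_poly.
apply: eq_Rintegral => t _.
by rewrite rnorm_circle_laurent exprMn mulnC exprM exprVn.
Qed.

Lemma circle_laurentX M p m t :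
  circle_laurent r M p t ^+ m = circle_laurent r (m * M) (p ^+ m) t.
Proof. by rewrite /circle_laurent exprMn exprVn -exprM mulnC horner_exp. Qed.

Lemma circle_laurentB M M0 p q t : (M0 <= M)%N ->
  circle_laurent r M p t - circle_laurent r M0 q t =
  circle_laurent r M (p - 'X^(M - M0) * q) t.
Proof.
move=> h; rewrite /circle_laurent hornerD hornerN hornerM hornerXn mulrBr; congr (_ - _).
have z0 : r%:C * cis t != 0 by rewrite mulf_neq0 ?cis_neq0.
set z := _ * cis t in z0 *.
have -> : z ^- M = z ^- (M - M0) * z ^- M0 by rewrite -invfM -exprD subnK.
by rewrite mulrACA mulVf ?mul1r// expf_neq0.
Qed.

End LaurentPolynomials.

(** * Almost everywhere limits and the boundary function *)

Section AlmostEverywhereLimits.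
Variable R : realType.
Local Notation C := R[i].
Local Notation mu := (@lebesgue_measure R).
Local Notation I := (`[0%R, (2 * pi)%R]%classic : set R).

Lemma measurable_circle : measurable (I : set (measurableTypeR R)).
Proof. exact: measurable_itv. Qed.

Let mI := measurable_circle.

Lemma circle_finite : (mu I < +oo)%E.
Proof. by rewrite lebesgue_measure_itv /=; case: ifP => _; rewrite ?ltry// -EFinD ltry. Qed.

Lemma ae_imp (P Q : R -> Prop) : (forall t, P t -> Q t) ->
  {ae mu, forall t, P t} -> {ae mu, forall t, Q t}.
Proof. by move=> PQ [N [mN N0 PN]]; exists N; split => // t /= nQ; apply: PN => /PQ. Qed.

Lemma cont_measurable (f : R -> R) : continuous f -> measurable_fun I f.
Proof.
by move=> /cont_integrable /measurable_int /measurable_EFinP.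
Qed.

Lemma bounded_integrable (f : R -> R) (B : R) : measurable_fun I f ->
  (forall t, I t -> `|f t| <= B) -> mu.-integrable I (EFin \o f).
Proof.
move=> mf fB; apply: measurable_bounded_integrable => //; rewrite ?circle_finite//.
by exists B; split; [exact: num_real|move=> x Bx t It; exact: le_trans (fB t It) (ltW Bx)].
Qed.

Lemma Rintegral_dominated (f : nat -> R -> R) (g : R -> R) (B : R) : (forall k, measurable_fun I (f k)) ->
  measurable_fun I g -> (forall k t, I t -> `|f k t| <= B) ->
  {ae mu, forall t, I t -> f ^~ t @ \oo --> g t} ->
  mu.-integrable I (EFin \o g) /\
  (fun k => \int[mu]_(t in I) f k t) @ \oo --> \int[mu]_(t in I) g t.
Proof.
move=> mf mg fB fg.
have iB : mu.-integrable I (EFin \o cst B).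
  by apply: (@bounded_integrable _ `|B|) => //; exact: measurable_cst.
have fg' : {ae mu, forall t, I t -> (fun k => (f k t)%:E) @ \oo --> (g t)%:E}.
  by apply: ae_imp fg => t ht It; apply: cvg_EFin; [exact: nearW|exact: ht].
have mf' k : measurable_fun I (EFin \o f k) by exact/measurable_EFinP.
have mg' : measurable_fun I (EFin \o g) by exact/measurable_EFinP.
have [ig _ h] := dominated_convergence measurable_circle mf' mg' fg' iB
  (aeW mu (fun t k It => fB k t It)).
by split=> //; apply: fine_cvg; rewrite fineK ?integrable_fin_num.
Qed.

Lemma ccvgRe (u : nat -> C) l : ccvg u l -> (fun k => complex.Re (u k)) @ \oo --> complex.Re l.
Proof.
move=> h; apply/cvgrPdist_le => e e0; have [k0 hk] := h _ e0.
near=> k; have /hk : (k0 <= k)%N by near: k; exists k0.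
apply: le_trans; rewrite distrC.
by have := Re_le_rnorm (u k - l); case: (u k) => [? ?]; case: (l).
Unshelve. all: by end_near. Qed.

Lemma ccvgIm (u : nat -> C) l : ccvg u l -> (fun k => complex.Im (u k)) @ \oo --> complex.Im l.
Proof.
move=> h; apply/cvgrPdist_le => e e0; have [k0 hk] := h _ e0.
near=> k; have /hk : (k0 <= k)%N by near: k; exists k0.
apply: le_trans; rewrite distrC.
by have := Im_le_rnorm (u k - l); case: (u k) => [? ?]; case: (l).
Unshelve. all: by end_near. Qed.

Lemma half_powers_sum n : \sum_(i < n) 2^-1 ^+ i <= 2 :> R.
Proof.
have h0 : 0 <= 2^-1 :> R by rewrite invr_ge0.
have h1 : 2^-1 < 1 :> R by rewrite invf_lt1// ltr1n.
have := geom_tail 0 n h0 h1; rewrite expr0 => /le_trans; apply.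
by rewrite ler_pdivrMr; lra.
Qed.

(** Along a subsequence the mean squares of the increments are at most 4 * 4^-k.
    The sum of 2^k |increment|^2 is then integrable, hence finite almost
    everywhere, and |x| <= 2^-k + 2^k |x|^2 makes the increments summable. *)
Lemma mean_sqr_cauchy_ae (G : nat -> R -> C) : (forall k, ccont (G k)) ->
  (forall e, 0 < e -> exists M0, forall M, (M0 <= M)%N ->
    mean_sqr (fun t => G M t - G M0 t) <= e) ->
  exists phi : nat -> nat, (forall k, (k <= phi k)%N) /\
    {ae mu, forall t, I t -> exists l, ccvg (fun k => G (phi k) t) l}.
Proof.
move=> cG hG.
have pe k : 0 < 4^-1 ^+ k :> R by rewrite exprn_gt0// invr_gt0.
have /choice[psi hpsi] : forall k, exists M0, forall M, (M0 <= M)%N ->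
    mean_sqr (fun t => G M t - G M0 t) <= 4^-1 ^+ k by move=> k; exact: hG.
(* [phi k] and [phi k.+1] are both beyond [psi k] *)
pose phi k := (\sum_(i < k.+1) psi i + k)%N.
have phi_psi k : (psi k <= phi k)%N by rewrite /phi big_ord_recr /= -addnA addnCA leq_addr.
have phi_S k : (psi k <= phi k.+1)%N.
  by rewrite /phi 2!big_ord_recr /= -!addnA addnCA leq_addr.
exists phi; split; first by move=> k; rewrite leq_addl.
have cB M M0 : ccont (fun t => G M t - G M0 t).
  have -> : (fun t => G M t - G M0 t) = (fun t => G M t + (-1) * G M0 t).
    by apply/funext => t; rewrite mulN1r.
  by apply: ccontD => //; apply: ccontM => //; exact: ccont_cst.
have cB2 M M0 : mu.-integrable I (EFin \o (fun t => rnorm (G M t - G M0 t) ^+ 2)).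
  by apply: cont_integrable; apply: ccont_sqr.
pose h k t := 2 ^+ k * rnorm (G (phi k.+1) t - G (phi k) t) ^+ 2.
have h0 k t : 0 <= h k t by apply: mulr_ge0; rewrite ?sqr_ge0 ?exprn_ge0.
have ih k : mu.-integrable I (EFin \o h k).
  apply: cont_integrable => t; apply: cvgM; first exact: cst_continuous.
  exact: ccont_sqr.
have hh k : \int[mu]_(t in I) h k t <= 4 * 2^-1 ^+ k.
  rewrite /h RintegralZl//.
  have le4 : \int[mu]_(t in I) (rnorm (G (phi k.+1) t - G (phi k) t) ^+ 2) <= 4 * 4^-1 ^+ k.
    apply: (@le_trans _ _ (\int[mu]_(t in I) (2 * (rnorm (G (phi k.+1) t - G (psi k) t) ^+ 2
      + rnorm (G (phi k) t - G (psi k) t) ^+ 2)))).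
      apply: le_Rintegral => //.
        apply: cont_integrable => t; apply: cvgM; first exact: cst_continuous.
        by apply: cvgD; apply: ccont_sqr.
      move=> t _; have := rnormD3 (G (psi k) t) (G (phi k.+1) t) (G (phi k) t).
      rewrite [rnorm (G (psi k) t - _)]rnorm_distC.
      set x := rnorm (_ - _); set y := rnorm (_ - _); set z := rnorm (_ - _) => xyz.
      have x0 : 0 <= x by exact: rnorm_ge0.
      have yz : 0 <= y + z by rewrite addr_ge0 ?rnorm_ge0.
      apply: (@le_trans _ _ ((y + z) ^+ 2)); first by rewrite lerXn2r ?nnegrE.
      by rewrite -subr_ge0 (_ : _ - _ = (y - z) ^+ 2) ?sqr_ge0//; ring.
    rewrite RintegralZl//; last first.
      by apply: cont_integrable => t; apply: cvgD; apply: ccont_sqr.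
    rewrite RintegralD//.
    have := hpsi k _ (phi_S k); have := hpsi k _ (phi_psi k); rewrite /mean_sqr.
    by set x := _ ^+ k; lra.
  have p2 : 0 <= 2 ^+ k :> R by rewrite exprn_ge0.
  rewrite (le_trans (ler_wpM2l p2 le4))// mulrCA ler_pM2l// -exprMn.
  by rewrite (_ : 2 / 4 = 2^-1 :> R)//; field.
pose H t := (\sum_(k <oo) (h k t)%:E)%E.
have mh k : measurable_fun I (fun t => (h k t)%:E).
  exact: measurable_int (ih k).
have H0 t : (0 <= H t)%E by apply: nneseries_ge0 => k _ _; rewrite lee_fin.
have iH : mu.-integrable I H.
  apply/integrableP; split.
    apply: (@ge0_emeasurable_sum _ _ _ _ (fun k t => (h k t)%:E) xpredT) => [k t _ _|k _].
      by rewrite lee_fin.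
    exact: mh.
  rewrite (@eq_integral _ _ _ mu I H); last by move=> t _; rewrite gee0_abs.
  rewrite integral_nneseries//; last by move=> k t _; rewrite lee_fin.
  apply: (@le_lt_trans _ _ 8%:E); last exact: ltry.
  apply: lime_le.
    by apply: is_cvg_nneseries => k _ _; apply: integral_ge0 => t _; rewrite lee_fin.
  apply: nearW => n.
  apply: (@le_trans _ _ (\sum_(0 <= k < n) (4 * 2^-1 ^+ k)%:E)%E).
    apply: lee_sum => k _; rewrite -[leLHS]fineK; last first.
      by apply: integrable_fin_num => //; exact: ih.
    by rewrite lee_fin; exact: hh.
  rewrite sumEFin lee_fin big_mkord -mulr_sumr.
  by have := half_powers_sum n; lra.
apply: ae_imp (integrable_ae measurable_circle iH) => t ht It.
pose x k := G (phi k) t; pose S n := \sum_(k < n) rnorm (x k.+1 - x k).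
have S_le n : S n <= 2 + fine (H t).
  apply: (@le_trans _ _ (\sum_(k < n) (2^-1 ^+ k + h k t))).
    apply: ler_sum => k _; rewrite /h.
    set y := rnorm _; have y0 : 0 <= y by exact: rnorm_ge0.
    have p2 : 0 < 2 ^+ k :> R by rewrite exprn_gt0.
    rewrite exprVn; set p := 2 ^+ k in p2 *.
    have : 0 <= p * (y - p^-1) ^+ 2 by rewrite mulr_ge0 ?sqr_ge0 ?ltW.
    rewrite (_ : p * (y - p^-1) ^+ 2 = p^-1 + p * y ^+ 2 - 2 * y); first by lra.
    by field; rewrite gt_eqF.
  rewrite big_split; apply: lerD; first exact: half_powers_sum.
  rewrite -lee_fin fineK ?ht// -(big_mkord xpredT (fun k => h k t)) -sumEFin.
  by apply: nneseries_lim_ge => k _ _; rewrite lee_fin.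
have xS m n : (m <= n)%N -> rnorm (x n - x m) <= S n - S m.
  move=> mn; rewrite -(subnK mn); elim: (n - m)%N => [|i ih'].
    by rewrite add0n !subrr rnorm0.
  rewrite addSn (le_trans (rnormD3 (x (i + m)%N) _ _))// /S big_ord_recr /=.
  by rewrite addrAC [leRHS]addrC lerD2l.
apply: ccauchy => e e0; have [n hn] := monotone_tail S_le e0.
by exists n => M nM; rewrite (le_trans (xS _ _ nM))// lerBlDl hn.
Qed.

End AlmostEverywhereLimits.

Section BoundaryFunction.
Variable R : realType.
Local Notation C := R[i].
Local Notation mu := (@lebesgue_measure R).
Local Notation I := (`[0%R, (2 * pi)%R]%classic : set R).
Local Notation Re := (@complex.Re R).
Local Notation Im := (@complex.Im R).

Lemma ccvgP (u : nat -> C) l : (fun k => Re (u k)) @ \oo --> Re l ->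
  (fun k => Im (u k)) @ \oo --> Im l -> ccvg u l.
Proof.
move=> /cvgrPdist_le hr /cvgrPdist_le hi e e0.
have e2 : 0 < e / 2 by rewrite divr_gt0.
have [k1 _ h1] := hr _ e2; have [k2 _ h2] := hi _ e2.
exists (maxn k1 k2) => k; rewrite geq_max => /andP[/h1 /= a1 /h2 /= a2].
rewrite (le_trans (rnorm_le_ReIm _))// [e]splitr.
move: a1 a2; rewrite distrC [`|Im l - _|]distrC; case: (u k) => [? ?]; case: (l) => [? ?] /=.
exact: lerD.
Qed.

Lemma ccvg_unique (u : nat -> C) l l' : ccvg u l -> ccvg u l' -> l = l'.
Proof.
move=> h h'; apply/eqP; rewrite -subr_eq0 -rnorm_eq0 eq_le rnorm_ge0 andbT.
apply/ler_addgt0Pr => e e0; rewrite add0r.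
have e2 : 0 < e / 2 by rewrite divr_gt0.
have [k1 h1] := h _ e2; have [k2 h2] := h' _ e2.
rewrite (le_trans (rnormD3 (u (maxn k1 k2)) _ _))// [e]splitr lerD//.
  by rewrite rnorm_distC h1// leq_maxl.
by rewrite h2// leq_maxr.
Qed.

Lemma ccvg_rnorm_le (u : nat -> C) l b : (forall k, rnorm (u k) <= b) -> ccvg u l -> rnorm l <= b.
Proof.
move=> ub h; apply/ler_addgt0Pr => e /h[k0 hk].
rewrite -[l](subrK (u k0)) addrC (le_trans (rnormD _ _))// lerD// rnorm_distC.
exact: hk.
Qed.

Lemma cint_dominated (f : nat -> R -> C) (g : R -> C) (B : R) : (forall k, ccont (f k)) ->
  measurable_fun I (fun t => Re (g t)) -> measurable_fun I (fun t => Im (g t)) ->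
  (forall k t, rnorm (f k t) <= B) -> {ae mu, forall t, I t -> ccvg (f ^~ t) (g t)} ->
  ccvg (fun k => cint (f k)) (cint g).
Proof.
move=> cf mr mi fB fg; apply: ccvgP.
  apply: (proj2 (@Rintegral_dominated _ (fun k t => Re (f k t)) _ B _ _ _ _)) => //.
  - by move=> k; apply: cont_measurable; case: (cf k).
  - by move=> k t _; exact: le_trans (Re_le_rnorm _) (fB k t).
  - by apply: ae_imp fg => t h It; apply: ccvgRe; exact: h.
apply: (proj2 (@Rintegral_dominated _ (fun k t => Im (f k t)) _ B _ _ _ _)) => //.
- by move=> k; apply: cont_measurable; case: (cf k).
- by move=> k t _; exact: le_trans (Im_le_rnorm _) (fB k t).
- by apply: ae_imp fg => t h It; apply: ccvgIm; exact: h.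
Qed.

(** Chebyshev's inequality for all even powers at once; the constant [A]
    disappears as the exponent grows. *)
Lemma ae_le_of_moments (g : R -> C) (tau A : R) : 0 <= tau ->
  measurable_fun I (fun t => Re (g t)) -> measurable_fun I (fun t => Im (g t)) ->
  (forall m, \int[mu]_(t in I) ((rnorm (g t) ^+ 2) ^+ m) <= A * tau ^+ (2 * m)) ->
  (forall m, mu.-integrable I (EFin \o (fun t => (rnorm (g t) ^+ 2) ^+ m))) ->
  {ae mu, forall t, I t -> rnorm (g t) <= tau}.
Proof.
move=> tau0 mr mi hA hi.
have mF : measurable_fun I (fun t => rnorm (g t) ^+ 2).
  have -> : (fun t => rnorm (g t) ^+ 2) = (fun t => Re (g t) ^+ 2 + Im (g t) ^+ 2).
    by apply/funext => t; rewrite rnorm_sqr.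
  by apply: measurable_funD; apply: measurable_funX.
pose S s := I `&` [set t | s <= rnorm (g t)].
have S0 s : tau < s -> mu.-negligible (S s).
  move=> taus; have s0 : 0 < s := le_lt_trans tau0 taus.
  have SE m : S s `<=` I `&` [set t | ((s ^+ (2 * m))%:E <= `|((rnorm (g t) ^+ 2) ^+ m)%:E|)%E].
    move=> t [It /= st]; split => //=; rewrite lee_fin.
    rewrite ger0_norm; last by rewrite exprn_ge0// sqr_ge0.
    by rewrite -exprM lerXn2r ?nnegrE ?rnorm_ge0 ?(ltW s0).
  have mS : measurable (S s).
    have -> : S s = I `&` [set t | ((s ^+ 2)%:E <= (rnorm (g t) ^+ 2)%:E)%E].
      congr (_ `&` _); apply/funext => y; apply/propext; rewrite /= lee_fin.
      by rewrite ler_sqr ?nnegrE ?rnorm_ge0 ?(ltW s0).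
    by apply: emeasurable_fun_c_infty; [exact: measurable_circle|exact/measurable_EFinP].
  have fS : (mu (S s) < +oo)%E.
    apply: le_lt_trans (circle_finite R); apply: le_measure.
    - by rewrite inE.
    - by rewrite inE; exact: measurable_circle.
    - by move=> y [].
  have v0 : 0 <= fine (mu (S s)) by apply: fine_ge0.
  have key n : s ^+ (2 * n) * fine (mu (S s)) <= A * tau ^+ (2 * n).
    apply: le_trans (hA n).
    rewrite -lee_fin EFinM fineK ?ge0_fin_numE// /Rintegral fineK; last first.
      by apply: integrable_fin_num; [exact: measurable_circle|exact: hi].
    have sn : 0 < s ^+ (2 * n) by rewrite exprn_gt0.
    have := @le_integral_comp_abse _ _ _ mu I (@measurable_circle R) (EFin \o (fun t => (rnorm (g t) ^+ 2) ^+ n))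
      (s ^+ (2 * n)) id (@measurable_id _ _ _) (fun r h => h) (fun x y _ _ h => h) (measurable_int mu (hi n)) sn.
    rewrite (@eq_integral _ _ _ mu I (fun y => ((rnorm (g y) ^+ 2) ^+ n)%:E)); last first.
      by move=> y _; rewrite /= ger0_norm// exprn_ge0// sqr_ge0.
    apply: le_trans; rewrite lee_pmul2l ?lte_fin//.
    apply: le_measure; [by rewrite inE| |exact: SE].
    rewrite inE; apply: emeasurable_fun_c_infty; first exact: measurable_circle.
    by apply: measurableT_comp => //; exact: measurable_int (hi n).
  exists (S s); split => //.
  rewrite -[mu _]fineK ?ge0_fin_numE//; congr (_%:E); apply/eqP.
  rewrite eq_le v0 andbT leNgt; apply/negP => vpos.
  set v := fine _ in vpos key v0.
  pose t := (tau / s) ^+ 2.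
  have t0 : 0 <= t by exact: sqr_ge0.
  have ts : tau / s < 1 by rewrite ltr_pdivrMr// mul1r.
  have ts0 : 0 <= tau / s by rewrite divr_ge0// ltW.
  have t1 : t < 1 by rewrite /t exprn_ilt1.
  have A1 : 0 < `|A| + 1 by rewrite ltr_wpDl.
  have [m hm] := pow_vanish t0 t1 (divr_gt0 vpos A1).
  have sm : 0 < s ^+ (2 * m) by rewrite exprn_gt0.
  have : v <= `|A| * t ^+ m.
    rewrite /t -exprM exprMn exprVn mulrA ler_pdivlMr// mulrC (le_trans (key m))//.
    by rewrite ler_wpM2r ?exprn_ge0// ler_norm.
  rewrite ltr_pdivlMr// mulrDr mulr1 in hm.
  have : 0 <= t ^+ m by rewrite exprn_ge0.
  by rewrite [`|A| * _]mulrC; lra.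
have negl : mu.-negligible (\bigcup_k S (tau + k.+1%:R^-1)).
  by apply: negligible_bigcup => k; apply: S0; rewrite ltrDl invr_gt0 ltr0n.
apply: negligibleS negl => t /= /not_implyP[It]; move=> /negP; rewrite -ltNge => h.
have d0 : 0 < rnorm (g t) - tau by rewrite subr_gt0.
have [k hk] := exists_natr_gt (rnorm (g t) - tau)^-1.
exists k => //; split => //=; rewrite -lerBrDl -[leRHS]invrK lef_pV2 ?posrE ?invr_gt0 ?ltr0n//.
exact: ltW.
Qed.

(** The boundary function is the almost everywhere limit of a subsequence of the
    Fejer means.  Dominated convergence gives its Fourier coefficients, and its
    moments from the bounds on the powers of the means. *)
Lemma laurent_boundary (a : int -> C) (r b tau A : R) : 0 < r -> 0 <= tau ->
  (forall M z, (0 < M)%N -> rnorm z = r -> rnorm (fej M a).[z] <= b * r ^+ M) -> 1 <= b ->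
  (forall m e, 0 < e -> exists M0, forall M, (M0 <= M)%N ->
    l2 r (fej M a ^+ m) <= (A * tau ^+ (2 * m) + e) * r ^+ (2 * (m * M))) ->
  laurent_Linfty_le a r tau%:E.
Proof.
move=> r0 tau0 P_le b1 hpow.
have b0 : 0 <= b := le_trans ler01 b1.
have pi2 : 0 < 2 * pi :> R by rewrite mulr_gt0// pi_gt0.
pose H M (z : C) := (r%:C * z) ^- M * (fej M a).[r%:C * z].
pose G M t := circle_laurent r M (fej M a) t.
have cG M : ccont (G M) by exact: ccont_circle_laurent.
have Gb M t : rnorm (G M t) <= b.
  rewrite rnorm_circle_laurent//; case: M => [|M].
    by rewrite /fej double0 poly_def big_ord0 horner0 rnorm0 mulr0.
  rewrite mulrC ler_pdivrMr ?exprn_gt0//; apply: P_le => //; exact: rnorm_rcis.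
have Gcauchy e : 0 < e -> exists M0, forall M, (M0 <= M)%N ->
    mean_sqr (fun t => G M t - G M0 t) <= e.
  move=> e0; have [M0 _ h] := fejer_cauchy r0 b1 P_le (divr_gt0 e0 pi2).
  exists M0 => M M0M.
  have -> : (fun t => G M t - G M0 t) =
      circle_laurent r M (fej M a - 'X^(M - M0) * fej M0 a).
    by apply/funext => t; rewrite /G circle_laurentB.
  rewrite mean_sqr_laurent// mulrC ler_pdivrMr ?exprn_gt0//.
  rewrite (le_trans (ler_wpM2l (ltW pi2) (h _ M0M)))// mulrA.
  by rewrite [2 * pi * _]mulrC divfK// gt_eqF.
have [phi [phi_ge phi_cvg]] := mean_sqr_cauchy_ae cG Gcauchy.
(* the upper limits are defined everywhere and measurable, and agree with the
   limits where these exist *)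
pose nu (z : C) : C := (limn_sup (fun k => Re (H (phi k) z))) +i*
                       (limn_sup (fun k => Im (H (phi k) z))).
have nu_lim : {ae mu, forall t, I t -> ccvg (fun k => G (phi k) t) (nu (cis t))}.
  apply: ae_imp phi_cvg => t h It; have [l hl] := h It.
  suff -> : nu (cis t) = l by [].
  rewrite /nu (cvg_limn_inf_sup (ccvgRe hl)).2 (cvg_limn_inf_sup (ccvgIm hl)).2.
  by case: (l).
have mnuR : measurable_fun I (fun t => Re (nu (cis t))).
  apply: (@measurable_fun_limn_sup _ _ _ I (fun k t => Re (G (phi k) t))).
  - move=> t _; exists b => _ [k _ <-].
    by rewrite (le_trans (ler_norm _))// (le_trans (Re_le_rnorm _)).
  - move=> t _; exists (- b) => _ [k _ <-].
    by rewrite lerNl (le_trans (ler_norm _))// normrN (le_trans (Re_le_rnorm _)).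
  - by move=> k; apply: cont_measurable; case: (cG (phi k)).
have mnuI : measurable_fun I (fun t => Im (nu (cis t))).
  apply: (@measurable_fun_limn_sup _ _ _ I (fun k t => Im (G (phi k) t))).
  - move=> t _; exists b => _ [k _ <-].
    by rewrite (le_trans (ler_norm _))// (le_trans (Im_le_rnorm _)).
  - move=> t _; exists (- b) => _ [k _ <-].
    by rewrite lerNl (le_trans (ler_norm _))// normrN (le_trans (Im_le_rnorm _)).
  - by move=> k; apply: cont_measurable; case: (cG (phi k)).
have nu_le : {ae mu, forall t, I t -> rnorm (nu (cis t)) <= tau}.
  have dom m : mu.-integrable I (EFin \o (fun t => (rnorm (nu (cis t)) ^+ 2) ^+ m)) /\
      (fun k => \int[mu]_(t in I) ((rnorm (G (phi k) t) ^+ 2) ^+ m)) @ \oo -->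
      \int[mu]_(t in I) ((rnorm (nu (cis t)) ^+ 2) ^+ m).
    apply: (@Rintegral_dominated _ _ _ ((b ^+ 2) ^+ m)).
    - move=> k; apply: measurable_funX; apply: cont_measurable; exact: ccont_sqr.
    - have -> : (fun t => (rnorm (nu (cis t)) ^+ 2) ^+ m) =
          (fun t => (Re (nu (cis t)) ^+ 2 + Im (nu (cis t)) ^+ 2) ^+ m).
        by apply/funext => t; rewrite rnorm_sqr.
      by apply: measurable_funX; apply: measurable_funD; apply: measurable_funX.
    - move=> k t _; rewrite ger0_norm; last by rewrite exprn_ge0// sqr_ge0.
      have g0 : 0 <= rnorm (G (phi k) t) by exact: rnorm_ge0.
      by rewrite !lerXn2r ?nnegrE ?exprn_ge0.
    - apply: ae_imp nu_lim => t h It.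
      have -> : (fun k => (rnorm (G (phi k) t) ^+ 2) ^+ m) =
          (fun k => (Re (G (phi k) t) ^+ 2 + Im (G (phi k) t) ^+ 2) ^+ m).
        by apply/funext => k; rewrite rnorm_sqr.
      rewrite rnorm_sqr.
      have cX (u : nat -> R) (l : R) n : u @ \oo --> l -> (fun k => u k ^+ n) @ \oo --> l ^+ n.
        move=> hu; elim: n => [|n ih]; first by rewrite expr0; exact: cvg_cst.
        rewrite exprS (_ : (fun k => u k ^+ n.+1) = (fun k => u k * u k ^+ n)).
          exact: cvgM hu ih.
        by apply/funext => k; rewrite exprS.
      apply: (cX (fun k => Re (G (phi k) t) ^+ 2 + Im (G (phi k) t) ^+ 2)).
      apply: cvgD; [apply: (cX (fun k => Re (G (phi k) t)))|apply: (cX (fun k => Im (G (phi k) t)))].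
        exact: ccvgRe (h It).
      exact: ccvgIm (h It).
  apply: (@ae_le_of_moments _ tau (2 * pi * A)) => // m; last by case: (dom m).
  apply/ler_addgt0Pr => e e0.
  have e2 : 0 < e / 2 by rewrite divr_gt0.
  have [M0 hM0] := hpow m _ (divr_gt0 e2 pi2).
  have [_ /cvgrPdist_le /(_ _ e2)[k0 _ hk0]] := dom m.
  have := hk0 (maxn k0 M0) (leq_maxl _ _); set k := maxn k0 M0 => hk.
  have kM : (M0 <= phi k)%N by rewrite (leq_trans _ (phi_ge k))// leq_maxr.
  have : \int[mu]_(t in I) ((rnorm (G (phi k) t) ^+ 2) ^+ m) <= 2 * pi * A * tau ^+ (2 * m) + e / 2.
    have -> : \int[mu]_(t in I) ((rnorm (G (phi k) t) ^+ 2) ^+ m) =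
        mean_sqr (circle_laurent r (m * phi k) (fej (phi k) a ^+ m)).
      apply: eq_Rintegral => t _; rewrite -circle_laurentX rnormX.
      by rewrite -!exprM mulnC.
    rewrite mean_sqr_laurent// mulrC ler_pdivrMr ?exprn_gt0//.
    rewrite (le_trans (ler_wpM2l (ltW pi2) (hM0 _ kM)))// mulrA.
    rewrite (_ : 2 * pi * (_ + _) = 2 * pi * A * tau ^+ (2 * m) + e / 2)//.
    by rewrite mulrDr mulrA [2 * pi * (_ / _)]mulrC divfK ?gt_eqF.
  by move: hk; rewrite ler_norml => /andP[_ hk]; lra.
exists nu; split.
- by split => //; exists tau; exact: nu_le.
- move=> n; rewrite /fourier_coef.
  have lim1 : ccvg (fun k => cint (fun t => G (phi k) t * cis t ^ (- n)))
      (cint (fun t => nu (cis t) * cis t ^ (- n))).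
    have [cR cI] := @ccont_expz R (- n).
    apply: (@cint_dominated _ _ b).
    - by move=> k; apply: ccontM => //; exact: ccont_expz.
    - have -> : (fun t => Re (nu (cis t) * cis t ^ (- n))) =
          (fun t => Re (nu (cis t)) * Re (cis t ^ (- n)) - Im (nu (cis t)) * Im (cis t ^ (- n))).
        by apply/funext => t; rewrite complexReM.
      apply: measurable_funB; apply: measurable_funM => //; exact: cont_measurable.
    - have -> : (fun t => Im (nu (cis t) * cis t ^ (- n))) =
          (fun t => Re (nu (cis t)) * Im (cis t ^ (- n)) + Im (nu (cis t)) * Re (cis t ^ (- n))).
        by apply/funext => t; rewrite complexImM.
      apply: measurable_funD; apply: measurable_funM => //; exact: cont_measurable.
    - by move=> k t; rewrite rnormM cis_expz rnorm_cis mulr1.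
    - apply: ae_imp nu_lim => t h It.
      have := h It; apply: ev_small_le => k.
      by rewrite -mulrBl rnormM cis_expz rnorm_cis mulr1.
  have lim2 : ccvg (fun k => cint (fun t => G (phi k) t * cis t ^ (- n)))
      ((2 * pi)%:C * (a n * r%:C ^ n)).
    pose x := 2 * pi * rnorm (a n * r%:C ^ n).
    have x0 : 0 <= x by rewrite mulr_ge0 ?rnorm_ge0 ?(ltW pi2).
    move=> e e0.
    have [k0 hk0] := exists_natr_gt (x * (absz n)%:R / e).
    exists k0.+1 => k kk; rewrite fourier_circle_laurent//.
    have phi0 : (0 < phi k)%N by rewrite (leq_trans _ (phi_ge k))// (leq_trans _ kk).
    have [c [_ hc ->]] := lcoef_fej a n phi0.
    rewrite (_ : _ - _ = - ((1 - c) * ((2 * pi)%:C * (a n * r%:C ^ n)))); last by ring.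
    rewrite rnormN 2!rnormM (rnorm_real (2 * pi)) gtr0_norm// -/x.
    rewrite (le_trans (ler_wpM2r x0 hc))// mulrAC ler_pdivrMr ?ltr0n//.
    move: hk0; rewrite ltr_pdivrMr// => hk0; rewrite [_ * x]mulrC (le_trans (ltW hk0))//.
    rewrite mulrC ler_wpM2l ?(ltW e0)// ler_nat.
    by rewrite (leq_trans kk).
  rewrite -[cintegral _ _]/(cint (fun t => nu (cis t) * cis t ^ (- n))) (ccvg_unique lim1 lim2).
  rewrite mulrA -rmorphM /= mulVf ?gt_eqF//.
  by rewrite mul1r.
- by apply: ae_imp nu_le => t h It; rewrite lee_fin; exact: h.
Qed.

End BoundaryFunction.

(** * Power series and bounded holomorphic functions *)

Section PowerSeries.
Variable R : realType.
Local Notation C := R[i].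

Definition psum (u : nat -> C) (l : C) := ccvg (fun n => \sum_(i < n) u i) l.

Lemma psum_geom (u : nat -> C) (B t : R) : 0 <= B -> 0 <= t -> t < 1 ->
  (forall n, rnorm (u n) <= B * t ^+ n) -> exists2 l, psum u l & rnorm l <= B / (1 - t).
Proof.
move=> B0 t0 t1 uB; have t1' : 0 < 1 - t by rewrite subr_gt0.
pose S n := \sum_(i < n) rnorm (u i).
have S_le n : S n <= B / (1 - t).
  apply: (@le_trans _ _ (B * \sum_(k < n | (0 <= k)%N) t ^+ k)).
    by rewrite mulr_sumr; apply: ler_sum => i _; exact: uB.
  by rewrite ler_wpM2l// (le_trans (geom_tail _ _ t0 t1))// expr0 mul1r.
have xS m n : (m <= n)%N -> rnorm (\sum_(i < n) u i - \sum_(i < m) u i) <= S n - S m.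
  move=> mn; rewrite -(subnK mn); elim: (n - m)%N => [|i ih].
    by rewrite add0n !subrr rnorm0.
  rewrite addSn (le_trans (rnormD3 (\sum_(k < i + m) u k) _ _))// /S !big_ord_recr /=.
  rewrite [X in rnorm X + _](_ : _ = u (i + m)%N); last by ring.
  by move: ih; rewrite /S; lra.
have [l hl] : exists l, psum u l.
  apply: ccauchy => e e0; have [n hn] := monotone_tail S_le e0.
  by exists n => M nM; rewrite (le_trans (xS _ _ nM))// lerBlDl hn.
exists l => //; apply: ccvg_rnorm_le hl => n.
by apply: le_trans (S_le n); exact: rnorm_sum.
Qed.

Lemma ccvgD (u v : nat -> C) l l' : ccvg u l -> ccvg v l' -> ccvg (fun n => u n + v n) (l + l').
Proof.
move=> h h'; apply: ev_small_le (ev_smallD h h') => n.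
by rewrite opprD addrACA rnormD.
Qed.

Lemma ccvgZ (c : C) (u : nat -> C) l : ccvg u l -> ccvg (fun n => c * u n) (c * l).
Proof.
move=> h; apply: ev_small_le (ev_smallZ (rnorm_ge0 c) h) => n.
by rewrite -mulrBr rnormM.
Qed.

Lemma ccvg_shift (u : nat -> C) l : ccvg u l -> ccvg (fun n => u n.+1) l.
Proof. by move=> h e /h[k0 hk]; exists k0 => k kk; apply: hk; exact: leqW. Qed.

Lemma ccvg_eq (u v : nat -> C) l : (forall n, u n = v n) -> ccvg u l -> ccvg v l.
Proof. by move=> uv; rewrite (_ : v = u)//; apply/funext => n. Qed.

Lemma ccvg_cst (c : C) : ccvg (fun=> c) c.
Proof. by move=> e e0; exists 0%N => k _; rewrite subrr rnorm0 ltW. Qed.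

Lemma pow_ev_small (t B : R) : 0 <= t -> t < 1 -> 0 <= B -> ev_small (fun n => B * t ^+ n).
Proof.
move=> t0 t1 B0; apply: ev_smallZ => // e e0.
have [k hk] := pow_vanish t0 t1 e0; exists k => n kn.
by rewrite (le_trans _ (ltW hk))// ler_wiXn2l// ltW.
Qed.

Section Factorization.
Variables (rho : R).
Hypothesis rho0 : 0 < rho.

Definition coef_bounded (a : nat -> C) (B : R) := forall n, rnorm (a n) * rho ^+ n <= B.

Lemma term_bound a B (w : C) n : coef_bounded a B ->
  rnorm (a n * w ^+ n) <= B * (rnorm w / rho) ^+ n.
Proof.
move=> aB; rewrite rnormM rnormX exprMn exprVn mulrA ler_pdivlMr ?exprn_gt0//.
by rewrite mulrAC ler_wpM2r ?exprn_ge0 ?rnorm_ge0.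
Qed.

Lemma ratio_lt1 (w : C) : rnorm w < rho -> 0 <= rnorm w / rho /\ rnorm w / rho < 1.
Proof. by move=> wr; rewrite divr_ge0 ?rnorm_ge0 ?(ltW rho0)// ltr_pdivrMr// mul1r. Qed.

Lemma power_series_cvg a B w : 0 <= B -> coef_bounded a B -> rnorm w < rho ->
  exists2 l, psum (fun n => a n * w ^+ n) l & rnorm l <= B / (1 - rnorm w / rho).
Proof.
move=> B0 aB /ratio_lt1[t0 t1]; apply: psum_geom => // n; exact: term_bound.
Qed.

(** The quotient of a power series by w - z is a power series with the same
    radius; its coefficients are the tails of the series at z. *)
Lemma power_series_factor a B (z : C) : 0 <= B -> coef_bounded a B -> rnorm z < rho ->
  exists (b : nat -> C) (B' : R), [/\ 0 <= B', coef_bounded b B' &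
    forall w lz lw lb, rnorm w < rho -> psum (fun n => a n * z ^+ n) lz ->
      psum (fun n => a n * w ^+ n) lw -> psum (fun n => b n * w ^+ n) lb ->
      lw - lz = (w - z) * lb].
Proof.
move=> B0 aB zr; have [t0 t1] := ratio_lt1 zr; set t := rnorm z / rho in t0 t1.
have t1' : 0 < 1 - t by rewrite subr_gt0.
have hb i : exists l, psum (fun n => a (i + n).+1 * z ^+ n) l /\
    rnorm l <= B / rho ^+ i.+1 / (1 - t).
  have [|n|l h1 h2] := @psum_geom (fun n => a (i + n).+1 * z ^+ n) (B / rho ^+ i.+1) t _ t0 t1; last by exists l.
    by rewrite divr_ge0 ?exprn_ge0 ?(ltW rho0).
  rewrite rnormM rnormX /t exprMn exprVn mulrA ler_pdivlMr ?exprn_gt0//.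
  rewrite [rnorm _ * _ * _]mulrAC ler_wpM2r ?exprn_ge0 ?rnorm_ge0//.
  rewrite ler_pdivlMr ?exprn_gt0// -mulrA -exprD.
  by have := aB (i + n).+1; rewrite addnS addnC.
have [b hb'] := choice hb.
have Bt0 : 0 <= B / rho / (1 - t) by rewrite !divr_ge0 ?(ltW rho0) ?(ltW t1').
exists b, (B / rho / (1 - t)); split => //.
  move=> n; have [_ h] := hb' n; rewrite -ler_pdivlMr ?exprn_gt0// (le_trans h)//.
  apply: eq_ler; rewrite exprS invfM.
  by set x := _ ^-1; set y := _ ^-1; set u := _ ^-1; ring.
have rec i : b i = a i.+1 + z * b i.+1.
  apply: ccvg_unique (ccvg_shift (hb' i).1) _.
  apply: ccvg_eq (ccvgD (ccvg_cst (a i.+1)) (ccvgZ z (hb' i.+1).1)) => n.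
  rewrite big_ord_recl expr0 mulr1 addn0; congr (_ + _).
  rewrite mulr_sumr; apply: eq_bigr => k _.
  by rewrite lift0 exprS addSnnS mulrCA.
move=> w lz lw lb wr hz hw hl.
have hz0 : lz = a 0%N + z * b 0%N.
  apply: ccvg_unique (ccvg_shift hz) _.
  apply: ccvg_eq (ccvgD (ccvg_cst (a 0%N)) (ccvgZ z (hb' 0%N).1)) => n.
  rewrite big_ord_recl expr0 mulr1; congr (_ + _).
  rewrite mulr_sumr; apply: eq_bigr => k _.
  by rewrite lift0 exprS mulrCA.
have tel n : (w - z) * (\sum_(i < n.+1) b i * w ^+ i) =
    \sum_(i < n.+1) a i * w ^+ i - lz + b n * w ^+ n.+1.
  elim: n => [|n ih]; first by rewrite !big_ord1 !expr0 hz0; ring.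
  by rewrite big_ord_recr mulrDr ih [in RHS]big_ord_recr /= rec !exprS; ring.
have [s0 s1] := ratio_lt1 wr; set s := rnorm w / rho in s0 s1.
have small : ccvg (fun n => b n * w ^+ n.+1) 0.
  apply: ev_small_le (pow_ev_small s0 s1 (mulr_ge0 Bt0 (rnorm_ge0 w))) => n.
  rewrite subr0 exprS mulrCA rnormM [leRHS]mulrAC [leRHS]mulrC ler_wpM2l ?rnorm_ge0//.
  apply: term_bound => m.
  have [_ h] := hb' m; rewrite -ler_pdivlMr ?exprn_gt0// (le_trans h)//.
  apply: eq_ler; rewrite exprS invfM.
  by set x := _ ^-1; set y := _ ^-1; set u := _ ^-1; ring.
have L := ccvgZ (w - z) (ccvg_shift hl).
have := ccvgD (ccvgD (ccvg_shift hw) (ccvg_cst (- lz))) small.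
move=> /(ccvg_eq (fun n => esym (tel n))) /ccvg_unique /(_ L).
by rewrite addr0.
Qed.

(** Factoring twice, p(w) - p(z) = (w - z) (q(z) + (w - z) s(w)) with [s] bounded
    near [z]. *)
Lemma power_series_derivable (p : C -> C) a B z : 0 <= B -> coef_bounded a B ->
  (forall w, rnorm w < rho -> psum (fun n => a n * w ^+ n) (p w)) -> rnorm z < rho ->
  derivable (p : C^o -> C^o) z 1.
Proof.
move=> B0 aB hp zr.
have [b [B1 [B10 bB hb]]] := power_series_factor B0 aB zr.
have [c [B2 [B20 cB hc]]] := power_series_factor B10 bB zr.
have [lz hlz _] := power_series_cvg B10 bB zr.
pose d := (rho - rnorm z) / 2.
have d0 : 0 < d by rewrite divr_gt0// subr_gt0.
pose M := B2 / (1 - (rho - d) / rho).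
have s1 : 0 < 1 - (rho - d) / rho.
  by rewrite subr_gt0 ltr_pdivrMr// mul1r gtrDl oppr_lt0.
have M0 : 0 <= M by rewrite divr_ge0 ?(ltW s1).
apply/cvg_ex; exists lz; apply/cvgrPdist_le => e e0.
have eE : e = (rnorm e)%:C by rewrite -normE gtr0_norm.
have er0 : 0 < rnorm e by rewrite rnorm_gt0 gt_eqF.
pose del := Num.min d (rnorm e / (M + 1)).
have M1 : 0 < M + 1 by rewrite ltr_wpDl.
have del0 : 0 < del by rewrite lt_min d0 divr_gt0.
have delC : 0 < (del%:C : C) by rewrite ltcR.
near=> h.
have h0 : h != 0 by near: h; exact: nbhs_dnbhs_neq.
have hd : rnorm (h : C) < del.
  have : `|h| < del%:C by near: h; exact: dnbhs0_lt.
  by rewrite normE ltcR.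
have wr : rnorm (h + z) < rho.
  rewrite (le_lt_trans (rnormD _ _))//; move: hd; rewrite lt_min => /andP[hd _].
  by move: hd; rewrite /d; lra.
have wr' : rnorm (h + z) <= rho - d.
  rewrite (le_trans (rnormD _ _))//; move: hd; rewrite lt_min => /andP[hd _].
  by move: hd; rewrite /d; lra.
have [lw hlw _] := power_series_cvg B10 bB wr.
have [lc hlc lcM] := power_series_cvg B20 cB wr.
have e1 := hb _ _ _ _ wr (hp _ zr) (hp _ wr) hlw.
have e2 := hc _ _ _ _ wr hlz hlw hlc.
rewrite /= /GRing.scale /= mulr1 e1 addrK mulKf// eE normE lecR rnorm_distC e2 addrK rnormM.
apply: (@le_trans _ _ (rnorm (h : C) * M)).
  rewrite ler_wpM2l ?rnorm_ge0// (le_trans lcM)// ler_wpM2l// lef_pV2 ?posrE//.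
    by rewrite lerB// ler_pM2r ?invr_gt0.
  by rewrite subr_gt0 ltr_pdivrMr// mul1r.
move: hd; rewrite lt_min => /andP[_]; rewrite ltr_pdivlMr// mulrDr mulr1.
by have := rnorm_ge0 (h : C); lra.
Unshelve. all: by end_near. Qed.

End Factorization.

Lemma ev_small_inv (c : R) : 0 <= c -> ev_small (fun M => c / M%:R).
Proof.
move=> c0 e e0; have [k hk] := exists_natr_gt (c / e); exists k.+1 => M kM.
have M0 : 0 < M%:R :> R by rewrite ltr0n (leq_trans _ kM).
rewrite ler_pdivrMr// mulrC -ler_pdivrMr// (le_trans (ltW hk))//.
by rewrite ler_nat.
Qed.

Lemma sum_index_geom (t : R) M : 0 <= t -> t < 1 ->
  \sum_(i < M) i%:R * t ^+ i <= (1 - t) ^- 2.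
Proof.
move=> t0 t1; have t1' : 0 < 1 - t by rewrite subr_gt0.
have E : (1 - t) ^+ 2 * \sum_(i < M) i%:R * t ^+ i =
    t - M%:R * t ^+ M + (M%:R - 1) * t ^+ M.+1.
  elim: M => [|M ih]; first by rewrite big_ord0 mulr0 expr1; ring.
  by rewrite big_ord_recr mulrDr ih /= !exprS -!natr1; ring.
rewrite -[leRHS]mul1r ler_pdivlMr ?exprn_gt0// mulrC E exprS.
have tM : 0 <= t ^+ M by rewrite exprn_ge0.
have MtM : 0 <= M%:R * t ^+ M by rewrite mulr_ge0.
have : M%:R * t ^+ M * t <= M%:R * t ^+ M by rewrite ler_piMr// ltW.
have : 0 <= t * t ^+ M by rewrite mulr_ge0.
by lra.
Qed.

(** The weight of the term of index [i] is off by [i / M], and the sum of the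
    [i * t ^+ i] is finite. *)
Lemma cesaro_psum (u : nat -> C) (B t : R) l : 0 <= B -> 0 <= t -> t < 1 ->
  (forall n, rnorm (u n) <= B * t ^+ n) -> psum u l ->
  ccvg (fun M => \sum_(i < M) (M - i)%:R / M%:R * u i) l.
Proof.
move=> B0 t0 t1 uB ul.
have c0 : 0 <= B * (1 - t) ^- 2.
  by rewrite mulr_ge0 ?invr_ge0 ?exprn_ge0 ?subr_ge0 ?(ltW t1).
apply: ev_small_le (ev_smallD ul (ev_small_inv c0)) => M.
case: M => [|M]; first by rewrite !big_ord0 invr0 mulr0 addr0.
have M0 : 0 < M.+1%:R :> R by rewrite ltr0n.
have M0' : M.+1%:R != 0 :> C by rewrite pnatr_eq0.
rewrite (_ : _ - l = (\sum_(i < M.+1) u i - l) + - (M.+1%:R^-1 * \sum_(i < M.+1) i%:R * u i)).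
  rewrite (le_trans (rnormD _ _))// lerD2l rnormN rnormM rnormV rnorm_nat [leLHS]mulrC.
  rewrite ler_wpM2r ?invr_ge0 ?(ltW M0)// (le_trans (rnorm_sum _ _ _))//.
  apply: (@le_trans _ _ (B * \sum_(i < M.+1) i%:R * t ^+ i)).
    rewrite mulr_sumr; apply: ler_sum => i _.
    by rewrite rnormM rnorm_nat mulrCA ler_wpM2l.
  by rewrite ler_wpM2l// sum_index_geom.
rewrite addrAC; congr (_ - l); rewrite mulr_sumr -sumrB; apply: eq_bigr => i _.
rewrite natrB; last by rewrite ltnW.
by field.
Qed.

Lemma fej_bounded_coef (a : int -> C) be r (n : int) : 0 < r -> fej_bounded a be r ->
  rnorm (a n) * r ^ n <= be.
Proof.
move=> r0 ab; apply/ler_addgt0Pr => e e0.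
have rn : 0 < r ^ n by rewrite exprz_gt0.
have c0 : 0 <= (absz n)%:R * (rnorm (a n) * r ^ n) by rewrite mulr_ge0// mulr_ge0 ?rnorm_ge0 ?(ltW rn).
have [M0 hM0] := ev_small_inv c0 e0.
pose M := (maxn M0 (absz n)).+1.
have [k [_ hk hc]] := lcoef_fej a n (isT : (0 < M)%N).
have MR : 0 < M%:R :> R by rewrite ltr0n.
have kb : rnorm (k * a n) * r ^ n <= be.
  have [l hl] : exists l : nat, n + M%:Z = l by exists (absz (n + M%:Z)); rewrite /M; lia.
  have -> : r ^ n = r ^+ l / r ^+ M.
    by rewrite -[n](addrK M%:Z) hl expfzDr ?gt_eqF// -exprnN.
  rewrite -hc /lcoef hl mulrA ler_pdivrMr ?exprn_gt0//.
  by apply: cauchy_estimate (ltW r0) _ => z zr; exact: ab.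
have -> : a n = k * a n + (1 - k) * a n by ring.
rewrite (le_trans (ler_wpM2r (ltW rn) (rnormD _ _)))// mulrDl lerD//.
have := hM0 M (leqW (leq_maxl _ _)); apply: le_trans.
rewrite rnormM -[leLHS]mulrA [leRHS]mulrAC; apply: ler_wpM2r => //.
by rewrite mulr_ge0 ?rnorm_ge0 ?(ltW rn).
Qed.

Definition nonneg_coef (a : int -> C) n := a (Posz n).

(** The coefficients of the powers of 1/z; the constant term is counted in
    [nonneg_coef]. *)
Definition neg_coef (a : int -> C) n := if n is m.+1 then a (Negz m) else 0.

Definition psum_value (u : nat -> C) : C := xget 0 [set l | psum u l].

Lemma psum_valueE u l : psum u l -> psum_value u = l.
Proof.
move=> h; have := @xgetPex _ 0 [set l | psum u l] (ex_intro _ l h).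
by move=> h'; exact: ccvg_unique h' h.
Qed.

Lemma fej_mean_split (a : int -> C) M (z : C) : z != 0 ->
  z ^- M * (fej M a).[z] =
  \sum_(i < M) (M - i)%:R / M%:R * (nonneg_coef a i * z ^+ i) +
  \sum_(i < M) (M - i)%:R / M%:R * (neg_coef a i * z^-1 ^+ i).
Proof.
move=> z0; rewrite horner_poly -addnn big_split_ord /= addrC mulrDr; congr (_ + _).
  rewrite mulr_sumr; apply: eq_bigr => i _.
  have -> : (M + i)%:Z - M%:Z = i%:Z by lia.
  rewrite exprD /nonneg_coef /kf.
  have -> : (M - (M + i - M + (M - (M + i))) = M - i)%N by lia.
  set k := _ / _; have := expf_neq0 M z0; set u := z ^+ M => u0.
  by field.
have -> : \sum_(i < M) (M - i)%:R / M%:R * (neg_coef a i * z^-1 ^+ i) =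
    \sum_(i < M.+1) (M - i)%:R / M%:R * (neg_coef a i * z^-1 ^+ i).
  by rewrite [RHS]big_ord_recr /= subnn !mul0r addr0.
rewrite big_ord_recl /= mul0r mulr0 add0r (reindex_inj rev_ord_inj) mulr_sumr.
apply: eq_bigr => i _ /=; have iM := ltn_ord i.
have -> : (M - i.+1)%:Z - M%:Z = Negz i by lia.
rewrite /kf ?/bump ?add1n /=.
have -> : (M - (M - i.+1 - M + (M - (M - i.+1))) = M - i.+1)%N by lia.
set k := _ / _; have -> : z ^+ M = z ^+ (M - i.+1) * z ^+ i.+1 by rewrite -exprD subnK.
rewrite exprVn; have := expf_neq0 (M - i.+1) z0; have := expf_neq0 i.+1 z0.
set u := z ^+ _; set v := z ^+ _ => u0 v0.
by field; apply/andP.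
Qed.

Lemma ccvg_cvg (u : nat -> C) l : ccvg u l -> (u : nat -> C^o) @ \oo --> (l : C^o).
Proof.
move=> h; apply/cvgrPdist_le => e e0.
have er0 : 0 < rnorm e by rewrite rnorm_gt0 gt_eqF.
have [k0 hk] := h _ er0; exists k0 => // k /= kk.
rewrite normE -[leRHS]gtr0_norm// [X in _ <= X]normE lecR rnorm_distC.
exact: hk.
Qed.

Lemma differentiable_inverse (z : C) : z != 0 ->
  differentiable ((fun y : C^o => y^-1 : C^o) : C^o -> C^o) (z : C^o).
Proof. by move=> z0; exact: (@differentiable_Rinv C z z0). Qed.

(** Both halves of the series converge geometrically inside an annulus.  Their
    sum is the limit of the Fejer means, which the maximum principle bounds by
    [be]. *)
Lemma laurent_Hinfty_of_fejer (a : int -> C) (O : set C) be : 0 <= be ->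
  (forall z, O z -> z != 0 -> exists r1 r2, [/\ 0 < r1, r1 < rnorm z, rnorm z < r2,
     fej_bounded a be r1 & fej_bounded a be r2]) ->
  (O 0 -> (forall n, a (Negz n) = 0) /\ exists2 r2, 0 < r2 & fej_bounded a be r2) ->
  laurent_Hinfty a O.
Proof.
move=> be0 Ohyp O0.
pose fp w := psum_value (fun n => nonneg_coef a n * w ^+ n).
pose fm w := psum_value (fun n => neg_coef a n * w ^+ n).
have apB r : 0 < r -> fej_bounded a be r -> coef_bounded r (nonneg_coef a) be.
  by move=> r0 ab n; exact: (fej_bounded_coef n%:Z r0 ab).
have amB r : 0 < r -> fej_bounded a be r -> coef_bounded r^-1 (neg_coef a) be.
  move=> r0 ab [|n]; first by rewrite rnorm0 mul0r.
  by have := fej_bounded_coef (Negz n) r0 ab; rewrite NegzE -exprnN exprVn.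
have fpP r w : 0 < r -> fej_bounded a be r -> rnorm w < r ->
    psum (fun n => nonneg_coef a n * w ^+ n) (fp w).
  move=> r0 ab wr; have [l h _] := power_series_cvg r0 be0 (apB r r0 ab) wr.
  by rewrite /fp (psum_valueE h).
have fmP r w : 0 < r -> fej_bounded a be r -> rnorm w < r^-1 ->
    psum (fun n => neg_coef a n * w ^+ n) (fm w).
  move=> r0 ab wr.
  have rV0 : 0 < r^-1 by rewrite invr_gt0.
  have [l h _] := power_series_cvg rV0 be0 (amB r r0 ab) wr.
  by rewrite /fm (psum_valueE h).
have fm0 : (forall n, a (Negz n) = 0) -> forall w, fm w = 0.
  move=> a0 w; apply: psum_valueE; apply: ccvg_eq (ccvg_cst 0) => n.
  by rewrite big1// => -[[|i] hi] _ /=; rewrite ?a0 mul0r.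
have inv_lt r (z : C) : 0 < r -> r < rnorm z -> rnorm z^-1 < r^-1.
  by move=> r0 rz; rewrite rnormV ltf_pV2 ?posrE// (lt_trans r0).
exists (fun z => fp z + fm z^-1); split; first split.
- move=> z Oz; have [z0|z0] := eqVneq z 0.
    rewrite z0 in Oz *; have [a0 [r2 r20 ab]] := O0 Oz.
    rewrite (_ : (fun z => fp z + fm z^-1) = fp); last first.
      by apply/funext => w; rewrite (fm0 a0) addr0.
    apply: (power_series_derivable r20 be0 (apB r2 r20 ab)); last by rewrite rnorm0.
    by move=> w; exact: fpP.
  have [r1 [r2 [r10 r1z zr2 ab1 ab2]]] := Ohyp z Oz z0.
  have r20 : 0 < r2 by rewrite (lt_trans r10)// (lt_trans r1z).
  have r1V : 0 < r1^-1 by rewrite invr_gt0.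
  have d1 : derivable (fp : C^o -> C^o) z 1.
    apply: (power_series_derivable r20 be0 (apB r2 r20 ab2)) => //.
    by move=> w; exact: fpP.
  have d2 : derivable (fm : C^o -> C^o) z^-1 1.
    apply: (power_series_derivable r1V be0 (amB r1 r10 ab1)); last exact: inv_lt.
    by move=> w; exact: fmP.
  have d3 : derivable ((fun y => fm y^-1) : C^o -> C^o) z 1.
    apply/derivable1_diffP.
    apply: (@differentiable_comp _ _ _ _ (fun y : C^o => y^-1 : C^o) (fm : C^o -> C^o)).
      exact: differentiable_inverse z0.
    exact/derivable1_diffP.
  exact: derivableD d1 d3.
- exists be => z Oz; have [z0|z0] := eqVneq z 0.
    rewrite z0 in Oz *; have [a0 [r2 r20 ab]] := O0 Oz.
    rewrite (fm0 a0) addr0.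
    have hp := fpP r2 0 r20 ab; rewrite rnorm0 in hp.
    have -> : fp 0 = a 0.
      apply: ccvg_unique (ccvg_shift (hp r20)) _; apply: ccvg_eq (ccvg_cst (a 0)) => n.
      rewrite big_ord_recl expr0 mulr1 big1 ?addr0// => i _.
      by rewrite lift0 exprS mul0r mulr0.
    by have := apB r2 r20 ab 0%N; rewrite expr0 mulr1.
  have [r1 [r2 [r10 r1z zr2 ab1 ab2]]] := Ohyp z Oz z0.
  have r20 : 0 < r2 by rewrite (lt_trans r10)// (lt_trans r1z).
  have r1V : 0 < r1^-1 by rewrite invr_gt0.
  have [t0 t1] := ratio_lt1 r20 zr2.
  have [s0 s1] := ratio_lt1 r1V (inv_lt r1 z r10 r1z).
  have L := ccvgD
    (cesaro_psum be0 t0 t1 (fun n => term_bound r20 z n (apB r2 r20 ab2)) (fpP _ _ r20 ab2 zr2))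
    (cesaro_psum be0 s0 s1 (fun n => term_bound r1V z^-1 n (amB r1 r10 ab1)) (fmP _ _ r10 ab1 (inv_lt _ _ r10 r1z))).
  apply: ccvg_rnorm_le L => M; rewrite -fej_mean_split//.
  case: M => [|M].
    by rewrite /fej double0 poly_def big_ord0 horner0 mulr0 rnorm0.
  rewrite rnormM rnormV rnormX mulrC ler_pdivrMr ?exprn_gt0 ?rnorm_gt0//.
  exact: (fej_bounded_annulus be0 r10 (ltW r1z) (ltW zr2) ab1 ab2).
- move=> z Oz; split=> [z0|]; first by rewrite z0 in Oz; have [] := O0 Oz.
  have cm (Q : C) : psum (fun n => neg_coef a n * z^-1 ^+ n) Q ->
      series (fun n : nat => a (Negz n) * z ^ (Negz n) : C^o) @ \oo --> (Q : C^o).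
    move=> h; apply: ccvg_cvg; apply: ccvg_eq (ccvg_shift h) => n.
    rewrite big_ord_recl mul0r add0r seriesEord; apply: eq_bigr => i _.
    by rewrite lift0 NegzE -exprnN exprVn.
  have cp (Q : C) : psum (fun n => nonneg_coef a n * z ^+ n) Q ->
      series (fun n : nat => a (Posz n) * z ^ (Posz n) : C^o) @ \oo --> (Q : C^o).
    by move=> h; apply: ccvg_cvg; apply: ccvg_eq h => n; rewrite seriesEord.
  exists (fp z), (fm z^-1); have [z0|z0] := eqVneq z 0.
    rewrite z0 in Oz cp cm *; have [a0 [r2 r20 ab]] := O0 Oz; split => //.
      by apply: cp; apply: (fpP _ _ r20 ab); rewrite rnorm0.
    apply: cm; rewrite (fm0 a0); apply: ccvg_eq (ccvg_cst 0) => n.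
    by rewrite big1// => -[[|i] hi] _ /=; rewrite ?a0 mul0r.
  have [r1 [r2 [r10 r1z zr2 ab1 ab2]]] := Ohyp z Oz z0.
  have r20 : 0 < r2 by rewrite (lt_trans r10)// (lt_trans r1z).
  split => //; first by apply: cp; exact: (fpP _ _ r20 ab2 zr2).
  by apply: cm; exact: (fmP _ _ r10 ab1 (inv_lt _ _ r10 r1z)).
Qed.

End PowerSeries.

(** * Uniform boundedness *)

Section BanachSpaces.
Variables (R : realType) (E : completeNormedModType R[i]).
Local Notation C := R[i].

Lemma banach_complete (u : nat -> E) :
  (forall e, 0 < e -> exists M0, forall M, (M0 <= M)%N -> rnorm (u M - u M0) <= e) ->
  exists l, ev_small (fun M => rnorm (u M - l)).
Proof.
move=> h.
have /cvg_ex[l hl] : cvgn (u : nat -> E).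
  apply: cauchy_cvg; apply: cauchy_exP => e e0.
  have er0 : 0 < rnorm e by rewrite rnorm_gt0 gt_eqF.
  have [M0 hM] := h (rnorm e / 2) (divr_gt0 er0 (ltr0n _ 2)).
  exists (u M0); exists M0 => // M /= MM; rewrite -ball_normE /ball_ /=.
  rewrite normE -[ltRHS]gtr0_norm// [X in _ < X]normE ltcR rnorm_distC.
  by rewrite (le_lt_trans (hM M MM))// ltr_pdivrMr// ltr_pMr// ltrDl.
exists l => e e0; move/cvgrPdist_le : hl => /(_ e%:C).
rewrite ltcR => /(_ e0)[M0 _ hM]; exists M0 => M /hM /=.
by rewrite normE lecR rnorm_distC.
Qed.

Lemma ev_small_le_cst (u : nat -> E) l x b : ev_small (fun M => rnorm (u M - l)) ->
  (exists M0, forall M, (M0 <= M)%N -> rnorm (u M - x) <= b) -> rnorm (l - x) <= b.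
Proof.
move=> h [M1 h1]; apply/ler_addgt0Pr => e /h[M0 hM].
rewrite (le_trans (rnormD3 (u (maxn M0 M1)) _ _))// addrC lerD//.
  by rewrite h1// leq_maxr.
by rewrite rnorm_distC hM// leq_maxl.
Qed.

Section UniformBoundedness.
Variable L : nat -> E -> E.
Hypothesis LD : forall M x y, L M (x + y) = L M x + L M y.
Hypothesis LZ : forall M a x, L M (a *: x) = a *: L M x.
Variable c : nat -> R.
Hypothesis c0 : forall M, 0 <= c M.
Hypothesis Lc : forall M x, rnorm (L M x) <= c M * rnorm x.
Hypothesis L_pw : forall x, exists B, forall M, rnorm (L M x) <= B.

Let LB M x y : L M (x - y) = L M x - L M y.
Proof. by rewrite -scaleN1r LD LZ scaleN1r. Qed.

(** Otherwise there are nested balls on the n-th of which some [L M] has norm at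
    least n; their common point contradicts the pointwise bound. *)
Lemma uniform_bound : exists2 B, 1 <= B & forall M x, rnorm (L M x) <= B * rnorm x.
Proof.
apply: contrapT => nub.
have big B : 1 <= B -> exists M x, B * rnorm x < rnorm (L M x).
  move=> B1; apply: contrapT => h; apply: nub; exists B => // M x.
  by rewrite leNgt; apply/negP => hx; apply: h; exists M, x.
(* a ball is given by its centre and radius; the next one lies around one of
   the points x + t xi and x - t xi, as L M cannot be small at both *)
have step (n : nat) (p : E * R) : exists p' : E * R, 0 < p.2 ->
    [/\ 0 < p'.2, p'.2 <= p.2 / 2, rnorm (p'.1 - p.1) <= p.2 / 2 &
      exists M, forall y, rnorm (y - p'.1) <= p'.2 -> n%:R <= rnorm (L M y)].
  case: p => x d /=; have [d0|d0] := ltP 0 d; last by exists (x, d) => h; lra.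
  have d2 : 0 < d / 2 by rewrite divr_gt0.
  pose B := Num.max 1 ((n%:R + 1) / (d / 2)).
  have [|M [xi hxi]] := big B; first by rewrite le_max lexx.
  have B0 : 0 < B by rewrite lt_max ltr01.
  have xi0 : 0 < rnorm xi.
    rewrite lt0r rnorm_ge0 andbT rnorm_eq0; apply/eqP => E0; move: hxi.
    by rewrite E0 -(scale0r 0) LZ !scale0r !rnorm0 mulr0 ltxx.
  pose t := d / 2 / rnorm xi; have t0 : 0 < t by rewrite divr_gt0.
  have tx : rnorm (t%:C *: xi) = d / 2.
    by rewrite rnormZ rnorm_real gtr0_norm// /t divfK// gt_eqF.
  have Ltx : n%:R + 1 <= rnorm (L M (t%:C *: xi)).
    rewrite LZ rnormZ rnorm_real gtr0_norm//.
    apply: (@le_trans _ _ (t * (B * rnorm xi))); last by rewrite ler_wpM2l// ltW.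
    rewrite mulrCA /t divfK ?gt_eqF// -ler_pdivrMr//.
    by rewrite le_max lexx orbT.
  have [x' [x'd x'L]] : exists x', rnorm (x' - x) <= d / 2 /\ n%:R + 1 <= rnorm (L M x').
    have [h|h] := leP (n%:R + 1) (rnorm (L M (x + t%:C *: xi))).
      by exists (x + t%:C *: xi); rewrite addrAC subrr add0r tx.
    exists (x - t%:C *: xi); rewrite addrAC subrr add0r rnormN tx; split => //.
    have := rnormB (L M (x + t%:C *: xi)) (L M (x - t%:C *: xi)).
    rewrite -LB opprB addrCA [x + _]addrC addrK -mulr2n -scaler_nat LZ rnormZ rnorm_nat.
    by move: h Ltx; rewrite [x + _]addrC; set a := rnorm _; set b := rnorm _; set e := rnorm _; lra.
  have cM : 0 < c M + 1 by rewrite ltr_wpDl.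
  exists (x', Num.min (d / 2) (c M + 1)^-1) => _ /=; split => //.
  - by rewrite lt_min d2 invr_gt0.
  - by rewrite ge_min lexx.
  - exists M => y; rewrite le_min => /andP[_ hy].
    have := rnormD (L M y) (L M (x' - y)); rewrite -LD addrC subrK => h.
    have : rnorm (L M (x' - y)) <= 1.
      rewrite (le_trans (Lc _ _))// rnorm_distC.
      apply: (@le_trans _ _ ((c M + 1) * (c M + 1)^-1)); last by rewrite mulfV// gt_eqF.
      by apply: ler_pM => //; rewrite ?rnorm_ge0// lerDl.
    by lra.
have [F hF] := choice (fun np : nat * (E * R) => step np.1 np.2).
pose p := fix p n := if n is n'.+1 then F (n', p n') else (0 : E, 1 : R).
have pS n : p n.+1 = F (n, p n) by [].
have p0 n : 0 < (p n).2.
  by elim: n => [|n ih] //=; have [] := hF (n, p n) ih.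
have nest k n : rnorm ((p (n + k)%N).1 - (p n).1) <= (p n).2 - (p (n + k)%N).2.
  elim: k => [|k ih]; first by rewrite addn0 !subrr rnorm0.
  have [_ h1 h2 _] := hF ((n + k)%N, p (n + k)%N) (p0 _).
  rewrite addnS pS (le_trans (rnormD3 (p (n + k)%N).1 _ _))//.
  by move: ih h1 h2 => /=; lra.
have small n : (p n).2 <= 2^-1 ^+ n.
  elim: n => [|n ih]; first by rewrite expr0.
  have [_ h1 _ _] := hF (n, p n) (p0 n).
  by rewrite pS exprS mulrC (le_trans h1)// ler_pM2r ?invr_gt0.
have [l hl] : exists l, ev_small (fun M => rnorm ((p M).1 - l)).
  apply: banach_complete => e e0.
  have h0 : 0 <= 2^-1 :> R by rewrite invr_ge0.
  have h1 : 2^-1 < 1 :> R by rewrite invf_lt1// ltr1n.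
  have [M0 hM] := pow_vanish h0 h1 e0.
  exists M0 => M MM; rewrite -(subnKC MM) (le_trans (nest _ _))//.
  have := small M0; have := p0 (M0 + (M - M0))%N; lra.
have inball n : rnorm (l - (p n).1) <= (p n).2.
  apply: ev_small_le_cst hl _; exists n => M nM.
  rewrite -(subnKC nM) (le_trans (nest _ _))// gerBl ltW//.
have [B hB] := L_pw l.
have [n hn] := exists_natr_gt B.
have [_ _ _ [M hM]] := hF (n.+1, p n.+1) (p0 n.+1).
have := hM l (inball n.+2); have := hB M => /= h1 h2.
by move: (le_lt_trans (le_trans h2 h1) hn); rewrite ltxx.
Qed.

End UniformBoundedness.

Lemma continuous_linear_bound (T : {linear E -> E}) : continuous T ->
  exists2 M, 0 <= M & forall x, rnorm (T x) <= M * rnorm x.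
Proof.
move=> Tc; have /cvgrPdist_lt/(_ 1 ltr01) := Tc 0.
move=> /nbhs_ballP[d /= d0 hd].
have dE : d = (rnorm d)%:C by rewrite -normE gtr0_norm.
have d0' : 0 < rnorm d by rewrite rnorm_gt0 gt_eqF.
set d' := rnorm d in dE d0'.
exists (2 / d'); first by rewrite divr_ge0// ltW.
move=> x; have [->|x0] := eqVneq x 0; first by rewrite linear0 !rnorm0 mulr0.
have nx : 0 < rnorm x by rewrite rnorm_gt0.
pose t := d' / 2 / rnorm x.
have t0 : 0 < t by rewrite !divr_gt0.
have : ball (0 : E) d (t%:C *: x).
  rewrite -ball_normE /ball_ /= sub0r normrN normE dE ltcR rnormZ rnorm_real.
  rewrite gtr0_norm// /t divfK ?gt_eqF// ltr_pdivrMr// ltr_pMr//.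
  by rewrite ltrDl.
move=> /hd /=; rewrite linear0 sub0r normrN linearZ normE ltcR rnormZ rnorm_real gtr0_norm//.
rewrite -ltr_pdivlMl// mulr1 => /ltW /le_trans; apply; apply: eq_ler.
by rewrite /t; field; rewrite !gt_eqF.
Qed.

Lemma opnormP (f : E -> E) (M : R) : (forall a x, f (a *: x) = a *: f x) ->
  (opnorm f <= M%:E)%E -> forall x, rnorm (f x) <= M * rnorm x.
Proof.
move=> fZ fM x; have [->|x0] := eqVneq x 0.
  by rewrite -(scale0r 0) fZ !scale0r !rnorm0 mulr0.
have nx : 0 < rnorm x by rewrite rnorm_gt0.
have : ((rnorm (f ((rnorm x)^-1%:C *: x)))%:E <= M%:E)%E.
  apply: le_trans fM; apply: ereal_sup_ubound; exists ((rnorm x)^-1%:C *: x) => //=.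
  by rewrite rnormZ rnorm_real gtr0_norm ?invr_gt0// mulVf// gt_eqF.
rewrite lee_fin fZ rnormZ rnorm_real gtr0_norm ?invr_gt0//.
by rewrite ler_pdivrMl// mulrC.
Qed.

Lemma opnorm_fin (T : {linear E -> E}) : continuous T ->
  exists2 tau, 0 <= tau & opnorm T = tau%:E /\ forall x, rnorm (T x) <= tau * rnorm x.
Proof.
move=> /continuous_linear_bound[M M0 TM].
have ub : (opnorm T <= M%:E)%E.
  apply: ge_ereal_sup => _ [x /= x1 <-]; rewrite lee_fin (le_trans (TM x))//.
  by rewrite ler_piMr.
have lb : (0 <= opnorm T)%E.
  apply: ereal_sup_ubound; exists 0 => //=; first by rewrite rnorm0.
  by rewrite linear0 rnorm0.
have [tau tE] : exists tau, opnorm T = tau%:E.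
  by move: ub lb; case: (opnorm T) => // r _ _; exists r.
exists tau; first by rewrite -lee_fin -tE.
split => //; apply: opnormP; last by rewrite tE.
by move=> a x; rewrite linearZ.
Qed.

End BanachSpaces.

(** * The Neumann series *)

Section Neumann.
Variables (R : realType) (E : completeNormedModType R[i]).
Local Notation C := R[i].
Variables (S : E -> E) (b c x : R).
Hypothesis SD : forall u v, S (u + v) = S u + S v.
Hypothesis SZ : forall a u, S (a *: u) = a *: S u.
Hypothesis Sb : forall u, rnorm (S u) <= b * rnorm u.
Hypothesis c0 : 0 <= c.
Hypothesis x0 : 0 < x.
Hypothesis Sn : forall n u, rnorm (iter n S u) <= c * x ^+ n * rnorm u.

Let SB u v : S (u - v) = S u - S v.
Proof. by rewrite -scaleN1r SD SZ scaleN1r. Qed.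

Let SN u : S (- u) = - S u.
Proof. by rewrite -scaleN1r SZ scaleN1r. Qed.

Let S0 : S 0 = 0.
Proof. by rewrite -(scale0r 0) SZ !scale0r. Qed.

Let iterD n u v : iter n S (u + v) = iter n S u + iter n S v.
Proof. by elim: n => //= n ->. Qed.

Let iterZ n a u : iter n S (a *: u) = a *: iter n S u.
Proof. by elim: n => //= n ->. Qed.

Lemma norm_limit_unique (u : nat -> E) l l' : ev_small (fun M => rnorm (u M - l)) ->
  ev_small (fun M => rnorm (u M - l')) -> l = l'.
Proof.
move=> h h'; apply/eqP; rewrite -subr_eq0 -rnorm_eq0 eq_le rnorm_ge0 andbT.
apply/ler_addgt0Pr => e e0; rewrite add0r.
by apply: (ev_small_le_cst h); have [M0 hM] := h' e e0; exists M0.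
Qed.

(** The resolvent is minus the sum of the [lambda ^- n.+1 *: iter n S]. *)
Lemma resolvent_of_power_bound (lambda : C) : x < rnorm lambda ->
  resolvent_set [set p : E * E | p.2 = S p.1] lambda.
Proof.
move=> xl; have l0 : 0 < rnorm lambda := lt_trans x0 xl.
have lam0 : lambda != 0 by rewrite -rnorm_gt0.
pose t := x / rnorm lambda.
have t0 : 0 <= t by rewrite divr_ge0 ?ltW.
have t1 : t < 1 by rewrite ltr_pdivrMr// mul1r.
pose P k v := - \sum_(n < k) lambda ^- n.+1 *: iter n S v.
have term n v : rnorm (lambda ^- n.+1 *: iter n S v) <= c / rnorm lambda * rnorm v * t ^+ n.
  rewrite rnormZ rnormV rnormX -ler_pdivlMl ?invr_gt0 ?exprn_gt0// invrK (le_trans (Sn _ _))//.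
  apply: eq_ler; rewrite /t exprMn exprVn exprS; field.
  by rewrite expf_neq0 ?gt_eqF.
have cv v : 0 <= c / rnorm lambda * rnorm v.
  by rewrite mulr_ge0 ?rnorm_ge0// divr_ge0// ltW.
have t1' : 0 < 1 - t by rewrite subr_gt0.
have Pc v m n : (m <= n)%N -> rnorm (P n v - P m v) <=
    c / rnorm lambda * rnorm v * (t ^+ m / (1 - t)).
  move=> mn; rewrite /P opprK addrC -(big_mkord xpredT (fun n => lambda ^- n.+1 *: iter n S v)).
  rewrite -(big_mkord xpredT (fun n => lambda ^- n.+1 *: iter n S v)) (big_cat_nat (leq0n m) mn) /=.
  rewrite opprD addrA subrr add0r rnormN (le_trans (rnorm_sum _ _ _))//.
  apply: (@le_trans _ _ (\sum_(m <= k < n) c / rnorm lambda * rnorm v * t ^+ k)).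
    by apply: ler_sum => k _; exact: term.
  rewrite -mulr_sumr ler_wpM2l// (le_trans _ (geom_tail m n t0 t1))//.
  by rewrite big_geq_mkord.
have hB v : exists l, ev_small (fun M => rnorm (P M v - l)).
  apply: banach_complete => e e0.
  have A0 : 0 < c / rnorm lambda * rnorm v / (1 - t) + 1 by rewrite ltr_wpDl// divr_ge0// ltW.
  have [M0 hM] := pow_vanish t0 t1 (divr_gt0 e0 A0).
  exists M0 => M /Pc /le_trans; apply; rewrite mulrCA mulrC.
  rewrite (le_trans (ler_wpM2l _ (ltW hM)))//; first by rewrite divr_ge0// ltW.
  rewrite mulrCA ler_piMr ?(ltW e0)// ler_pdivrMr// mul1r.
  by rewrite lerDl.
have [B hB'] := choice hB.
have limD (u v : nat -> E) l l' : ev_small (fun M => rnorm (u M - l)) ->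
    ev_small (fun M => rnorm (v M - l')) -> ev_small (fun M => rnorm (u M + v M - (l + l'))).
  move=> h h'; apply: ev_small_le (ev_smallD h h') => M.
  by rewrite opprD addrACA rnormD.
have limZ a (u : nat -> E) l : ev_small (fun M => rnorm (u M - l)) ->
    ev_small (fun M => rnorm (a *: u M - a *: l)).
  by move=> h; apply: ev_small_le (ev_smallZ (rnorm_ge0 a) h) => M; rewrite -scalerBr rnormZ.
have PD M u v : P M (u + v) = P M u + P M v.
  rewrite /P -opprD -big_split; congr (- _); apply: eq_bigr => n _.
  by rewrite iterD scalerDr.
have PZ M a u : P M (a *: u) = a *: P M u.
  rewrite /P scalerN scaler_sumr; congr (- _); apply: eq_bigr => n _.
  by rewrite iterZ !scalerA mulrC.
have BL : linear B.
  move=> a u v; apply: norm_limit_unique (hB' _) _.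
  by apply: ev_small_le (limD _ _ _ _ (limZ a _ _ (hB' u)) (hB' v)) => M; rewrite PD PZ.
have Bb v : rnorm (B v) <= c / rnorm lambda / (1 - t) * rnorm v.
  rewrite -[B v]subr0; apply: ev_small_le_cst (hB' v) _; exists 0%N => M _.
  have P0 : P 0%N v = 0 by rewrite /P big_ord0 oppr0.
  have := Pc v 0%N M (leq0n _); rewrite P0 expr0 => /le_trans; apply.
  by apply: eq_ler; ring.
have tailS v : ev_small (fun M => rnorm (lambda ^- M *: iter M S v - 0)).
  apply: ev_small_le (pow_ev_small t0 t1 (mulr_ge0 c0 (rnorm_ge0 v))) => M.
  rewrite subr0 rnormZ rnormV rnormX (le_trans (ler_wpM2l _ (Sn M v)))//.
    by rewrite invr_ge0 exprn_ge0// rnorm_ge0.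
  by apply: eq_ler; rewrite /t exprMn exprVn; ring.
have tel M v : \sum_(n < M) (lambda ^- n.+1 *: iter n.+1 S v - lambda ^- n *: iter n S v) =
    lambda ^- M *: iter M S v - v.
  elim: M => [|M ih]; first by rewrite big_ord0 expr0 invr1 scale1r subrr.
  by rewrite big_ord_recr ih /= addrC addrA subrK.
have SP M v : S (P M v) - lambda *: P M v = v - lambda ^- M *: iter M S v.
  rewrite -[RHS]opprB -tel /P SN scalerN -opprD; congr (- _).
  rewrite scaler_sumr sumrB.
  have -> : S (\sum_(n < M) lambda ^- n.+1 *: iter n S v) = \sum_(n < M) lambda ^- n.+1 *: iter n.+1 S v.
    by elim: M => [|M ih]; rewrite ?big_ord0// !big_ord_recr SD ih SZ.
  congr (_ - _); apply: eq_bigr => n _.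
  by rewrite scalerA exprS invfM mulrA mulfV// mul1r.
have PS M v : P M (S v - lambda *: v) = v - lambda ^- M *: iter M S v.
  rewrite -SP PD -[- (lambda *: v)]scaleN1r PZ scaleN1r PZ; congr (_ - _).
  rewrite /P SN; congr (- _).
  elim: M => [|M ih]; rewrite ?big_ord0// !big_ord_recr SD ih SZ /=.
  by rewrite -iterS -iterSr.
pose Bl : {linear E -> E} := HB.pack B (GRing.isLinear.Build _ _ _ _ B BL).
have lim_v v : ev_small (fun M => rnorm (v - lambda ^- M *: iter M S v - v)).
  apply: ev_small_le (tailS v) => M; rewrite addrAC subrr add0r subr0 rnormN//.
exists Bl; split => /=.
- move=> v; apply/cvgrPdist_le => e e0.
  pose A := c / rnorm lambda / (1 - t).
  have A0 : 0 <= A by rewrite !divr_ge0// ltW.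
  have A1 : 0 < A + 1 by rewrite ltr_wpDl.
  have er0 : 0 < rnorm e by rewrite rnorm_gt0 gt_eqF.
  have d0 : 0 < ((rnorm e / (A + 1))%:C : C) by rewrite ltcR divr_gt0.
  near=> w.
  have : `|v - w| < (rnorm e / (A + 1))%:C by near: w; apply: cvgr_dist_lt.
  rewrite normE ltcR => hw.
  rewrite -[B v - B w](linearB Bl) normE -[leRHS]gtr0_norm// [X in _ <= X]normE lecR /=.
  rewrite (le_trans (Bb _))// -/A.
  move: hw; rewrite ltr_pdivlMr// mulrDr mulr1.
  by have := rnorm_ge0 (v - w); lra.
- move=> u y ->; apply: norm_limit_unique (hB' _) _.
  by apply: ev_small_le (lim_v u) => M; rewrite PS.
- move=> v; suff key : S (B v) - lambda *: B v = v by rewrite -{1}key subrK.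
  apply: (@norm_limit_unique (fun M => S (P M v) - lambda *: P M v)); last first.
    by apply: ev_small_le (lim_v v) => M; rewrite SP.
  have SBv : ev_small (fun M => rnorm (S (P M v) - S (B v))).
    apply: ev_small_le (ev_smallZ (normr_ge0 b) (hB' v)) => M.
    by rewrite -SB (le_trans (Sb _))// ler_wpM2r ?rnorm_ge0// ler_norm.
  apply: ev_small_le (limD _ _ _ _ SBv (limZ (- lambda) _ _ (hB' v))) => M.
  by rewrite !scaleNr.
Unshelve. all: by end_near. Qed.

End Neumann.

(** * Boundedness and spectra of the shifts *)

Section CoordinateOperators.
Variables (R : realType) (E : completeNormedModType R[i]).
Local Notation C := R[i].
Variable j : E -> nat -> C.
Hypothesis j_linear : forall (a : C) (x y : E) (n : nat),
  j (a *: x + y) n = a * j x n + j y n.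
Hypothesis j_inj : injective j.
Hypothesis F_sub : forall u : nat -> C, finsupp u -> exists x : E, j x = u.
Hypothesis F_dense : dense [set x : E | finsupp (j x)].
Hypothesis coord_cont : forall n : nat, continuous (fun x : E => j x n : R[i]^o).
Variable K : R.
Hypothesis K0 : 0 < K.
Hypothesis rot : forall z x, rnorm z = 1 ->
  exists2 y, j y = rotate z (j x) & rnorm y <= K * rnorm x.

Local Notation emb := (emb j).
Local Notation N := (emb_norm j).

Let ND := ND j_linear j_inj F_sub.
Let NZ := NZ j_linear j_inj F_sub.
Let N_ge0 := @N_ge0 R E j.
Let N_gt0 := N_gt0 j_linear j_inj F_sub.
Let emb_dense := emb_dense j_inj F_sub F_dense.
Let embB := embB j_linear j_inj F_sub.
Let embD := embD j_linear j_inj F_sub.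
Let embZ := embZ j_linear j_inj F_sub.
Let jemb := jemb j_inj F_sub.
Let jB := jB j_linear.
Let jD := jD j_linear.
Let jZ := jZ j_linear.
Let NE q : N q = rnorm (emb q). Proof. by []. Qed.
Let coord_bounded := coord_bounded j_linear coord_cont.

(** Operators each of whose output coordinates is zero or copies one input
    coordinate; the iterates of both shifts are of this kind. *)
Definition copies (A : (nat -> C) -> nat -> C) :=
  forall i, (forall u, A u i = 0) \/ exists k, forall u, A u i = u k.

Lemma copies_iter n A : copies A -> copies (iter n A).
Proof.
move=> hA; elim: n => [|n ih] i; first by right; exists i.
have [h|[k h]] := hA i; first by left => u; rewrite iterS h.
have [h'|[l h']] := ih k; first by left => u; rewrite iterS h h'.
by right; exists l => u; rewrite iterS h h'.
Qed.

Lemma copies_fwd : copies shift_fwd.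
Proof. by case=> [|i]; [left|right; exists i]. Qed.

Lemma copies_bwd : copies shift_bwd.
Proof. by move=> i; right; exists i.+1. Qed.

Lemma fwd_poly (q : {poly C}) : (fun n => ('X * q)`_n) = shift_fwd (fun n => q`_n).
Proof. by apply/funext => -[|n]; rewrite coefXM. Qed.

Lemma bwd_poly (q : {poly C}) : (fun n => (drop_poly 1 q)`_n) = shift_bwd (fun n => q`_n).
Proof. by apply/funext => n; rewrite coef_drop_poly addn1. Qed.

Section Operator.
Variables (A : (nat -> C) -> nat -> C) (s : {poly C} -> {poly C}).
Hypothesis A_copies : copies A.
Hypothesis sA : forall q, (fun n => (s q)`_n) = A (fun n => q`_n).

Lemma poly_coefE q i : (s q)`_i = A (fun n => q`_n) i.
Proof. by rewrite -sA. Qed.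

Lemma copiesD u v i : A (fun n => u n + v n) i = A u i + A v i.
Proof. by have [h|[k h]] := A_copies i; rewrite !h ?addr0. Qed.

Lemma copiesZ c u i : A (fun n => c * u n) i = c * A u i.
Proof. by have [h|[k h]] := A_copies i; rewrite !h ?mulr0. Qed.

Lemma poly_opZ c q : s (c *: q) = c *: s q.
Proof.
apply/polyP => i; rewrite coefZ !poly_coefE -copiesZ.
by congr (A _ _); apply/funext => n; rewrite coefZ.
Qed.

Lemma poly_opB p q : s (p - q) = s p - s q.
Proof.
rewrite -scaleN1r -[- s q]scaleN1r -poly_opZ; set q' := _ *: q.
apply/polyP => i; rewrite coefD !poly_coefE -copiesD.
by congr (A _ _); apply/funext => n; rewrite coefD.
Qed.

(** Density and completeness; the continuity of the coordinates identifies the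
    limit with [A (j x)]. *)
Lemma extend_operator c : 0 <= c -> (forall q, N (s q) <= c * N q) ->
  forall x, exists2 y, j y = A (j x) & rnorm y <= c * rnorm x.
Proof.
move=> c0 sN x.
have p2 k : 0 < 2^-1 ^+ k :> R by rewrite exprn_gt0// invr_gt0.
have [q hq] := choice (fun k => emb_dense x (p2 k)).
have h0 : 0 <= 2^-1 :> R by rewrite invr_ge0.
have h1 : 2^-1 < 1 :> R by rewrite invf_lt1// ltr1n.
have qd M M0 : (M0 <= M)%N -> rnorm (emb (q M) - emb (q M0)) <= 2 * 2^-1 ^+ M0.
  move=> MM; rewrite (le_trans (rnormD3 x _ _))// rnorm_distC.
  have := ltW (hq M); have := ltW (hq M0).
  have : 2^-1 ^+ M <= 2^-1 ^+ M0 :> R by rewrite ler_wiXn2l// ltW.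
  by lra.
have [y hy] : exists l, ev_small (fun M => rnorm (emb (s (q M)) - l)).
  apply: banach_complete => e e0.
  have c2 : 0 < c * 2 + 1 by rewrite ltr_wpDl// mulr_ge0.
  have [M0 hM] := pow_vanish h0 h1 (divr_gt0 e0 c2).
  exists M0 => M MM; rewrite -embB -poly_opB (le_trans (sN _))//.
  have := ler_wpM2l c0 (qd _ _ MM); rewrite -embB -NE => /le_trans; apply.
  move: hM; rewrite ltr_pdivlMr// => /ltW; have := p2 M0.
  by set z := _ ^+ M0; lra.
exists y.
  apply/funext => i; have [d d0 hd] := coord_bounded i.
  have l1 : ccvg (fun M => j (emb (s (q M))) i) (j y i).
    apply: ev_small_le (ev_smallZ d0 hy) => M; rewrite -jB; exact: hd.
  have [hA|[k hA]] := A_copies i.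
    rewrite hA; apply/esym; apply: ccvg_unique (ccvg_cst 0) _.
    by apply: ccvg_eq l1 => M; rewrite jemb poly_coefE hA.
  rewrite hA; apply: ccvg_unique l1 _.
  have [d' d'0 hd'] := coord_bounded k.
  apply: ev_small_le (ev_smallZ d'0 (pow_ev_small h0 h1 ler01)) => M.
  have -> : j (emb (s (q M))) i = j (emb (q M)) k by rewrite !jemb poly_coefE hA.
  rewrite -jB (le_trans (hd' _))// ler_wpM2l// mul1r rnorm_distC.
  exact: ltW.
rewrite -[y]subr0; apply/ler_addgt0Pr => e e0; apply: ev_small_le_cst hy _.
have c2 : 0 < c + 1 by rewrite ltr_wpDl.
have [M0 hM] := pow_vanish h0 h1 (divr_gt0 e0 c2).
exists M0 => M MM; rewrite subr0 (le_trans (sN _))//.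
have : N (q M) <= rnorm x + 2^-1 ^+ M0.
  rewrite NE -[emb (q M)](subrK x) addrC (le_trans (rnormD _ _))// lerD2l rnorm_distC.
  by rewrite (le_trans (ltW (hq M)))// ler_wiXn2l// ltW.
move=> /(ler_wpM2l c0) /le_trans; apply; rewrite mulrDr lerD2l.
move: hM; rewrite ltr_pdivlMr// => /ltW; have := p2 M0.
by set z := _ ^+ M0; lra.
Qed.

End Operator.

Section Stable.
Variables (A : (nat -> C) -> nat -> C) (s : {poly C} -> {poly C}).
Hypothesis A_copies : copies A.
Hypothesis sA : forall q, (fun n => (s q)`_n) = A (fun n => q`_n).
Let AD := copiesD A_copies.
Let AZ := copiesZ A_copies.
Let sZ := poly_opZ A_copies sA.
Hypothesis A_stable : stable j A.
Let S := restriction j A.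

Lemma j_restriction x : j (S x) = A (j x).
Proof. by rewrite /S /restriction; have [y <-] := A_stable x; rewrite (seq_liftE j_inj (erefl _)). Qed.

Lemma restrictionD u v : S (u + v) = S u + S v.
Proof.
apply: j_inj; apply/funext => i; rewrite jD !j_restriction.
rewrite -AD.
by congr (A _ _); apply/funext => n; rewrite jD.
Qed.

Lemma restrictionZ c u : S (c *: u) = c *: S u.
Proof.
apply: j_inj; apply/funext => i; rewrite jZ !j_restriction.
rewrite -AZ.
by congr (A _ _); apply/funext => n; rewrite jZ.
Qed.

Lemma restriction_emb q : S (emb q) = emb (s q).
Proof. by apply: j_inj; rewrite j_restriction !jemb sA. Qed.

(** The closed graph theorem for S: uniform boundedness is applied to the
    finite rank operators x |-> Fejer mean of S x. *)
Lemma restriction_bounded : exists2 B, 1 <= B & forall x, rnorm (S x) <= B * rnorm x.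
Proof.
pose L M x := emb (\poly_(i < 0 + M) (kf R M i 0 * j (S x) i)).
have coefL M x i : (\poly_(i < 0 + M) (kf R M i 0 * j (S x) i))`_i =
    if (i < 0 + M)%N then kf R M i 0 * j (S x) i else 0 by rewrite coef_poly.
have LD M x y : L M (x + y) = L M x + L M y.
  rewrite /L -embD; congr emb; apply/polyP => i; rewrite coefD !coef_poly.
  by case: ifP => _; rewrite ?addr0// restrictionD jD mulrDr.
have LZ M c x : L M (c *: x) = c *: L M x.
  rewrite /L -embZ; congr emb; apply/polyP => i; rewrite coefZ !coef_poly.
  by case: ifP => _; rewrite ?mulr0// restrictionZ jZ mulrCA.
have cb i : exists d, 0 <= d /\ forall x, rnorm (j (S x) i) <= d * rnorm x.
  have [h|[k h]] := A_copies i.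
    by exists 0; split => // x; rewrite j_restriction h rnorm0 mul0r.
  by have [d d0 hd] := coord_bounded k; exists d; split => // x; rewrite j_restriction h.
have [d hd] := choice cb.
pose c M := \sum_(i < 0 + M) d i * N 'X^i.
have c0 M : 0 <= c M by apply: sumr_ge0 => i _; rewrite mulr_ge0 ?N_ge0//; case: (hd i).
have Lc M x : rnorm (L M x) <= c M * rnorm x.
  rewrite /L poly_def (emb_sum j_linear j_inj F_sub) (le_trans (rnorm_sum _ _ _))//.
  rewrite mulr_suml; apply: ler_sum => i _; rewrite embZ rnormZ rnormM.
  have [d0 hdi] := hd i; rewrite [leRHS]mulrAC -NE ler_wpM2r ?N_ge0//.
  rewrite -[leRHS]mul1r; apply: ler_pM => //; rewrite ?rnorm_ge0 ?rnorm_kf//.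
have Llim x : ev_small (fun M => rnorm (L M x - S x)).
  exact: (fejer_mean_cvg j_linear j_inj F_sub F_dense coord_cont K0 rot (S x) 0).
have Lpw x : exists B, forall M, rnorm (L M x) <= B.
  have [M0 hM0] := Llim x 1 ltr01.
  have s0 : 0 <= \sum_(M < M0) rnorm (L M x) by apply: sumr_ge0 => *; exact: rnorm_ge0.
  exists (1 + rnorm (S x) + \sum_(M < M0) rnorm (L M x)) => M.
  have [h|h] := leqP M0 M.
    rewrite -[L M x](subrK (S x)) (le_trans (rnormD _ _))//.
    by have := hM0 M h; lra.
  rewrite (bigD1 (Ordinal h))//=.
  have : 0 <= \sum_(i < M0 | i != Ordinal h) rnorm (L i x).
    by apply: sumr_ge0 => *; exact: rnorm_ge0.
  by have := rnorm_ge0 (S x); lra.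
have [B B1 hB] := uniform_bound LD LZ c0 Lc Lpw.
exists B => // x; rewrite -[S x]subr0; apply: ev_small_le_cst (Llim x) _.
by exists 0%N => M _; rewrite subr0.
Qed.

Lemma shift_bounded : exists2 B, 1 <= B & forall q, N (s q) <= B * N q.
Proof.
by have [B B1 hB] := restriction_bounded; exists B => // q; rewrite NE -restriction_emb.
Qed.

Lemma op_graphE : op_graph j A = [set p | p.2 = S p.1].
Proof.
rewrite /op_graph asboolT//; apply/seteqP; split => p /= h.
  by apply: j_inj; rewrite h j_restriction.
by rewrite h j_restriction.
Qed.

(** Bernoulli's inequality replaces the extraction of a root. *)
Lemma lt_root (o r : R) l : 0 < r -> 0 <= o -> (0 < l)%N -> o < r ^+ l ->
  exists r', [/\ 0 < r', r' < r & o <= r' ^+ l].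
Proof.
move=> r0 o0 l0 h; have rl : 0 < r ^+ l by rewrite exprn_gt0.
pose e := (1 - o / r ^+ l) / l.+1%:R.
have q1 : o / r ^+ l < 1 by rewrite ltr_pdivrMr// mul1r.
have q0 : 0 <= o / r ^+ l by rewrite divr_ge0// ltW.
have e0 : 0 < e by rewrite divr_gt0// subr_gt0.
have l2 : 2 <= l.+1%:R :> R by rewrite ler_nat.
have e2 : e < 1.
  by rewrite ltr_pdivrMr ?mul1r ?ltr0n//; lra.
exists (r * (1 - e)); split; first by rewrite mulr_gt0// subr_gt0.
  by rewrite gtr_pMr// gtrDl oppr_lt0.
rewrite exprMn mulrC -ler_pdivrMr//; apply: le_trans (bernoulli_sub l (ltW e0) (ltW e2)).
have : l.+1%:R * e = 1 - o / r ^+ l by rewrite /e mulrC divfK// gt_eqF// ltr0n.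
by rewrite -natr1 mulrDl mul1r; lra.
Qed.

(** By the Neumann series, a point of the spectrum of modulus at least r forces
    all the powers to have norm at least r^l. *)
Lemma spectral_lower_bound r : 0 < r -> (r%:E <= rho (op_graph j A))%E ->
  forall l, r ^+ l <= opN N (iter l s).
Proof.
move=> r0 rr l; rewrite leNgt; apply/negP => hl.
have [B B1 sN] := shift_bounded.
have [B' B'1 SB] := restriction_bounded.
have o0 := opN_iter_ge0 N_ge0 NZ B1 sN l.
have l0 : (0 < l)%N.
  rewrite lt0n; apply: contraTneq hl => ->; rewrite expr0 -leNgt.
  have := opN_iterP N_ge0 NZ N_gt0 sZ B1 sN 0 1; rewrite /= ler_pMl// N_gt0.
  exact: oner_neq0.
have [r' [r'0 r'r hr']] := lt_root r0 o0 l0 hl.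
have [c c0 hc] := opN_iter_small N_ge0 NZ N_gt0 sZ B1 sN r'0 l0 hr'.
have itA n q : (fun i => (iter n s q)`_i) = iter n A (fun i => q`_i).
  by elim: n => //= n <-; rewrite sA.
have itS n u : j (iter n S u) = iter n A (j u).
  by elim: n => //= n <-; rewrite j_restriction.
have Sn n u : rnorm (iter n S u) <= c * r' ^+ n * rnorm u.
  have cn0 : 0 <= c * r' ^+ n by rewrite mulr_ge0// exprn_ge0// ltW.
  have itsN q : N (iter n s q) <= c * r' ^+ n * N q.
    by rewrite (le_trans (opN_iterP N_ge0 NZ N_gt0 sZ B1 sN n q))// ler_wpM2r.
  have [y jy yle] := extend_operator (copies_iter n A_copies) (itA n) cn0 itsN u.
  by rewrite (_ : iter n S u = y)//; apply: j_inj; rewrite itS jy.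
suff : (rho (op_graph j A) <= r'%:E)%E.
  by move=> /(le_trans rr); rewrite lee_fin leNgt r'r.
apply: ge_ereal_sup => _ [lam /= hlam <-]; rewrite lee_fin leNgt; apply/negP => lr.
apply: hlam; rewrite op_graphE.
exact: (resolvent_of_power_bound restrictionD restrictionZ SB c0 r'0 Sn lr).
Qed.

End Stable.

End CoordinateOperators.

(** * Two opposite diagonals of a Toeplitz matrix *)

Section SecondDifference.
Variable R : realType.
Local Notation C := R[i].
Variable a : int -> C.

Lemma fej_coefE Q e : Q%:R * (fej Q a)`_e = (Q - ((e - Q) + (Q - e)))%:R * a (e%:Z - Q%:Z).
Proof.
rewrite coef_poly; case: ltnP => h; last first.
  by rewrite mulr0 (_ : (Q - _)%N = 0%N) ?mul0r//; lia.
rewrite /kf; case: Q h => [|Q] h; first by lia.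
by rewrite mulrA [Q.+1%:R * _]mulrC divfK// pnatr_eq0.
Qed.

Lemma second_difference_weight (P e : nat) :
  ((P.+2 - ((e.+2 - P.+2) + (P.+2 - e.+2))) + (P - ((e - P) + (P - e))) =
   2 * (P.+1 - ((e.+1 - P.+1) + (P.+1 - e.+1))) +
   (e.+2 == 2 * P + 3))%N.
Proof. by case: (eqVneq e.+2 (2 * P + 3)%N) => h; lia. Qed.

(** The triangle weights have second difference a pair of point masses, which
    isolates the two diagonals at distance Q of the Toeplitz matrix. *)
Lemma fej_second_difference P :
  P.+2%:R *: fej P.+2 a + P%:R *: ('X^2 * fej P a) - (2 * P.+1)%:R *: ('X * fej P.+1 a) =
  a P.+1%:Z *: 'X^(2 * P + 3) + a (- P.+1%:Z) *: 'X.
Proof.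
apply/polyP => e; rewrite !(coefB, coefD, coefZ, coefXn, coefX) coefXnM coefXM natrM -mulrA.
case: e => [|[|e]].
- rewrite fej_coefE (_ : (P.+2 - (0 - P.+2 + (P.+2 - 0)))%N = 0%N); last by lia.
  rewrite (_ : (0 == 2 * P + 3)%N = false); last by lia.
  by rewrite /= mul0r !mulr0 !addr0 subr0.
- rewrite /= !fej_coefE (_ : (P.+2 - (1 - P.+2 + (P.+2 - 1)))%N = 1%N); last by lia.
  rewrite (_ : (P.+1 - (0 - P.+1 + (P.+1 - 0)))%N = 0%N); last by lia.
  rewrite (_ : (1 == 2 * P + 3)%N = false); last by lia.
  rewrite mul1r mul0r !mulr0 addr0 add0r subr0 mulr1.
  by congr a; lia.
rewrite /= subn2 /= !fej_coefE.
have -> : e.+2%:Z - P.+2%:Z = e%:Z - P%:Z by lia.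
have -> : e.+1%:Z - P.+1%:Z = e%:Z - P%:Z by lia.
rewrite mulrA -!mulrDl -mulrBl -natrM -natrD second_difference_weight natrD addrAC subrr add0r.
rewrite mulr0 addr0.
case: eqP => h; last by rewrite mul0r mulr0.
by rewrite mul1r mulr1; congr a; lia.
Qed.

Lemma drop_polyXnM n k (q : {poly C}) : drop_poly (n + k) ('X^n * q) = drop_poly k q.
Proof.
apply/polyP => i; rewrite !coef_drop_poly coefXnM ifF; last by lia.
by congr (q`_ _); lia.
Qed.

Lemma toeplitz_two_diagonals P (q : {poly C}) :
  a P.+1%:Z *: ('X^(P.+1) * q) + a (- P.+1%:Z) *: drop_poly P.+1 q =
  P.+2%:R *: fejer_toeplitz a P.+2 q + P%:R *: fejer_toeplitz a P q -
    (2 * P.+1)%:R *: fejer_toeplitz a P.+1 q.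
Proof.
rewrite !fejer_toeplitzE.
have -> : drop_poly P (fej P a * q) = drop_poly P.+2 ('X^2 * fej P a * q).
  by rewrite -mulrA -[P.+2]/(2 + P)%N drop_polyXnM.
have -> : drop_poly P.+1 (fej P.+1 a * q) = drop_poly P.+2 ('X * fej P.+1 a * q).
  by rewrite -mulrA -['X]expr1 -[P.+2]/(1 + P.+1)%N drop_polyXnM.
have dB (u v : {poly C}) : drop_poly P.+2 u - drop_poly P.+2 v = drop_poly P.+2 (u - v).
  by apply/polyP => i; rewrite !(coefB, coef_drop_poly).
transitivity (drop_poly P.+2 ((P.+2%:R *: fej P.+2 a + P%:R *: ('X^2 * fej P a) -
    (2 * P.+1)%:R *: ('X * fej P.+1 a)) * q)); last first.
  by rewrite mulrBl mulrDl -!scalerAl -dB drop_polyD !drop_polyZ.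
rewrite fej_second_difference mulrDl drop_polyD -!scalerAl !drop_polyZ; congr (_ *: _ + _ *: _).
  have -> : 'X^(2 * P + 3) * q = 'X^(P.+2) * ('X^(P.+1) * q).
    by rewrite mulrA -exprD; congr ('X^_ * _); lia.
  by have := drop_polyXnM P.+2 0 ('X^(P.+1) * q); rewrite addn0 drop_poly0l => ->.
by rewrite -['X]expr1 -[P.+2]/(1 + P.+1)%N drop_polyXnM.
Qed.

Variables (N : {poly C} -> R) (D : R).
Hypothesis N_ge0 : forall q, 0 <= N q.
Hypothesis ND : forall p q, N (p + q) <= N p + N q.
Hypothesis NZ : forall c p, N (c *: p) = rnorm c * N p.
Hypothesis ND_le : forall Q q, (0 < Q)%N -> N (fejer_toeplitz a Q q) <= D * N q.

Let NB p q : N (p - q) <= N p + N q.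
Proof. by rewrite -scaleN1r (le_trans (ND _ _))// NZ rnormN rnorm1 mul1r. Qed.

Lemma two_diagonals_bound P q :
  N (a P.+1%:Z *: ('X^(P.+1) * q) + a (- P.+1%:Z) *: drop_poly P.+1 q) <=
  4 * P.+1%:R * D * N q.
Proof.
rewrite toeplitz_two_diagonals (le_trans (NB _ _))//.
have h Q : N (Q%:R *: fejer_toeplitz a Q q) <= Q%:R * (D * N q).
  rewrite NZ rnorm_nat; case: Q => [|Q]; first by rewrite !mul0r.
  by rewrite ler_wpM2l// ND_le.
have h2 : N ((2 * P.+1)%:R *: fejer_toeplitz a P.+1 q) <= 2 * P.+1%:R * (D * N q).
  by rewrite NZ rnorm_nat natrM ler_wpM2l ?mulr_ge0// ND_le.
apply: (@le_trans _ _ (P.+2%:R * (D * N q) + P%:R * (D * N q) + 2 * P.+1%:R * (D * N q))).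
  by apply: lerD => //; apply: le_trans (ND _ _) _; apply: lerD; exact: h.
by apply: eq_ler; rewrite -!natr1; ring.
Qed.

(** If S_{-1} is bounded, only one of the two diagonals isolated by the second
    difference is not known to be bounded. *)
Lemma forward_diagonal_bound P (B : R) : a P.+1%:Z != 0 -> 0 <= B -> 0 <= D ->
  (forall q, N (drop_poly P.+1 q) <= B * N q) ->
  exists2 c, 0 <= c & forall q, N ('X^(P.+1) * q) <= c * N q.
Proof.
move=> aP B0 D0 hB; have ra : 0 < rnorm (a P.+1%:Z) by rewrite rnorm_gt0.
exists ((4 * P.+1%:R * D + rnorm (a (- P.+1%:Z)) * B) / rnorm (a P.+1%:Z)).
  by rewrite divr_ge0 ?(ltW ra)// addr_ge0// mulr_ge0 ?rnorm_ge0// mulr_ge0.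
move=> q; rewrite mulrAC ler_pdivlMr// mulrC -NZ.
rewrite -[_ *: _](addrK (a (- P.+1%:Z) *: drop_poly P.+1 q)) (le_trans (NB _ _))//.
rewrite mulrDl lerD ?two_diagonals_bound// NZ -mulrA ler_wpM2l ?rnorm_ge0//.
Qed.

Lemma backward_diagonal_bound P (B : R) : a (- P.+1%:Z) != 0 -> 0 <= B -> 0 <= D ->
  (forall q, N ('X^(P.+1) * q) <= B * N q) ->
  exists2 c, 0 <= c & forall q, N (drop_poly P.+1 q) <= c * N q.
Proof.
move=> aP B0 D0 hB; have ra : 0 < rnorm (a (- P.+1%:Z)) by rewrite rnorm_gt0.
exists ((4 * P.+1%:R * D + rnorm (a P.+1%:Z) * B) / rnorm (a (- P.+1%:Z))).
  by rewrite divr_ge0 ?(ltW ra)// addr_ge0// mulr_ge0 ?rnorm_ge0// mulr_ge0.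
move=> q; rewrite mulrAC ler_pdivlMr// mulrC -NZ.
rewrite -[_ *: _](addrK (a P.+1%:Z *: ('X^(P.+1) * q))) (le_trans (NB _ _))//.
rewrite mulrDl lerD//; first by rewrite addrC two_diagonals_bound.
by rewrite NZ -mulrA ler_wpM2l ?rnorm_ge0.
Qed.

End SecondDifference.

(** * The circles and the domains of holomorphy *)

Section Assembly.
Variables (R : realType) (E : completeNormedModType R[i]).
Local Notation C := R[i].
Variable j : E -> nat -> C.
Hypothesis j_linear : forall (a : C) (x y : E) (n : nat),
  j (a *: x + y) n = a * j x n + j y n.
Hypothesis j_inj : injective j.
Hypothesis F_sub : forall u : nat -> C, finsupp u -> exists x : E, j x = u.
Hypothesis F_dense : dense [set x : E | finsupp (j x)].
Hypothesis coord_cont : forall n : nat, continuous (fun x : E => j x n : R[i]^o).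

Lemma rotation_bound :
  (forall z : R[i], `|z| = 1 -> stable j (rotate z)) ->
  (ereal_sup [set opnorm (restriction j (rotate z))
             | z in [set z : R[i] | (`|z| = 1)%R]] < +oo)%E ->
  exists2 K : R, 0 < K & forall z x, rnorm z = 1 ->
    exists2 y, j y = rotate z (j x) & rnorm y <= K * rnorm x.
Proof.
move=> rst; set s := ereal_sup _ => sfin.
have [M sM] : exists M : R, (s <= M%:E)%E.
  move: sfin; case: s => [r|//|] _; first by exists r.
  by exists 0; rewrite leNye.
exists (`|M| + 1) => [|z x z1]; first by rewrite ltr_wpDl.
have z1' : `|z| = 1 by rewrite normE z1.
have jr y : j (restriction j (rotate z) y) = rotate z (j y).
  by rewrite /restriction; have [y' <-] := rst z z1' y; rewrite (seq_liftE j_inj (erefl _)).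
exists (restriction j (rotate z) x) => //.
have rM : (opnorm (restriction j (rotate z)) <= M%:E)%E.
  by apply: le_trans sM; apply: ereal_sup_ubound; exists z.
have rZ a y : restriction j (rotate z) (a *: y) = a *: restriction j (rotate z) y.
  apply: j_inj; apply/funext => i; rewrite (jZ j_linear) !jr /rotate (jZ j_linear).
  by rewrite mulrCA.
rewrite (le_trans (opnormP rZ rM x))// ler_wpM2r ?rnorm_ge0//.
by rewrite (le_trans (ler_norm M))// lerDl.
Qed.

Lemma interior_radii (P : R -> Prop) (z : C) :
  (interior [set w : R[i]^o | P (rnorm (w : C))]) z -> z != 0 ->
  exists r1 r2, [/\ 0 < r1, r1 < rnorm z, rnorm z < r2, P r1 & P r2].
Proof.
move=> /nbhs_ballP[e /= e0 he] z0.
have rz : 0 < rnorm z by rewrite rnorm_gt0.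
have er0 : 0 < rnorm (e : C) by rewrite rnorm_gt0 gt_eqF.
pose d := Num.min 2^-1 (rnorm (e : C) / (2 * rnorm z)).
have d0 : 0 < d by rewrite lt_min invr_gt0 ltr0n divr_gt0// mulr_gt0.
have d1 : d <= 2^-1 by rewrite ge_min lexx.
have dz : d * rnorm z < rnorm (e : C).
  apply: (@le_lt_trans _ _ (rnorm (e : C) / 2)); last by rewrite ltr_pdivrMr// ltr_pMr// ltrDl.
  rewrite -ler_pdivlMr// -mulrA -invfM ge_min; apply/orP; right.
  by rewrite lexx.
have inb (x : R) : `|x| = d -> 0 <= 1 + x -> P (rnorm z * (1 + x)).
  move=> xd x1; have -> : rnorm z * (1 + x) = rnorm (z * (1 + x)%:C).
    by rewrite rnormM rnorm_real ger0_norm.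
  apply: he; rewrite -ball_normE /ball_ /= normE -[ltRHS]gtr0_norm// [X in _ < X]normE ltcR.
  rewrite (_ : z - _ = - (z * x%:C)); last by rewrite rmorphD /=; ring.
  by rewrite rnormN rnormM rnorm_real xd mulrC.
exists (rnorm z * (1 - d)), (rnorm z * (1 + d)); split.
- by rewrite mulr_gt0//; lra.
- by rewrite gtr_pMr// gtrDl oppr_lt0.
- by rewrite ltr_pMr// ltrDl.
- by apply: inb; [rewrite normrN gtr0_norm|lra].
- by apply: inb; [rewrite gtr0_norm|lra].
Qed.

Lemma interior_zero (P : R -> Prop) :
  (interior [set w : R[i]^o | P (rnorm (w : C))]) 0 ->
  exists2 e : R, 0 < e & forall r, 0 <= r -> r < e -> P r.
Proof.
move=> /nbhs_ballP[e /= e0 he].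
have er0 : 0 < rnorm (e : C) by rewrite rnorm_gt0 gt_eqF.
exists (rnorm (e : C)) => // r r0 re.
have -> : r = rnorm (r%:C : C) by rewrite rnorm_real ger0_norm.
apply: he; rewrite -ball_normE /ball_ /= normE -[ltRHS]gtr0_norm// [X in _ < X]normE ltcR.
by rewrite sub0r rnormN rnorm_real ger0_norm.
Qed.

Variable K : R.
Hypothesis K0 : 0 < K.
Hypothesis rot : forall z x, rnorm z = 1 ->
  exists2 y, j y = rotate z (j x) & rnorm y <= K * rnorm x.

Local Notation emb := (emb j).
Local Notation N := (emb_norm j).

Let ND := ND j_linear j_inj F_sub.
Let NZ := NZ j_linear j_inj F_sub.
Let N_ge0 := @N_ge0 R E j.
Let N_gt0 := N_gt0 j_linear j_inj F_sub.
Let N_rotp := N_rotp j_inj F_sub rot.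
Let jemb := jemb j_inj F_sub.

Let shiftX_lower r (st : stable j shift_fwd) :=
  spectral_lower_bound j_linear j_inj F_sub F_dense coord_cont K0 rot (copies_fwd R) (@fwd_poly R) st (r := r).
Let shiftD_lower r (st : stable j shift_bwd) :=
  spectral_lower_bound j_linear j_inj F_sub F_dense coord_cont K0 rot (copies_bwd R) (@bwd_poly R) st (r := r).
Let shiftX_bounded (st : stable j shift_fwd) :=
  shift_bounded j_linear j_inj F_sub F_dense coord_cont K0 rot (copies_fwd R) (@fwd_poly R) st.
Let shiftD_bounded (st : stable j shift_bwd) :=
  shift_bounded j_linear j_inj F_sub F_dense coord_cont K0 rot (copies_bwd R) (@bwd_poly R) st.

Let iterX n (q : {poly C}) : (fun i => ('X^n * q)`_i) = iter n shift_fwd (fun i => q`_i).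
Proof.
elim: n => [|n ih]; first by rewrite expr0 mul1r.
by rewrite iterS -ih exprS -mulrA fwd_poly.
Qed.

Let iterD n (q : {poly C}) : (fun i => (drop_poly n q)`_i) = iter n shift_bwd (fun i => q`_i).
Proof.
rewrite -iter_shiftD; elim: n => [|n ih] //=.
by rewrite -ih bwd_poly.
Qed.

Let iter_cancel n (v : nat -> C) : iter n shift_bwd (iter n shift_fwd v) = v.
Proof. by elim: n v => // n ih v; rewrite iterSr; exact: ih. Qed.

Let iter_fwd n (v : nat -> C) i : iter n shift_fwd v i = if (i < n)%N then 0 else v (i - n)%N.
Proof.
by elim: n i => [|n ih] [|i] //=.
Qed.

Let iter_bwd n (v : nat -> C) i : iter n shift_bwd v i = v (i + n)%N.
Proof. by elim: n i => [|n ih] i /=; rewrite ?addn0// /shift_bwd ih addSnnS. Qed.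

Lemma stable_iter A n : stable j A -> stable j (iter n A).
Proof.
move=> st x; elim: n => [|n [y jy]]; first by exists x.
by have [y' jy'] := st y; exists y'; rewrite jy' jy.
Qed.

(** S = S_{-1}^P S^(P + 1). *)
Lemma stable_fwd_of_power P c : 0 <= c -> (forall q, N ('X^(P.+1) * q) <= c * N q) ->
  stable j shift_bwd -> stable j shift_fwd.
Proof.
move=> c0 hc st x.
have [y jy _] := extend_operator j_linear j_inj F_sub F_dense coord_cont
  (copies_iter P.+1 (copies_fwd R)) (iterX P.+1) c0 hc x.
have [z jz] := stable_iter P st y.
by exists z; rewrite jz jy iterSr iter_cancel.
Qed.

(** S^P S_{-1}^(P + 1) is S_{-1} up to the first [P] coordinates, which a
    polynomial corrects. *)
Lemma stable_bwd_of_power P c : 0 <= c -> (forall q, N (drop_poly P.+1 q) <= c * N q) ->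
  stable j shift_fwd -> stable j shift_bwd.
Proof.
move=> c0 hc st x.
have [y jy _] := extend_operator j_linear j_inj F_sub F_dense coord_cont
  (copies_iter P.+1 (copies_bwd R)) (iterD P.+1) c0 hc x.
have [z jz] := stable_iter P st y.
exists (z + emb (\poly_(i < P) j x i.+1)); apply/funext => i.
rewrite (jD j_linear) jemb coef_poly jz iter_fwd jy iter_bwd /shift_bwd.
case: ltnP => h; first by rewrite add0r.
by rewrite addr0; congr (j x _); lia.
Qed.

(** S_{-1} kills e_0, so that 0 is in its spectrum; in particular the supremum
    that defines rho is not taken over the empty set. *)
Lemma rho_bwd_ge0 : stable j shift_bwd -> (0 <= rho (op_graph j shift_bwd))%E.
Proof.
move=> st; apply: ereal_sup_ubound; exists 0; last by rewrite rnorm0.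
rewrite /spec /= => -[B [_ h _]].
have g : (op_graph j shift_bwd) (emb 1, 0).
  rewrite /op_graph asboolT//=; apply/funext => i; rewrite (j0 j_linear) jemb.
  by rewrite /shift_bwd coef1.
have := h _ _ g; rewrite scale0r subrr linear0 => e.
have := congr1 (fun x => j x 0%N) e; rewrite (j0 j_linear) jemb coef1 => /esym/eqP.
by rewrite oner_eq0.
Qed.

Lemma inve_le_bwd r : stable j shift_bwd -> 0 < r ->
  ((rho (op_graph j shift_bwd))^-1 <= r%:E)%E -> ((r^-1)%:E <= rho (op_graph j shift_bwd))%E.
Proof.
move=> /rho_bwd_ge0 + r0; case: (rho _) => [x| |]; [|by move=> _ _; rewrite leey|by []].
rewrite lee_fin => x0; have [->|xn] := eqVneq x 0; first by rewrite inve0.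
by rewrite inver (negPf xn) !lee_fin => h; rewrite -[x]invrK lef_pV2 ?posrE// invr_gt0 lt0r xn.
Qed.

Variables (T : {linear E -> E}) (tau : R).
Hypothesis tau0 : 0 <= tau.
Hypothesis T_le : forall x, rnorm (T x) <= tau * rnorm x.
Hypothesis T_toeplitz : toeplitz j T.
Let a := toeplitz_coef j T.

Let T_lin c x y : T (c *: x + y) = c *: T x + T y.
Proof. exact: linearP. Qed.

Let e_emb k : seq_lift j (e_ k) = emb 'X^k.
Proof.
apply: seq_liftE => //; rewrite jemb; apply/funext => n.
by rewrite coefXn.
Qed.

Lemma toeplitz_entries i k : j (T (emb 'X^k)) i = a (i%:Z - k%:Z).
Proof.
have step n m : j (T (emb 'X^(n.+1))) m.+1 = j (T (emb 'X^n)) m.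
  have [_ h] := T_toeplitz.
  have fs : finsupp (e_ n : nat -> C).
    by exists n.+1 => l nl; rewrite /e_ gtn_eqF.
  have := congr1 (fun u => u m) (h _ fs).
  have -> : shift_fwd (e_ n) = e_ n.+1 :> (nat -> C).
    by apply/funext => -[|l].
  by rewrite !e_emb.
have a0 m : a m%:Z = j (T (emb 'X^0)) m by rewrite -e_emb.
have aN m : a (- m.+1%:Z) = j (T (emb 'X^(m.+1))) 0%N by rewrite -e_emb -NegzE.
elim: k i => [|k ih] [|i].
- by rewrite subrr -a0.
- by rewrite subr0 a0.
- by rewrite sub0r aN.
- rewrite step ih; congr a; lia.
Qed.

Let fejer_power := fejer_power j_linear j_inj F_sub F_dense coord_cont K0 rot T_lin tau0 T_le.
Let entry_lim := entry_lim j_linear j_inj F_sub F_dense coord_cont K0 rot T_lin tau0 T_le toeplitz_entries.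

Let ent1 i k : entry j T 1 i k = a (i%:Z - k%:Z).
Proof. exact: toeplitz_entries. Qed.

Let fejer_toeplitz_le Q q : (0 < Q)%N -> N (fejer_toeplitz a Q q) <= K ^+ 2 * tau * N q.
Proof.
move=> Q0; have := fejer_power 1 q Q0; rewrite expr1 /fejer_toeplitz.
by rewrite (_ : entry j T 1 = fun i k => a (i%:Z - k%:Z))//; apply/funext => i; apply/funext => k.
Qed.

Let D0 : 0 <= K ^+ 2 * tau.
Proof. by rewrite mulr_ge0// exprn_ge0// ltW. Qed.

Lemma coef_pos_vanish : stable j shift_bwd -> ~ stable j shift_fwd -> forall n, a n.+1%:Z = 0.
Proof.
move=> sb nf P; apply/eqP; apply: contra_notT nf => aP.
have [B B1 hB] := shiftD_bounded sb.
have B0 : 0 <= B := le_trans ler01 B1.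
have dB q : N (drop_poly P.+1 q) <= B ^+ P.+1 * N q.
  rewrite -iter_shiftD; elim: P.+1 => [|n ih]; first by rewrite expr0 mul1r.
  by rewrite iterS exprS -mulrA (le_trans (hB _))// ler_wpM2l.
have BP : 0 <= B ^+ P.+1 by rewrite exprn_ge0.
have [c c0 hc] := forward_diagonal_bound ND NZ fejer_toeplitz_le aP BP D0 dB.
exact: stable_fwd_of_power c0 hc sb.
Qed.

Lemma coef_neg_vanish : stable j shift_fwd -> ~ stable j shift_bwd -> forall n, a (Negz n) = 0.
Proof.
move=> sf nb P; rewrite NegzE; apply/eqP; apply: contra_notT nb => aP.
have [B B1 hB] := shiftX_bounded sf.
have B0 : 0 <= B := le_trans ler01 B1.
have dB q : N ('X^(P.+1) * q) <= B ^+ P.+1 * N q.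
  rewrite -iter_shiftX; elim: P.+1 => [|n ih]; first by rewrite expr0 mul1r.
  by rewrite iterS exprS -mulrA (le_trans (hB _))// ler_wpM2l.
have BP : 0 <= B ^+ P.+1 by rewrite exprn_ge0.
have [c c0 hc] := backward_diagonal_bound ND NZ fejer_toeplitz_le aP BP D0 dB.
exact: stable_bwd_of_power c0 hc sf.
Qed.

Let rhoS := rho (op_graph j shift_fwd).
Let rhoS1 := rho (op_graph j shift_bwd).

Definition power_l2_bounded r := forall m e, 0 < e -> exists M0, forall M, (M0 <= M)%N ->
  l2 r (fej M a ^+ m) <= (2 * K ^+ 4 * tau ^+ (2 * m) + e) * r ^+ (2 * (m * M)).

Let b := 1 + K ^+ 2 * tau ^+ 1.
Let b1 : 1 <= b. Proof. by rewrite lerDl expr1. Qed.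

Let power_l2_of_all c r : 0 < r ->
  (forall m d, ccvg (fun M => pow_coef a m M d) (c m d)) ->
  all_powers_bounded K a tau c r ->
  fej_bounded a (K ^+ 2 * tau) r /\ power_l2_bounded r.
Proof.
move=> r0 c_lim [h1 hc]; rewrite expr1 in h1; split => // m e e0.
have be0 : 0 <= K ^+ 2 * tau ^+ m by rewrite mulr_ge0 ?exprn_ge0 ?(ltW K0).
have P_le Q z : (0 < Q)%N -> rnorm z = r -> rnorm (fej Q a).[z] <= b * r ^+ Q.
  move=> Q0 zr; rewrite (le_trans (h1 Q z Q0 zr))// ler_wpM2r ?exprn_ge0 ?(ltW r0)//.
  by rewrite /b expr1 lerDr.
have [M0 hM] := power_l2 r0 b1 P_le c_lim be0 (hc m) e0.
exists M0 => M /hM /le_trans; apply; apply: eq_ler; congr ((_ + _) * _).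
by rewrite exprMn -!exprM [(m * 2)%N]mulnC mulrA.
Qed.

Let limits_exist r : 0 < r -> fej_bounded a (K ^+ 2 * tau ^+ 1) r ->
  exists c, forall m d, ccvg (fun M => pow_coef a m M d) (c m d).
Proof.
move=> r0 h1.
have P_le Q z : (0 < Q)%N -> rnorm z = r -> rnorm (fej Q a).[z] <= b * r ^+ Q.
  move=> Q0 zr; rewrite (le_trans (h1 Q z Q0 zr))// ler_wpM2r ?exprn_ge0 ?(ltW r0)//.
  by rewrite /b lerDr.
have /choice[c hc] : forall md : nat * int, exists l, ccvg (fun M => pow_coef a md.1 M md.2) l.
  by move=> [m d]; exact: pow_coef_cvg r0 b1 P_le m d.
by exists (fun m d => c (m, d)) => m d; exact: (hc (m, d)).
Qed.

(** If one shift is not bounded, the coefficients on its side vanish and the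
    critical circle of the other one suffices. *)
Lemma circle_bounds r : stable j shift_fwd \/ stable j shift_bwd -> 0 < r ->
  (stable j shift_fwd -> (r%:E <= rhoS)%E) -> (stable j shift_bwd -> (rhoS1^-1 <= r%:E)%E) ->
  fej_bounded a (K ^+ 2 * tau) r /\ power_l2_bounded r.
Proof.
move=> sor r0 hf hb.
have rV0 : 0 < r^-1 by rewrite invr_gt0.
have fwd (st : stable j shift_fwd) : exists B rp : R, [/\ 1 <= B,
    forall q : {poly C}, N ('X * q) <= B * N q, r <= rp & power_radius N ( *%R ('X : {poly C})) rp].
  have [B B1 hB] := shiftX_bounded st.
  have sZ (x : C) (q : {poly C}) : 'X * (x *: q) = x *: ('X * q) by rewrite scalerAr.
  have [rp h1 h2] := radius_exists N_ge0 NZ N_gt0 sZ B1 hB r0 (shiftX_lower st r0 (hf st)).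
  by exists B, rp.
have bwd (st : stable j shift_bwd) : exists B rm : R, [/\ 1 <= B,
    forall q : {poly C}, N (drop_poly 1 q) <= B * N q, 0 < rm, rm <= r & power_radius N (drop_poly 1) rm^-1].
  have [B B1 hB] := shiftD_bounded st.
  have sZ (x : C) (q : {poly C}) : drop_poly 1 (x *: q) = x *: drop_poly 1 q by exact: drop_polyZ.
  have [rm h1 h2] := radius_exists N_ge0 NZ N_gt0 sZ B1 hB rV0
    (shiftD_lower st rV0 (inve_le_bwd st r0 (hb st))).
  have rm0 := lt_le_trans rV0 h1.
  exists B, rm^-1; split => //; rewrite ?invr_gt0 ?invrK//.
  by rewrite -[leRHS]invrK lef_pV2 ?posrE.
have [sf|nf] := pselect (stable j shift_fwd); have [sb|nb] := pselect (stable j shift_bwd).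
- have [B [rp [B1 hB rrp Rp]]] := fwd sf; have [B' [rm [B'1 hB' rm0 rmr Rm]]] := bwd sb.
  have rp0 := lt_le_trans r0 rrp.
  have h1 := forward_bound K0 N_ge0 ND NZ N_gt0 N_rotp tau0 fejer_power B1 hB Rp
    (geometric_defect1 ent1).
  have [c hc] := limits_exist rp0 h1.
  apply: (power_l2_of_all r0 hc).
  have Bm1 : 1 <= Num.max B B' by rewrite le_max B1.
  apply: (bilateral_case K0 N_ge0 ND NZ N_gt0 N_rotp tau0 ent1 fejer_power entry_lim hc Bm1 _ _ rm0 Rp Rm rmr rrp).
    by move=> q; rewrite (le_trans (hB q))// ler_wpM2r// le_max lexx.
  by move=> q; rewrite (le_trans (hB' q))// ler_wpM2r// le_max lexx orbT.
- have [B [rp [B1 hB rrp Rp]]] := fwd sf.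
  have rp0 := lt_le_trans r0 rrp.
  have h1 := forward_bound K0 N_ge0 ND NZ N_gt0 N_rotp tau0 fejer_power B1 hB Rp
    (geometric_defect1 ent1).
  have [c hc] := limits_exist rp0 h1.
  apply: (power_l2_of_all r0 hc).
  exact: (analytic_case K0 N_ge0 ND NZ N_gt0 N_rotp tau0 ent1 fejer_power entry_lim hc B1 hB Rp
    (coef_neg_vanish sf nb) r0 rrp).
- have [B' [rm [B'1 hB' rm0 rmr Rm]]] := bwd sb.
  have h1 := backward_bound K0 N_ge0 ND NZ N_gt0 N_rotp tau0 fejer_power B'1 hB' rm0 Rm
    (geometric_defect1 ent1).
  have [c hc] := limits_exist rm0 h1.
  apply: (power_l2_of_all r0 hc).
  exact: (coanalytic_case K0 N_ge0 ND NZ N_gt0 N_rotp tau0 ent1 fejer_power entry_lim hc B'1 hB' rm0 Rm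
    (coef_pos_vanish sb nf) rmr).
- by case: sor.
Qed.

Lemma boundary_Linfty r : stable j shift_fwd \/ stable j shift_bwd -> 0 < r ->
  (rhoS1^-1 <= r%:E)%E -> (r%:E <= rhoS)%E -> laurent_Linfty_le a r tau%:E.
Proof.
move=> sor r0 h1 h2; have [ab pb] := circle_bounds sor r0 (fun=> h2) (fun=> h1).
apply: (laurent_boundary r0 tau0 _ b1 pb) => Q z Q0 zr.
have rQ : 0 <= r ^+ Q := ltW (exprn_gt0 Q r0).
apply: le_trans (ab Q z Q0 zr) _; apply: ler_wpM2r => //.
by rewrite /b expr1 lerDr.
Qed.

(** For such radii 1/r <= rho(S_{-1}), which is at most the norm of S_{-1}. *)
Lemma bwd_radii_away : stable j shift_bwd ->
  ~ (exists2 e : R, 0 < e & forall r, 0 <= r -> r < e -> (rhoS1^-1 <= r%:E)%E).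
Proof.
move=> st [e e0 he]; have [B B1 hB] := shiftD_bounded st.
have B0 : 0 < B := lt_le_trans ltr01 B1.
pose r := Num.min (e / 2) (B^-1 / 2).
have r0 : 0 < r by rewrite lt_min !divr_gt0// invr_gt0.
have re : r < e by rewrite (@le_lt_trans _ _ (e / 2)) ?ge_min ?lexx// ltr_pdivrMr// ltr_pMr// ltrDl.
have rB : r < B^-1.
  rewrite (@le_lt_trans _ _ (B^-1 / 2)) ?ge_min ?lexx ?orbT//.
  by rewrite ltr_pdivrMr// ltr_pMr ?invr_gt0// ltrDl.
have rV0 : 0 < r^-1 by rewrite invr_gt0.
have := shiftD_lower st rV0 (inve_le_bwd st r0 (he r (ltW r0) re)) 1.
move=> /le_trans /(_ (opN_iter_le NZ B1 hB 1)); rewrite !expr1 leNgt.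
by rewrite -[ltLHS]invrK ltf_pV2 ?posrE ?invr_gt0// rB.
Qed.

Lemma annulus_Hinfty (P : R -> Prop) : stable j shift_fwd \/ stable j shift_bwd ->
  (forall r, 0 < r -> P r -> (stable j shift_fwd -> (r%:E <= rhoS)%E) /\
     (stable j shift_bwd -> (rhoS1^-1 <= r%:E)%E)) ->
  (forall r, P r -> stable j shift_bwd -> (rhoS1^-1 <= r%:E)%E) ->
  laurent_Hinfty a (interior [set z : R[i]^o | P (rnorm (z : C))]).
Proof.
move=> sor hP hP1; apply: (@laurent_Hinfty_of_fejer _ _ _ (K ^+ 2 * tau)) => //.
  move=> z Oz z0; have [r1 [r2 [r10 r1z zr2 P1 P2]]] := interior_radii Oz z0.
  have r20 : 0 < r2 by rewrite (lt_trans r10)// (lt_trans r1z).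
  have [f1 g1] := hP _ r10 P1; have [f2 g2] := hP _ r20 P2.
  exists r1, r2; split => //.
    by have [] := circle_bounds sor r10 f1 g1.
  by have [] := circle_bounds sor r20 f2 g2.
move=> /interior_zero[e e0 he].
have nb : ~ stable j shift_bwd.
  move=> sb; apply: (bwd_radii_away sb); exists e => // r r0 re.
  by apply: hP1 sb; exact: he.
have sf : stable j shift_fwd by case: sor.
split; first exact: coef_neg_vanish.
have e2 : 0 < e / 2 by rewrite divr_gt0.
exists (e / 2) => //; have [f2 g2] : (stable j shift_fwd -> ((e / 2)%:E <= rhoS)%E) /\
     (stable j shift_bwd -> (rhoS1^-1 <= (e / 2)%:E)%E).
  by apply: hP => //; apply: he; rewrite ?(ltW e2)// ltr_pdivrMr// ltr_pMr// ltrDl.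
by have [] := circle_bounds sor e2 f2 g2.
Qed.

End Assembly.

Theorem theorem2 (R : realType) (E : completeNormedModType R[i])
  (j : E -> nat -> R[i])
  (j_linear : forall (a : R[i]) (x y : E) (n : nat),
     j (a *: x + y) n = a * j x n + j y n)
  (j_inj : injective j)
  (F_sub : forall u : nat -> R[i], finsupp u -> exists x : E, j x = u)
  (F_dense : dense [set x : E | finsupp (j x)])
  (coord_cont : forall n : nat, continuous (fun x : E => j x n : R[i]^o))
  (rot_stable : forall z : R[i], `|z| = 1 -> stable j (rotate z))
  (rot_bounded : (ereal_sup [set opnorm (restriction j (rotate z))
                            | z in [set z : R[i] | (`|z| = 1)%R]] < +oo)%E)
  (shift_or : stable j shift_fwd \/ stable j shift_bwd)
  (T : {linear E -> E}) (T_toeplitz : toeplitz j T) :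
  let a := toeplitz_coef j T in
  let rhoS := rho (op_graph j shift_fwd) in
  let rhoS1 := rho (op_graph j shift_bwd) in
  [/\ forall r : R, 0 < r -> (rhoS1^-1 <= r%:E)%E -> (r%:E <= rhoS)%E ->
        laurent_Linfty_le a r (opnorm T),
      stable j shift_fwd -> stable j shift_bwd -> (rhoS1^-1 < rhoS)%E ->
        laurent_Hinfty a
          (interior [set z : R[i]^o | (rhoS1^-1 <= (rnorm z)%:E <= rhoS)%E]),
      ~ stable j shift_fwd -> stable j shift_bwd ->
        laurent_Hinfty a
          (interior [set z : R[i]^o | (rhoS1^-1 <= (rnorm z)%:E)%E])
    & stable j shift_fwd -> ~ stable j shift_bwd ->
        laurent_Hinfty a
          (interior [set z : R[i]^o | ((rnorm z)%:E <= rhoS)%E])].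
Proof.
move=> a rhoS rhoS1.
have [K K0 rot] := rotation_bound j_linear j_inj rot_stable rot_bounded.
have [tau tau0 [-> T_le]] := opnorm_fin T_toeplitz.1.
have hinf := annulus_Hinfty j_linear j_inj F_sub F_dense coord_cont K0 rot tau0 T_le T_toeplitz.
split.
- move=> r r0 h1 h2.
  exact: (boundary_Linfty j_linear j_inj F_sub F_dense coord_cont K0 rot tau0 T_le T_toeplitz).
- move=> sf sb _; apply: (hinf (fun r => (rhoS1^-1 <= r%:E <= rhoS)%E) shift_or).
    by move=> r _ /andP[].
  by move=> r /andP[].
- move=> nf sb; apply: (hinf (fun r => (rhoS1^-1 <= r%:E)%E) shift_or) => // r _ h; split => //.
- move=> sf nb; apply: (hinf (fun r => (r%:E <= rhoS)%E) shift_or) => // r _ h; split => //.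
Qed.
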